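(* For every $\epsilon \in (0, 1/2)$, there is a deterministic distributed algorithm in the LOCAL model that, run on an $n$-node chordal graph $G$, computes an independent set $I$ of $G$ with $\alpha(G) \le (1+\epsilon)|I|$ (a $(1+\epsilon)$-approximation to Maximum Independent Set) in $\mathrm{O}(\frac{1}{\epsilon}\log(\frac{1}{\epsilon})\log^* n)$ rounds.
   Context: A graph is chordal if every cycle on at least four vertices has a chord, i.e., an edge joining two non-consecutive vertices of the cycle. $\alpha(G)$ denotes the maximum size of an independent set in $G$. In the LOCAL model, the input graph $G=(V,E)$ is the communication network; each node has a unique ID and initially knows only its own ID and its neighbors. Computation proceeds in synchronous rounds; in each round every node performs unlimited local computation and then sends messages of unbounded size to each of its neighbors. The running time is the number of rounds. At termination every node must know whether it belongs to the output independent set.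
   Formalization: The unique IDs are assumed to lie in {1,…,n^c} for an arbitrary fixed c, on which the algorithm and the O-constant may depend; with unbounded IDs the claim fails, by a Ramsey argument on paths. *)

(* Defs.v *)
From mathcomp Require Import all_boot all_order all_algebra.
From mathcomp Require Import all_classical all_reals all_analysis.

Set Implicit Arguments.
Unset Strict Implicit.
Unset Printing Implicit Defensive.

Import Order.TTheory GRing.Theory Num.Theory.

Definition simple_graph (T : finType) (e : rel T) : Prop :=
  symmetric e /\ irreflexive e.

(* [ucycle e p]: the vertices of p are pairwise distinct and cyclically
   adjacent; [next p x] is the successor of x on the cycle. *)
Definition chordal (T : finType) (e : rel T) : Prop :=
  forall p : seq T, ucycle e p -> (4 <= size p)%N ->
  exists x y : T, [/\ x \in p, y \in p, e x y, y != next p x & x != next p y].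

Definition independent (T : finType) (e : rel T) (S : {set T}) : bool :=
  [forall x in S, forall y in S, ~~ e x y].

Definition alpha (T : finType) (e : rel T) : nat :=
  \max_(S : {set T} | independent e S) #|S|.

(* Unique identifiers from the usual range {1, ..., n^c}, n = #|T|. *)
Definition id_assignment (c : nat) (T : finType) (id : T -> nat) : Prop :=
  injective id /\ forall v, (0 < id v <= #|T| ^ c)%N.

(* A deterministic algorithm of the LOCAL model.  It does not depend on the
   graph; in particular the number of nodes is not given to it.
   - [init i s]: initial state of a node with identifier i whose neighbours
     have the identifiers listed (in increasing order) in s;
   - [send q j]: message that a node in state q sends to its neighbour j;
   - [receive q ms]: new state after a round in which ms was received, each
     message being paired with the identifier of its sender;
   - [decide q]: [Some b] if a node in state q commits to the answer b (b is
     true iff the node joins the output set), [None] if it is not ready yet.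
   The functions are arbitrary, as local computation is unlimited. *)
Record local_algorithm := LocalAlgorithm {
  state : Type;
  message : Type;
  init : nat -> seq nat -> state;
  send : state -> nat -> message;
  receive : state -> seq (nat * message) -> state;
  decide : state -> option bool
}.

(* Sorting by identifier makes the list independent of the enumeration of T,
   so that nothing but the identifiers is revealed to a node. *)
Definition neighbours (T : finType) (e : rel T) (id : T -> nat) (v : T) :
    seq T :=
  sort (fun x y => (id x <= id y)%N) (enum (e v)).

Fixpoint state_after (A : local_algorithm) (T : finType) (e : rel T)
    (id : T -> nat) (t : nat) (v : T) : state A :=
  match t with
  | 0 => init A (id v) [seq id w | w <- neighbours e id v]
  | t'.+1 =>
      receive (state_after A e id t' v)
        [seq (id w, send (state_after A e id t' w) (id v))
           | w <- neighbours e id v]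
  end.

(* The output register of a node is write-once: the first answer is final,
   although the node may keep on relaying messages. *)
Fixpoint output_after (A : local_algorithm) (T : finType) (e : rel T)
    (id : T -> nat) (t : nat) (v : T) : option bool :=
  match t with
  | 0 => decide (state_after A e id 0 v)
  | t'.+1 =>
      if output_after A e id t' v is Some b then Some b
      else decide (state_after A e id t v)
  end.

Definition computes_in (A : local_algorithm) (T : finType) (e : rel T)
    (id : T -> nat) (r : nat) (I : {set T}) : Prop :=
  forall v : T, output_after A e id r v = Some (v \in I).

Local Open Scope ring_scope.

Definition log2 (R : realType) (x : R) : R := ln x / ln 2.

Lemma log_star_ex (R : realType) (n : nat) :
  exists k, iter k (@log2 R) n%:R <= 1.
Proof.
suff H m (x : R) : x <= m.+1%:R -> exists k, iter k (@log2 R) x <= 1.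
  by apply: (H n); rewrite ler_nat.
elim: m x => [|m IH] x le_x; first by exists 0%N.
have [x_le1|x_gt1] := leP x 1; first by exists 0%N.
have x_gt0 : 0 < x by apply: lt_trans x_gt1.
have [|k Hk] := IH (log2 x); last by exists k.+1; rewrite iterSr.
have ln2_gt0 : 0 < ln 2 :> R by rewrite ln_gt0 ?ltr1n.
rewrite /log2 ler_pdivrMr // mulr_natl -lnXn ?ltr0n //.
rewrite ler_ln ?posrE ?exprn_gt0 ?ltr0n //.
by apply: le_trans le_x _; rewrite -natrX ler_nat ltn_expl.
Qed.

(* The least number of applications of the binary logarithm that bring n to
   at most 1. *)
Definition log_star (R : realType) (n : nat) : nat :=
  ex_minn (log_star_ex R n).

(* Main.v *)
Require Import Defs.
From mathcomp Require Import all_boot all_order all_algebra.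
From mathcomp Require Import all_classical all_reals all_analysis.
From mathcomp Require Import zify ring lra finmap.

(* Weigh the edges of the graph of maximal cliques by the size of the
   intersection, ties being broken.  In a chordal graph the edges whose ends are
   not joined by heavier edges (the Kruskal forest) form a clique tree.  With
   K ~ 2 / eps, the blocks are the maximal components at a weight threshold that
   span fewer than K independent vertices; their diameter is O(K).  A block that
   is not a whole component of the graph points along its heaviest outgoing
   edge.  Weights increase along pointers, and a pair of blocks that point to
   each other spans K independent vertices.

   Call a stretch of a pointer path near if it spans fewer than K independent
   vertices.  Labels in which equal values within a near stretch are separated
   by a larger one are reduced log* n times, taking maxima over near stretches
   and then highest differing bits, until only O(log* n) values remain.  The
   maxima of the last values over near stretches keep changing, hence going down,
   and no descent is near an ascent before it.  Cutting the paths at the descents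
   that end a stretch that is not near gives clusters of diameter O(K log* n),
   each of which spans K independent vertices or is a whole component of the
   graph.

   Take a maximum independent set in each cluster after dropping the vertices
   that also lie in cliques of another cluster.  By the clique tree property at
   most twice as many independent vertices are lost as there are clusters that
   span K of them, a fraction O(1 / K) of the optimum.  Each step depends on a
   ball only, so a node may answer as soon as its view determines the result:
   no bound on n has to be known. *)

Set Implicit Arguments.
Unset Strict Implicit.
Unset Printing Implicit Defensive.

Import Order.TTheory GRing.Theory Num.Theory.

Local Open Scope fset_scope.
Local Open Scope nat_scope.

(** Many pointer steps may gain few independent vertices, so windows are measured by independent
    vertices and not by steps. This is compatible with locality because a connected set without K
    independent vertices has diameter at most 2K, the source of all radii below. Pointer paths are
    treated as infinite: in the end they alternate between two blocks that point to each other, and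
    as such a pair is never near, the ends of paths need no separate case. Locality is a comparison
    of two graphs that agree on a ball. The second graph stands for any network that produces the
    same view and may be far larger, so bounds on names, and the distances derived from them, are
    used in the first graph only. Chordality enters only through [fan]: a vertex adjacent to both
    ends of an induced path is adjacent to all of it. *)

Lemma high_bit_ex (x y : nat) : exists i, x %/ 2 ^ i.+1 == y %/ 2 ^ i.+1.
Proof.
exists (x + y); have lt z : z <= x + y -> z < 2 ^ (x + y).+1.
  by move=> le_z; apply: leq_ltn_trans (ltnW (ltn_expl _ _)) => //; lia.
by rewrite !divn_small ?lt //; lia.
Qed.

Definition high_bit x y := ex_minn (high_bit_ex x y).

Lemma divn_exp2S x i : x %/ 2 ^ i.+1 = x %/ 2 ^ i %/ 2.
Proof. by rewrite expnSr divnMA. Qed.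

Lemma divn_exp2_eq x y i j : i <= j ->
  x %/ 2 ^ i = y %/ 2 ^ i -> x %/ 2 ^ j = y %/ 2 ^ j.
Proof. by move=> /subnKC <- eq_i; rewrite expnD !divnMA eq_i. Qed.

Lemma high_bitP x y : x <> y ->
  x %/ 2 ^ (high_bit x y).+1 = y %/ 2 ^ (high_bit x y).+1 /\
  x %/ 2 ^ high_bit x y <> y %/ 2 ^ high_bit x y.
Proof.
rewrite /high_bit; case: ex_minnP => i /eqP eq_i min_i neq; split=> //.
case: i eq_i min_i => [|i] eq_i min_i eq_xy.
  by apply: neq; rewrite !expn0 !divn1 in eq_xy.
by move/eqP: eq_xy => /min_i; rewrite ltnn.
Qed.

Lemma high_bit_ge x y j : x %/ 2 ^ j <> y %/ 2 ^ j -> j <= high_bit x y.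
Proof.
move=> neq; rewrite leqNgt; apply/negP => lt; apply: neq.
have neq : x <> y -> x %/ 2 ^ j = y %/ 2 ^ j.
  by move=> neq; apply: divn_exp2_eq lt _; case: (high_bitP neq).
by case: (eqVneq x y) => [->//|/eqP].
Qed.

Lemma high_bit_lt k x y : x <> y -> x < 2 ^ k -> y < 2 ^ k -> high_bit x y < k.
Proof.
move=> neq ltx lty; rewrite ltnNge; apply/negP => le_k.
have [_] := high_bitP neq; apply.
by apply: divn_exp2_eq le_k _; rewrite !divn_small.
Qed.

(** Above the highest differing bit the two numbers share the prefix [h]; at that bit the larger one
    has 1 and the smaller one 0. *)
Lemma high_bit_halves x y : y < x -> exists h,
  x %/ 2 ^ high_bit x y = h.*2.+1 /\ y %/ 2 ^ high_bit x y = h.*2.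
Proof.
move=> lt_yx; have [|eqS neq] := @high_bitP x y; first lia.
have le: y %/ 2 ^ high_bit x y <= x %/ 2 ^ high_bit x y by apply/leq_div2r/ltnW.
by exists (y %/ 2 ^ (high_bit x y).+1); move: eqS; rewrite !divn_exp2S; lia.
Qed.

(* Every descent is labelled above all ascents.  Along a monotone run of values,
   a bit can be the highest to change twice only if a higher one changes in
   between. *)
Definition step_label k x y :=
  if x == y then 0
  else if x < y then (high_bit x y).+1 else (k + high_bit x y).+1.

Lemma high_bitC x y : high_bit x y = high_bit y x.
Proof.
have eqP : (fun i => x %/ 2 ^ i.+1 == y %/ 2 ^ i.+1) =1
          (fun i => y %/ 2 ^ i.+1 == x %/ 2 ^ i.+1) by move=> i; rewrite eq_sym.
exact: (eq_ex_minn (high_bit_ex x y) (high_bit_ex y x) eqP).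
Qed.

Lemma step_label_gt0 k x y : (0 < step_label k x y) = (x != y).
Proof. by rewrite /step_label; case: eqP => //; case: ifP. Qed.

Lemma step_label_le k x y : x < 2 ^ k -> y < 2 ^ k -> step_label k x y <= k.*2.
Proof.
move=> ltx lty; rewrite /step_label; case: eqP => // neq.
by have := high_bit_lt neq ltx lty; case: ifP; lia.
Qed.

(** * Separated sequences and their maxima over windows *)

Section Windows.

Variable near : nat -> nat -> Prop.
Hypothesis near_sub : forall j j' l' l,
  j <= j' -> j' <= l' -> l' <= l -> near j l -> near j' l'.

(* Within a window, a positive value recurs only after a larger one. *)
Definition separated (f : nat -> nat) := forall j l, j < l -> near j.+1 l ->
  0 < f j -> f j = f l -> exists2 m, j < m < l & f j < f m.

Definition window_max (f a : nat -> nat) :=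
  (forall j l, j <= l -> near j l -> f l <= a j) /\
  forall j, exists l, [/\ j <= l, near j l & f l = a j].

Lemma change_between (g : nat -> nat) j l : j <= l -> g j <> g l ->
  exists2 m, j <= m < l & g m <> g m.+1.
Proof.
elim: l => [|l IH]; first by case: j.
rewrite leq_eqVlt => /predU1P [-> //|/[!ltnS] le_jl] neq.
have [eq|/eqP neql] := eqVneq (g j) (g l).
  by exists l; [rewrite le_jl /= | rewrite -eq].
by have [m lt_m neqm] := IH le_jl neql; exists m => //; lia.
Qed.

Variables (f a : nat -> nat).
Hypothesis aP : window_max f a.

(** Let [a j] be the largest value of [a] after [x] and up to [u], attained by [f y]. If [y] is at
    most [u], a near stretch from [x] contains [y], so [a x] is as large and there is no ascent at
    [x]. If [y] lies beyond [u], the window of [u.+1] contains it, and there is no descent at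
    [u]. *)
Lemma up_down_far x u : x < u -> a x < a x.+1 -> a u.+1 < a u -> ~ near x u.
Proof.
move=> lt_xu up down near_xu.
have [j lt_j max_j] : exists2 j, x < j <= u &
    forall i, x < i <= u -> a i <= a j.
  have [] := @bigop.eq_bigmax _ (fun i : 'I_(u - x) => a (x.+1 + i)).
    by rewrite card_ord; lia.
  move=> i0 def_i0; exists (x.+1 + i0); first by have := ltn_ord i0; lia.
  move=> i lt_i; rewrite -def_i0; have lt : i - x.+1 < u - x by lia.
  have := @bigop.leq_bigmax _ (fun i : 'I_(u - x) => a (x.+1 + i)) (Ordinal lt).
  by rewrite /= subnKC //; lia.
have [y [le_jy near_jy eq_y]] := aP.2 j.
have maxx := max_j x.+1; have maxu := max_j u.
have [le_yu|lt_uy] := leqP y u.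
  have le_xy : x <= y by lia.
  have := aP.1 x y le_xy (near_sub (leqnn x) le_xy le_yu near_xu); lia.
have near_uy: near u.+1 y by apply: near_sub near_jy => //; lia.
have := aP.1 u.+1 y lt_uy near_uy; lia.
Qed.

Lemma step_label_separated k : (forall j, a j < 2 ^ k) ->
  separated (fun j => step_label k (a j) (a j.+1)).
Proof.
move=> lt_a j l lt_jl near_jl; rewrite step_label_gt0 => neqj eq_lab.
have neql : a l != a l.+1 by rewrite -(step_label_gt0 k) -eq_lab step_label_gt0.
have hb i : a i <> a i.+1 -> high_bit (a i) (a i.+1) < k.
  by move=> ?; apply: high_bit_lt.
have hbj := hb _ (elimN eqP neqj); have hbl := hb _ (elimN eqP neql).
move: neqj neql eq_lab; rewrite /step_label => neqj neql.
rewrite (negPf neqj) (negPf neql).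
have [upj|] := ltnP (a j) (a j.+1).
  have [upl|] := ltnP (a l) (a l.+1); last lia.
  (* Two ascents: a descent in between has a label above [k], and without one the values do not
     decrease from [j.+1] to [l]. *)
  move=> [eq_hb].
  have [[m lt_m down]|nodown] :=
      pselect (exists2 m, j < m < l & a m.+1 < a m).
    exists m => //; case: eqP => [|_]; first lia.
    by case: ifP; lia.
  have mono m : j < m -> m <= l -> a j.+1 <= a m.
    elim: m => // m IH; rewrite ltnS leq_eqVlt => /predU1P[-> //|lt_jm] le_ml.
    apply: leq_trans (IH lt_jm (ltnW le_ml)) _; rewrite leqNgt; apply/negP => ?.
    by apply: nodown; exists m => //; rewrite lt_jm.
  have [h [Bj Aj]] := high_bit_halves upj.
  have [h' [Dl Cl]] := high_bit_halves upl.
  rewrite high_bitC in Bj Aj; rewrite high_bitC -eq_hb in Dl Cl.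
  set i := high_bit (a j) (a j.+1) in hbj Bj Aj Dl Cl eq_hb *.
  (* Bit [i] is 1 at [j.+1] and 0 at [l], yet the values have not decreased: the prefix above bit
     [i] must have changed in between. *)
  have leBC: a j.+1 %/ 2 ^ i <= a l %/ 2 ^ i by apply: leq_div2r; apply: mono.
  have [|m lt_m neqm] :=
      @change_between (fun m => a m %/ 2 ^ i.+1) j.+1 l lt_jl.
    by rewrite !divn_exp2S; lia.
  have ge_m := high_bit_ge neqm; exists m; first lia.
  by case: eqP => [eqm|_]; [rewrite eqm in neqm | case: ifP; lia].
move=> downj; have [upl|] := ltnP (a l) (a l.+1); first lia.
move=> downl [/addnI eq_hb].
(* Two descents: an ascent in between would be near the descent at [l], against [up_down_far]. So
   the run is monotone and the argument for ascents applies in reverse. *)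
have noup m : j < m < l -> a m.+1 <= a m.
  move=> lt_m; rewrite leqNgt; apply/negP => up.
  have [] := @up_down_far m l; [lia|exact: up|lia|].
  by apply: near_sub near_jl; lia.
have mono m : j < m -> m <= l -> a m <= a j.+1.
  elim: m => // m IH; rewrite ltnS leq_eqVlt => /predU1P[-> //|lt_jm] le_ml.
  by apply: leq_trans (IH lt_jm (ltnW le_ml)); apply: noup; rewrite lt_jm.
have {}downj : a j.+1 < a j by lia.
have {}downl : a l.+1 < a l by lia.
have [h [Aj Bj]] := high_bit_halves downj.
have [h' [Cl Dl]] := high_bit_halves downl.
rewrite -eq_hb in Dl Cl.
set i := high_bit (a j) (a j.+1) in hbj Bj Aj Dl Cl eq_hb *.
have leBC: a l %/ 2 ^ i <= a j.+1 %/ 2 ^ i by apply: leq_div2r; apply: mono.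
have [|m lt_m neqm] :=
    @change_between (fun m => a m %/ 2 ^ i.+1) j.+1 l lt_jl.
  by rewrite !divn_exp2S; lia.
have ge_m := high_bit_ge neqm; exists m; first lia.
case: eqP => [eqm|neqam]; first by rewrite eqm in neqm.
by have := noup m; case: ifP; lia.
Qed.

Hypothesis sep : separated f.

(** If the window of [x] attains its maximum at [z] before [y], the window of [z.+1] attains the
    same value at some [z']. Separation puts a larger value between them, inside the window of
    [z.+1], whose maximum it would exceed. This is why [separated] asks for nearness from [j.+1]
    only. *)
Lemma constant_run_near x y : x <= y -> 0 < a x ->
  (forall j, x <= j <= y -> a j = a x) -> near x y.
Proof.
move=> le_xy ax_gt0 const.
have [z [le_xz near_xz fz]] := aP.2 x.
have [|lt_zy] := leqP y z; first by move=> le_yz; apply: near_sub near_xz.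
have [z' [le_zz' near_zz' fz']] := aP.2 z.+1.
rewrite const in fz'; last lia.
have [|||m lt_m lt_fm] := sep le_zz'; rewrite ?fz ?fz' //.
have : f m <= a z.+1.
  by apply: aP.1; [lia|apply: near_sub near_zz'; lia].
by rewrite const; lia.
Qed.

Variable next : nat -> nat.
Hypothesis next_gt : forall j, j < next j.
Hypothesis next_far : forall j, ~ near j (next j).

Lemma change_in_window x : 0 < a x ->
  exists2 j, x <= j < next x & a j <> a j.+1.
Proof.
move=> ax_gt0; apply: contrapT => nochange; apply: (@next_far x).
apply: constant_run_near => //; first exact: ltnW.
move=> j /andP[le_xj le_j]; apply: contrapT => neq; apply: nochange.
have [|m lt_m neqm] := @change_between a _ _ le_xj.
  by move=> eq; apply: neq.
by exists m => //; lia.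
Qed.

Lemma iter_next_ge i x : x <= iter i next x.
Proof. by elim: i => //= i IH; apply: leq_trans IH (ltnW (next_gt _)). Qed.

Variable Q : nat.
Hypothesis a_gt0 : forall j, 0 < a j.
Hypothesis a_le : forall j, a j <= Q.

(** The maxima change in each of [Q] successive windows; without a descent these changes are
    increases and push a positive value above [Q]. *)
Lemma down_exists x : exists2 d, x <= d < iter Q next x & a d.+1 < a d.
Proof.
apply: contrapT => nodown.
have mono j l : x <= j -> j <= l -> l <= iter Q next x -> a j <= a l.
  move=> le_xj; elim: l => [|l IH]; first by rewrite leqn0 => /eqP->.
  rewrite leq_eqVlt => /predU1P[-> //|/[!ltnS] le_jl] le_l.
  apply: leq_trans (IH le_jl (ltnW le_l)) _; rewrite leqNgt; apply/negP => ?.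
  by apply: nodown; exists l => //; rewrite (leq_trans le_xj le_jl).
suff H i : i <= Q -> i < a (iter i next x).
  by have := H Q (leqnn Q); have := a_le (iter Q next x); lia.
elim: i => [|i IH] lt_iQ; first exact: a_gt0.
have le_iter : iter i.+1 next x <= iter Q next x.
  by rewrite -(subnK lt_iQ) iterD; apply: iter_next_ge.
have [j lt_j neqj] := @change_in_window (iter i next x) (a_gt0 _).
have := iter_next_ge i x; rewrite /= in le_iter * => ge_x.
apply: leq_ltn_trans (IH (ltnW lt_iQ)) _.
have := @mono (iter i next x) j; have := @mono j j.+1.
have := @mono j.+1 (next (iter i next x)); lia.
Qed.

Lemma up_exists x : exists2 d, x <= d < iter Q next x & a d < a d.+1.
Proof.
apply: contrapT => noup.
have mono j l : x <= j -> j <= l -> l <= iter Q next x -> a l <= a j.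
  move=> le_xj; elim: l => [|l IH]; first by rewrite leqn0 => /eqP->.
  rewrite leq_eqVlt => /predU1P[-> //|/[!ltnS] le_jl] le_l.
  apply: leq_trans _ (IH le_jl (ltnW le_l)); rewrite leqNgt; apply/negP => ?.
  by apply: noup; exists l => //; rewrite (leq_trans le_xj le_jl).
suff H i : i <= Q -> a (iter i next x) + i <= Q.
  by have := H Q (leqnn Q); have := a_gt0 (iter Q next x); lia.
elim: i => [|i IH] lt_iQ; first by rewrite addn0; apply: a_le.
have le_iter : iter i.+1 next x <= iter Q next x.
  by rewrite -(subnK lt_iQ) iterD; apply: iter_next_ge.
have [j lt_j neqj] := @change_in_window (iter i next x) (a_gt0 _).
have := iter_next_ge i x; rewrite /= in le_iter * => ge_x.
apply: leq_trans (IH (ltnW lt_iQ)).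
have := @mono (iter i next x) j; have := @mono j j.+1.
have := @mono j.+1 (next (iter i next x)); lia.
Qed.

(** A descent, then an ascent [w], then a descent are found in [Q] windows each, hence [3 * Q].
    Taking [d] as the last descent before [w] and [u] as the first one after it leaves no descent
    between them. A near stretch from [d.+1] to [u] would contain the ascent at [w] followed by the
    descent at [u]. *)
Lemma big_gap x : exists d u, [/\ x <= d < u, u < iter (3 * Q) next x,
  a d.+1 < a d, a u.+1 < a u &
  (forall m, d < m < u -> a m <= a m.+1) /\ ~ near d.+1 u].
Proof.
have [d0 lt_d0 down0] := down_exists x.
have [w lt_w up] := up_exists (iter Q next x).
have [u0 lt_u0 downu0] := down_exists (iter Q next (iter Q next x)).
have lt_d0w : d0 < w by lia.
have exd : exists d, (d < w) && (a d.+1 < a d) by exists d0; rewrite lt_d0w.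
have bd d : (d < w) && (a d.+1 < a d) -> d <= w by lia.
have [d /andP[lt_dw downd] max_d] := ex_maxnP exd bd.
have exu : exists u, (w < u) && (a u.+1 < a u).
  exists u0; rewrite downu0 andbT.
  by case: ltngtP => [||eq] //; [lia | rewrite eq in up; lia].
have [u /andP[lt_wu downu] min_u] := ex_minnP exu.
have le_d0 : d0 <= d by apply: max_d; rewrite lt_d0w.
have le_u0 : u <= u0.
  apply: min_u; rewrite downu0 andbT.
  by case: ltngtP => [||eq] //; [lia | rewrite eq in up; lia].
exists d, u; split=> //; [lia| |split].
- have -> : 3 * Q = Q + (Q + Q) by lia.
  by rewrite !iterD; lia.
- move=> m lt_m; rewrite leqNgt; apply/negP => downm.
  have [lt_mw|lt_wm|eq] := ltngtP m w.
  + have : m <= d by apply: max_d; rewrite lt_mw.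
    lia.
  + have : u <= m by apply: min_u; rewrite lt_wm.
    lia.
  + by rewrite eq in downm; lia.
- move=> near_du; apply: (up_down_far lt_wu up downu).
  by apply: near_sub near_du; lia.
Qed.

End Windows.

(** * Binary codes of finite sets, edge weights, reachability *)

Lemma sum_bits_lt (b : nat -> bool) N : \sum_(i < N) b i * 2 ^ i < 2 ^ N.
Proof.
elim: N => [|N IH]; first by rewrite big_ord0.
rewrite big_ord_recr /= expnS mul2n -addnn -addSn leq_add //.
by case: (b N); rewrite ?mul1n ?mul0n.
Qed.

Lemma sum_bits_odd (b : nat -> bool) N j : j < N ->
  odd ((\sum_(i < N) b i * 2 ^ i) %/ 2 ^ j) = b j.
Proof.
elim: N => // N IH; rewrite ltnS big_ord_recr /= leq_eqVlt.
case/predU1P => [->|lt_jN].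
  by rewrite divnDr ?dvdn_mull // divn_small ?sum_bits_lt // mulnK ?expn_gt0 //;
    case: (b N).
have dv : 2 ^ j %| b N * 2 ^ N by rewrite dvdn_mull // dvdn_exp2l // ltnW.
rewrite divnDr // oddD IH // -muln_divA ?dvdn_exp2l 1?ltnW //.
rewrite -expnB 1?ltnW // oddM oddX subn_eq0 leqNgt lt_jN andbF addbF //.
Qed.

(** The indicator of [C] read in binary. Codes over identifiers below [N] stay below [2 ^ N], which
    costs the label reduction only one more logarithm. *)
Definition code (C : {fset nat}) := \sum_(x <- C) 2 ^ x.

Lemma codeE C N : {in C, forall x, x < N} ->
  code C = \sum_(i < N) (val i \in C) * 2 ^ i.
Proof.
move=> ltN; rewrite -(big_mkord xpredT (fun i => (i \in C) * 2 ^ i)).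
rewrite (eq_bigr (fun i => if i \in C then 2 ^ i else 0)); last by move=> i _;
  case: (i \in C); rewrite ?mul1n ?mul0n.
rewrite -big_mkcond -big_filter; apply: perm_big; apply: uniq_perm => //.
  by rewrite filter_uniq ?iota_uniq.
move=> x; rewrite mem_filter mem_index_iota /=.
by case: (boolP (x \in C)) => // /ltN ->.
Qed.
Lemma code_inj : injective code.
Proof.
move=> C D eq_code.
pose N := (\max_(x <- C) x + \max_(x <- D) x).+1.
have ltC : {in C, forall x, x < N}.
  by move=> x Cx; rewrite ltnS; apply: leq_trans (leq_addr _ _);
    apply: (@bigop.leq_bigmax_seq _ _ xpredT id).
have ltD : {in D, forall x, x < N}.
  by move=> x Cx; rewrite ltnS; apply: leq_trans (leq_addl _ _);
    apply: (@bigop.leq_bigmax_seq _ _ xpredT id).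
rewrite (codeE ltC) (codeE ltD) in eq_code.
apply/fsetP => x; have [lt_xN|le_Nx] := ltnP x N.
  by rewrite -(sum_bits_odd (fun x => x \in C) lt_xN) -(sum_bits_odd
    (fun x => x \in D) lt_xN) eq_code.
by apply/idP/idP => [/ltC|/ltD]; lia.
Qed.
Lemma code_lt C N : {in C, forall x, x < N} -> code C < 2 ^ N.
Proof. by move=> ltN; rewrite (codeE ltN) (sum_bits_lt (fun x => x \in C)). Qed.
(* The codes break ties, so that distinct edges have distinct weights. *)
Definition weight (C D : {fset nat}) : (nat *l (nat *l nat))%type :=
  (#|` (C `&` D)%fset|, (maxn (code C) (code D), minn (code C) (code D))).

Lemma fsubset_iota (C : {fset nat}) N : {in C, forall x, x < N} ->
  (C `<=` [fset i | i in iota 0 N])%fset.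
Proof.
move=> ltN; apply/fsubsetP => x Cx; apply/imfsetP; exists x; rewrite //=.
by rewrite mem_iota /= ltN.
Qed.

Lemma weightC C D : weight C D = weight D C.
Proof. by rewrite /weight fsetIC maxnC minnC. Qed.

Lemma weight_inj C D C' D' : weight C D = weight C' D' ->
  (C = C' /\ D = D') \/ (C = D' /\ D = C').
Proof.
case=> _ eq_max eq_min.
have : (code C = code C' /\ code D = code D') \/
       (code C = code D' /\ code D = code C') by lia.
by case=> -[/code_inj -> /code_inj ->]; [left|right].
Qed.

Lemma weight_card C D C' D' : (weight C D <= weight C' D')%O ->
  #|` C `&` D| <= #|` C' `&` D'|.
Proof. by rewrite lexi_pair => /andP[]. Qed.

(** Provides maxima for predicates that are not decidable but take their values in a finite list. *)
Lemma max_in_seq d (W : orderType d) (s : seq W) (P : W -> Prop) w :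
  P w -> (forall w, P w -> w \in s) ->
  exists2 w, P w & forall w', P w' -> (w' <= w)%O.
Proof.
elim: s P w => [|x s IH] P w Pw in_s; first by have := in_s _ Pw.
have [[w' [Pw' lt_xw']]|nomax] := pselect (exists w', P w' /\ (x < w')%O).
  have [|v|v [Pv lt_v] max_v] := IH (fun v => P v /\ (x < v)%O) w' _.
  - by [].
  - by move=> [/in_s]; rewrite inE => /predU1P[->|//]; rewrite ltxx.
  exists v => // u Pu; have [le_ux|lt_xu] := leP u x.
    exact: le_trans le_ux (ltW lt_v).
  exact: max_v.
have lex v : P v -> (v <= x)%O.
  by move=> Pv; rewrite leNgt; apply/negP => ?; apply: nomax; exists v.
have [Px|nPx] := pselect (P x); first by exists x.
apply: IH Pw _ => v Pv; have := in_s _ Pv; rewrite inE => /predU1P[eq|//].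
by rewrite eq in Pv.
Qed.

Inductive reach T (R : T -> T -> Prop) (x : T) : T -> Prop :=
| reach_refl : reach R x x
| reach_step y z : reach R x y -> R y z -> reach R x z.

Lemma reach1 T (R : T -> T -> Prop) x y : R x y -> reach R x y.
Proof. exact: reach_step (reach_refl _ _). Qed.

Lemma reach_trans T (R : T -> T -> Prop) x y z :
  reach R x y -> reach R y z -> reach R x z.
Proof. by move=> xy; elim=> // u v _; apply: reach_step. Qed.

Lemma reach_sym T (R : T -> T -> Prop) x y : (forall x y, R x y -> R y x) ->
  reach R x y -> reach R y x.
Proof.
move=> symR; elim=> [|u v _ ux uv]; first exact: reach_refl.
exact: reach_trans (reach1 (symR _ _ uv)) ux.
Qed.

Lemma reach_sub T (R R' : T -> T -> Prop) x y :
  (forall x y, R x y -> R' x y) -> reach R x y -> reach R' x y.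
Proof.
move=> sub; elim=> [|u v _ xu uv]; first exact: reach_refl.
exact: reach_step xu (sub _ _ uv).
Qed.

Lemma reach_stable T (R : T -> T -> Prop) (P : T -> Prop) x y :
  reach R x y -> P x -> (forall u v, P u -> R u v -> P v) -> P y.
Proof. by move=> xy Px stab; elim: xy => // u v _ Pu; apply: stab. Qed.

Lemma reach_exit T (R : T -> T -> Prop) (P : T -> Prop) x y :
  reach R x y -> P x -> ~ P y -> exists u v, [/\ P u, ~ P v & R u v].
Proof.
move=> xy Px nPy; apply: contrapT => noexit; apply: nPy.
apply: (reach_stable xy Px) => u v Pu uv; apply: contrapT => nPv.
by apply: noexit; exists u, v.
Qed.

(** * The graph of maximal cliques: blocks and pointers *)

Section Graph.

Variable A : rel nat.

(** As [x] and [y] may coincide, members carry loops. The graphs used have a loop at each identifier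
    in use, so this says that members are vertices. *)
Definition max_clique (C : {fset nat}) := [/\ C != fset0,
  {in C &, forall x y, A x y} &
  forall x, {in C, forall y, A x y} -> x \in C].

Definition meets C D :=
  [/\ max_clique C, max_clique D, C <> D & exists2 x, x \in C & x \in D].

(* [None] is a threshold above all weights. *)
Definition heavy (w : option (nat *l (nat *l nat))%type) C D :=
  meets C D /\ if w is Some w0 then (w0 <= weight C D)%O : Prop else False.

Definition level w C D := reach (heavy w) C D.

Variable K : nat.

Definition thin (S : nat -> Prop) := ~ exists s : seq nat,
  [/\ uniq s, size s = K, forall x, x \in s -> S x &
      {in s &, forall x y, x != y -> ~~ A x y}].

Definition members (F : {fset nat} -> Prop) x := exists2 C, F C & x \in C.

(* As the components [level w C] are nested, this is the largest one without K
   independent vertices; all its members have the same block. *)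
Definition block C D := exists2 w, level w C D & thin (members (level w C)).

Definition leaves C e := [/\ block C e.1, ~ block C e.2 & meets e.1 e.2].

Definition opened C := exists e, leaves C e.

Definition exits C e := leaves C e /\
  forall e', leaves C e' -> (weight e'.1 e'.2 <= weight e.1 e.2)%O.

(** [xget] depends on the predicate alone: wherever the leaving edges are the same, for two cliques
    of a block or in two graphs, the same exit is chosen. *)
Definition exit C : {fset nat} * {fset nat} := xget (fset0, fset0) (exits C).

Definition next C := (exit C).2.

Definition segment C i D := exists2 j, j <= i & block (iter j next C) D.

Definition near C i := thin (members (segment C i)).

Lemma thin_sub (S S' : nat -> Prop) : (forall x, S x -> S' x) -> thin S' -> thin S.
Proof.
move=> sub thin' [s [uniq_s size_s in_s ind_s]]; apply: thin'.
by exists s; split=> // x /in_s/sub.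
Qed.

Variable N : nat.
Hypothesis boundA : forall x y, A x y -> x < N.
Hypothesis K_gt1 : 1 < K.

Lemma max_clique_bound C : max_clique C -> {in C, forall x, x < N}.
Proof. by move=> [_ clC _] x Cx; apply: boundA (clC x x Cx Cx). Qed.

Lemma max_clique_eq C D : max_clique C -> max_clique D -> C `<=` D -> C = D.
Proof.
move=> [_ clC maxC] [_ clD maxD] subCD; apply/eqP; rewrite eqEfsubset subCD.
apply/fsubsetP => x Dx; apply: maxC => y Cy; apply: clD => //.
exact: (fsubsetP subCD).
Qed.

Lemma meets_sym C D : meets C D -> meets D C.
Proof. by move=> [? ? ? [x ? ?]]; split=> //; [exact: nesym|exists x]. Qed.

Lemma heavy_sym w C D : heavy w C D -> heavy w D C.
Proof. by move=> [/meets_sym CD]; rewrite weightC; split. Qed.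

Lemma level_sym w C D : level w C D -> level w D C.
Proof. by apply: reach_sym; apply: heavy_sym. Qed.

Lemma level_eq w C D : level w C D -> level w C = level w D.
Proof.
move=> CD; apply/funext => E; apply/propext; split; apply: reach_trans => //.
exact: level_sym.
Qed.

Definition above (w w' : option (nat *l (nat *l nat))%type) :=
  forall C D, heavy w C D -> heavy w' C D.

Lemma above_total w w' : above w w' \/ above w' w.
Proof.
case: w => [w|]; last by left=> C D [].
case: w' => [w'|]; last by right=> C D [].
by case: (leP w w') => [le|/ltW le]; [right|left] => C D [CD le'];
  split=> //; apply: le_trans le'.
Qed.

Lemma level_above w w' C D : above w w' -> level w C D -> level w' C D.
Proof. by move=> sub; apply: reach_sub. Qed.

Lemma level_max_clique w C D : max_clique C -> level w C D -> max_clique D.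
Proof. by move=> mcC CD; apply: (reach_stable CD) => // u v _ [[]]. Qed.

Lemma clique_thin C : max_clique C -> thin (fun x => x \in C).
Proof.
move=> [_ clC _] [s [uniq_s size_s in_s ind_s]].
have : 1 < size s by rewrite size_s.
case: s uniq_s {size_s} in_s ind_s => [|x [|y s]] //= /andP[+ _] in_s ind_s _.
rewrite inE negb_or => /andP[neq_xy _].
have := ind_s x y; rewrite !inE !eqxx orbT => /(_ isT isT neq_xy).
by rewrite clC //; apply: in_s; rewrite !inE eqxx ?orbT.
Qed.

Lemma block_refl C : max_clique C -> block C C.
Proof.
move=> mcC; exists None; first exact: reach_refl.
apply: thin_sub (clique_thin mcC) => x [D CD Dx].
suff <- : D = C by [].
by apply: (@reach_stable _ _ (eq^~ C) _ _ CD) => // u v _ [].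
Qed.

Lemma block_sym C D : block C D -> block D C.
Proof.
move=> [w CD thinC]; exists w; first exact: level_sym.
by rewrite -(level_eq CD).
Qed.

Lemma block_trans C D E : block C D -> block D E -> block C E.
Proof.
move=> [w CD thinC] [w' DE thinD].
have [ww'|w'w] := above_total w w'; [exists w' | exists w] => //.
- exact: reach_trans (level_above ww' CD) DE.
- by rewrite (level_eq (level_above ww' CD)).
- exact: reach_trans CD (level_above w'w DE).
Qed.

Lemma block_eq C D : block C D -> block C = block D.
Proof.
move=> CD; apply/funext => E; apply/propext; split; apply: block_trans => //.
exact: block_sym.
Qed.

Lemma block_max_clique C D : max_clique C -> block C D -> max_clique D.
Proof. by move=> mcC [w CD _]; apply: level_max_clique CD. Qed.

(** As levels are nested, finitely many members of a block already lie in one thin level. Hence the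
    block, a union of thin levels, is thin itself. *)
Lemma block_level C : max_clique C -> exists2 w, forall D, level w C D -> block C D &
  thin (members (level w C)) /\ forall s : seq nat,
  (forall x, x \in s -> members (block C) x) ->
  exists w', [/\ thin (members (level w' C)) &
              forall x, x \in s -> members (level w' C) x].
Proof.
move=> mcC; have [w CC thinC] := block_refl mcC.
exists w => [D CD|]; [by exists w|split=> // s].
elim: s => [|x s IH] in_s; first by exists w.
have [y sy|w1 [thin1 in1]] := IH; first by apply: in_s; rewrite inE sy orbT.
have [|D [w2 CD thin2] Dx] := in_s x; first by rewrite inE eqxx.
have [w12|w21] := above_total w1 w2; [exists w2 | exists w1]; split=> // y.
  rewrite inE => /predU1P[->|/in1[E CE Ey]]; first by exists D.
  by exists E => //; apply: level_above CE.
rewrite inE => /predU1P[->|/in1//]; exists D => //; exact: level_above CD.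
Qed.

Lemma block_thin C : max_clique C -> thin (members (block C)).
Proof.
move=> mcC [s [uniq_s size_s in_s ind_s]].
have [w _ [_ /(_ s in_s)[w' [thin_w' in_w']]]] := block_level mcC.
by apply: thin_w'; exists s.
Qed.

Lemma leaves_bound C e : leaves C e ->
  weight e.1 e.2 \in [seq weight D1 D2 |
    D1 <- fpowerset [fset i | i in iota 0 N], D2 <- fpowerset [fset i | i in iota 0 N]].
Proof.
have sub D : max_clique D -> D \in fpowerset [fset i | i in iota 0 N].
  by move=> /max_clique_bound ltN; rewrite fpowersetE fsubset_iota.
by move=> [_ _ [/sub ? /sub ? _ _]]; apply/allpairsP; exists e.
Qed.

Lemma exitP C : opened C -> exits C (exit C).
Proof.
move=> [e leave_e]; apply: xgetPex.
pose P w := exists2 e, leaves C e & weight e.1 e.2 = w.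
have Pe : P (weight e.1 e.2) by exists e.
have in_s w (Pw : P w) := let: ex_intro2 e' leave' eqw := Pw in
  eq_ind _ (fun w => w \in _) (leaves_bound leave') _ eqw.
have [w [e' leave' <-] max'] := max_in_seq Pe in_s.
by exists e'; split=> // e'' leave''; apply: max'; exists e''.
Qed.

Lemma exit_block C D : block C D -> exit C = exit D.
Proof. by move=> /block_eq eqCD; rewrite /exit /exits /leaves eqCD. Qed.

Lemma opened_block C D : block C D -> opened C -> opened D.
Proof. by move=> /block_eq eqCD; rewrite /opened /leaves eqCD. Qed.

Lemma next_block C D : block C D -> next C = next D.
Proof. by move=> CD; rewrite /next (exit_block CD). Qed.

Lemma next_meets C : opened C -> meets (exit C).1 (next C).
Proof. by case/exitP => -[]. Qed.

Lemma next_max_clique C : opened C -> max_clique (next C).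
Proof. by case/next_meets. Qed.

Lemma next_not_block C : opened C -> ~ block C (next C).
Proof. by case/exitP => -[]. Qed.

Lemma exit_rev_leaves C : opened C -> leaves (next C) (next C, (exit C).1).
Proof.
move=> openC; have [[CO nCP OP] _] := exitP openC; split=> /=.
- exact/block_refl/next_max_clique.
- by move=> PO; apply: nCP; apply: block_trans CO (block_sym PO).
- exact: meets_sym.
Qed.

Lemma next_opened C : opened C -> opened (next C).
Proof. by move=> /exit_rev_leaves; eexists; eassumption. Qed.

Definition exit_weight C := weight (exit C).1 (exit C).2.

(** The threshold that puts the near end of the exit into the block is comparable with the exit
    weight. In either case a thin level at the exit weight would put the far end into the block as
    well. *)
Lemma exit_level C : max_clique C -> opened C ->
  ~ thin (members (level (Some (exit_weight C)) C)).
Proof.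
move=> mcC openC thin_l; have [[[w COw thin_w] nCP OP] _] := exitP openC.
have heavyOP : heavy (Some (exit_weight C)) (exit C).1 (exit C).2 by split.
have [below|above_w] := above_total (Some (exit_weight C)) w.
  by apply: nCP; exists w => //; apply: reach_step COw (below _ _ _).
apply: nCP; exists (Some (exit_weight C)) => //.
by apply: reach_step heavyOP; apply: level_above COw.
Qed.

(** The reversed exit leaves the next block, so it competes for the exit there. *)
Lemma exit_weight_next C : opened C -> (exit_weight C <= exit_weight (next C))%O.
Proof.
move=> openC; have [_ /(_ _ (exit_rev_leaves openC))] := exitP (next_opened openC).
by rewrite weightC.
Qed.

(** Equal weights belong to the same unordered edge, so the next block points back. An edge at least
    as heavy that left the union of both blocks would be this edge again. Thus the union contains
    the level at the exit weight, which is not thin. *)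
Lemma exit_mutual C : max_clique C -> opened C ->
  exit_weight C = exit_weight (next C) ->
  block (next (next C)) C /\ ~ thin (members (fun D => block C D \/ block (next C) D)).
Proof.
move=> mcC openC eqw; have [[CO nCP OP] maxC] := exitP openC.
have openP := next_opened openC; have [[PO' nPP' OP'] maxP] := exitP openP.
have eq_rev : next (next C) = (exit C).1.
  case: (weight_inj eqw) => -[eqO eqP]; last by rewrite /next -eqO.
  case: nCP; rewrite -eqO in PO'; exact: block_trans CO (block_sym PO').
rewrite eq_rev; split; first exact: block_sym.
move=> thin2; apply: (exit_level mcC openC); apply: thin_sub thin2 => x.
move=> [D CD Dx]; exists D => //.
apply: (@reach_stable _ _ (fun D => block C D \/ block (next C) D) _ _ CD).
  by left; apply: block_refl.
move=> U V inU [UV leUV]; apply: contrapT => /not_orP[nCV nPV].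
case: inU => [CU|PU].
  have leaveUV : leaves C (U, V) by [].
  have eqUV : exit_weight C = weight U V by apply/le_anti;
    rewrite leUV (maxC _ leaveUV).
  case: (weight_inj eqUV) => -[eqO eqP].
    by apply: nPV; rewrite -eqP; apply/block_refl/next_max_clique.
  by apply: nCV; rewrite -eqO.
have leaveUV : leaves (next C) (U, V) by [].
have eqUV : exit_weight C = weight U V.
  by apply/le_anti; rewrite leUV eqw (maxP _ leaveUV).
case: (weight_inj eqUV) => -[eqO eqP].
  by apply: nPV; rewrite -eqP; apply/block_refl/next_max_clique.
by apply: nCV; rewrite -eqO.
Qed.

Lemma iter_next_opened i C : opened C -> opened (iter i next C).
Proof. by move=> openC; elim: i => //= i; apply: next_opened. Qed.

Lemma iter_next_max_clique i C : max_clique C -> opened C ->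
  max_clique (iter i next C).
Proof.
by move=> mcC openC; case: i => //= i; apply/next_max_clique/iter_next_opened.
Qed.

Definition path_near C j l := near (iter j next C) (l - j).

Lemma iterB j i C : iter i next (iter j next C) = iter (j + i) next C.
Proof. by rewrite addnC iterD. Qed.

Lemma path_near_refl C j : max_clique C -> opened C -> path_near C j j.
Proof.
move=> mcC openC; rewrite /path_near subnn.
apply: thin_sub (block_thin (iter_next_max_clique j mcC openC)) => x [D].
by move=> [i]; rewrite leqn0 => /eqP -> ? Dx; exists D.
Qed.

Lemma path_near_sub C j j' l' l : j <= j' -> j' <= l' -> l' <= l ->
  path_near C j l -> path_near C j' l'.
Proof.
move=> le_j le_jl le_l; apply: thin_sub => x [D [i le_i]]; rewrite iterB => iD Dx.
by exists D => //; exists (j' - j + i); rewrite ?iterB;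
  [lia | congr (block _ D): iD; congr iter; lia].
Qed.

Lemma exit_weight_mono C j l : opened C -> j <= l ->
  (exit_weight (iter j next C) <= exit_weight (iter l next C))%O.
Proof.
move=> openC; elim: l => [|l IH]; first by rewrite leqn0 => /eqP->.
rewrite leq_eqVlt => /predU1P[->//|/[!ltnS]/IH le].
exact/(le_trans le)/exit_weight_next/iter_next_opened.
Qed.

(** Exit weights never decrease along the path, so a repeated block keeps them constant in between.
    The block at [j] and the next one then point to each other, and the stretch contains both. *)
Lemma repeat_far C j l : max_clique C -> opened C -> j < l ->
  block (iter j next C) (iter l next C) -> ~ path_near C j.+1 l.
Proof.
move=> mcC openC lt_jl jl near_jl; set D := iter j next C in jl.
have openD : opened D by apply: iter_next_opened.
have mcD : max_clique D by apply: iter_next_max_clique.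
have eqw : exit_weight D = exit_weight (next D).
  apply/le_anti; rewrite exit_weight_next //=.
  have -> : exit_weight D = exit_weight (iter l next C).
    by rewrite /exit_weight (exit_block jl).
  exact: (@exit_weight_mono C j.+1).
have [back] := exit_mutual mcD openD eqw; apply.
(* So the stretch from [j.+1] reaches [j.+2], where the block of [D] occurs again. *)
have neq : l <> j.+1.
  by move=> eql; rewrite eql in jl; apply: next_not_block openD _.
apply: thin_sub near_jl => x [E inE_ Ex]; exists E => //.
case: inE_ => [DE|nE]; last by exists 0.
exists 1; first lia.
exact: block_trans back DE.
Qed.

Lemma path_repeats C : max_clique C -> opened C ->
  exists j l, j < l /\ iter j next C = iter l next C.
Proof.
move=> mcC openC; pose U := fpowerset [fset i | i in iota 0 N].
have inU i : iter i next C \in U.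
  rewrite fpowersetE fsubset_iota //; apply: max_clique_bound.
  exact: iter_next_max_clique.
pose s := [seq iter i next C | i <- iota 0 (size U).+1].
have : ~~ uniq s.
  apply/negP => /uniq_leq_size le_size; have /le_size : {subset s <= U}.
    by move=> D /mapP[i _ ->].
  by rewrite size_map size_iota ltnn.
move=> /(uniqPn fset0)[j [l [lt_jl]]]; rewrite size_map size_iota => lt_l.
rewrite !(nth_map 0) ?size_iota; try lia.
by rewrite !nth_iota; try lia; rewrite !add0n; exists j, l.
Qed.

Lemma near_ends C : max_clique C -> opened C -> exists i, ~ near C i.
Proof.
move=> mcC openC; have [j [l [lt_jl eq_jl]]] := path_repeats mcC openC.
exists l => near_l; apply: (repeat_far mcC openC lt_jl).
  by rewrite eq_jl; apply/block_refl/iter_next_max_clique.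
by apply: (@path_near_sub C 0 j.+1 l l) => //; rewrite /path_near subn0.
Qed.

End Graph.

(** * Labels of blocks, their reduction, and cuts *)

Fixpoint tower g := if g is g'.+1 then (2 ^ (tower g').-1).-1 else 4.

Lemma tower_gt g : g + 3 < tower g.
Proof.
elim: g => //= g IH.
have : tower g <= 2 ^ (tower g).-1 by have := ltn_expl (tower g).-1 (leqnn 2); lia.
have : 2 ^ (tower g).-1 = 2 * 2 ^ (tower g).-2.
  by rewrite -expnS; congr (_ ^ _); lia.
have := ltn_expl (tower g).-2 (leqnn 2); lia.
Qed.

(** [tower] counts bits. Step labels of [k]-bit values are at most [2k], and [tower g.+1] is the
    largest [k] for which they fit into [tower g] bits. The start is 4 because 3 is a fixed point of
    the recursion; hence the final values are below 16. *)
Lemma tower_double g : (tower g.+1).*2 < 2 ^ tower g.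
Proof.
rewrite /=; have lt_tower := tower_gt g.
have -> : 2 ^ tower g = 2 * 2 ^ (tower g).-1.
  by rewrite -expnS; congr (_ ^ _); lia.
by have := expn_gt0 2 (tower g).-1; lia.
Qed.

Lemma class_ex n : exists g, n < 2 ^ tower g.
Proof.
by exists n; apply: ltn_trans (ltn_expl n (leqnn 2)) _; rewrite ltn_exp2l //;
  have := tower_gt n; lia.
Qed.

Definition tower_class n := ex_minn (class_ex n).

Section Labels.

Variables (A : rel nat) (K : nat).

Local Notation next := (next A K).
Local Notation near := (near A K).
Local Notation opened := (opened A K).
Local Notation exit := (exit A K).
Local Notation max_clique := (max_clique A).
Local Notation block := (block A K).

Definition window_sup (f : {fset nat} -> nat) C : nat :=
  xget 0 [set v | (exists2 i, near C i & f (iter i next C) = v) /\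
                  forall i, near C i -> f (iter i next C) <= v].

(** [(exit C).1] lies in the block of [C], so equal names mean equal blocks. The successor keeps 0
    free for the absence of a label. *)
Definition name C := (code (exit C).1).+1.

(* Each step replaces values below [2 ^ tower g.+1] by values below
   [2 ^ tower g], as in Cole and Vishkin's colour reduction. *)
Fixpoint label t s C := match s with
  | 0 => if name C < 2 ^ tower t then name C else 0
  | s'.+1 => step_label (tower (t - s'))
      (window_sup (label t s') C) (window_sup (label t s') (next C))
  end.

Definition mark t C := label t t C.

(* [mark g] reduces only the names below [2 ^ tower g].  Smaller g take priority,
   so that the drops below do not depend on t once it is large enough: no bound
   on all names is needed. *)
Definition rank t C :=
  \max_(g < t.+1) if 0 < mark g C then (t - g) * 16 + mark g C else 0.

(** The least [t] that admits the names of both [C] and [next C], so that both maxima compared by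
    [drop] are positive. *)
Definition rank_level C := maxn (tower_class (name C)) (tower_class (name (next C))).

Definition drop C :=
  window_sup (rank (rank_level C)) (next C) < window_sup (rank (rank_level C)) C.

(* A drop that ends a stretch of at least a whole window without drops. *)
Definition cut C := drop C /\ exists D l, [/\ max_clique D /\ opened D,
  block (iter l next D) C, forall i, i < l -> ~~ drop (iter i next D) & ~ near D l].

Variable N : nat.
Hypothesis boundA : forall x y, A x y -> x < N.
Hypothesis K_gt1 : 1 < K.

Lemma near_le C i j : i <= j -> near C j -> near C i.
Proof.
move=> le_ij; apply: thin_sub => x [D [m le_m mD] Dx]; exists D => //.
by exists m => //; apply: leq_trans le_ij.
Qed.

Lemma near0 C : max_clique C -> opened C -> near C 0.
Proof. exact: (@path_near_refl A K N boundA K_gt1 C 0). Qed.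

Let iter_opened i C : opened C -> opened (iter i next C).
Proof. exact: (@iter_next_opened A K N boundA K_gt1 i C). Qed.

Let iter_clique i C : max_clique C -> opened C -> max_clique (iter i next C).
Proof. exact: (@iter_next_max_clique A K N boundA K_gt1 i C). Qed.

Lemma window_supP f C : max_clique C -> opened C ->
  (exists2 i, near C i & f (iter i next C) = window_sup f C) /\
  forall i, near C i -> f (iter i next C) <= window_sup f C.
Proof.
move=> mcC openC.
suff: [set v | (exists2 i, near C i & f (iter i next C) = v) /\
    forall i, near C i -> f (iter i next C) <= v]%classic (window_sup f C) by [].
apply: xgetPex.
have [e far_e] := near_ends boundA K_gt1 mcC openC.
pose P v := exists2 i, near C i & f (iter i next C) = v.
have P0 : P (f C) by exists 0 => //; apply: near0.
have in_s v : P v -> v \in [seq f (iter i next C) | i <- iota 0 e].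
  move=> [i near_i <-]; apply/map_f; rewrite mem_iota /= ltnNge.
  by apply/negP => le_ei; apply: far_e; apply: near_le near_i.
have [v Pv max_v] := max_in_seq P0 in_s.
by exists v; split=> // i near_i; rewrite -leEnat; apply: max_v; exists i.
Qed.

Lemma window_sup_lt f C b : max_clique C -> opened C ->
  (forall D, max_clique D -> opened D -> f D < b) -> window_sup f C < b.
Proof.
move=> mcC openC lt_b; have [[i _ <-] _] := window_supP f mcC openC.
by apply: lt_b; [apply: iter_clique | apply: iter_opened].
Qed.

Lemma window_sup_gt0 f C : max_clique C -> opened C ->
  0 < f C -> 0 < window_sup f C.
Proof.
move=> mcC openC f_gt0; have [_ ub] := window_supP f mcC openC.
exact: leq_trans f_gt0 (ub 0 (near0 mcC openC)).
Qed.

Lemma path_window_max f C : max_clique C -> opened C ->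
  window_max (path_near A K C) (fun j => f (iter j next C))
    (fun j => window_sup f (iter j next C)).
Proof.
move=> mcC openC; split=> [j l le_jl near_jl|j].
all: have [[i near_i eq_i] ub] :=
  window_supP f (iter_clique j mcC openC) (iter_opened j openC).
- by have := ub _ near_jl; rewrite iterB subnKC.
- exists (j + i); rewrite leq_addr -iterB eq_i; split=> //.
  by rewrite /path_near addKn.
Qed.

Lemma label_lt t s C : s <= t -> max_clique C -> opened C ->
  label t s C < 2 ^ tower (t - s).
Proof.
elim: s C => [|s IH] C lt_st mcC openC /=.
  by rewrite subn0; case: ifP => // _; rewrite expn_gt0.
apply: leq_ltn_trans (step_label_le _ _) _.
- by apply: window_sup_lt => // D; apply: IH; apply: ltnW.
- apply: window_sup_lt => [||D]; first exact: (iter_clique 1).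
    exact: (iter_opened 1).
  by apply: IH; apply: ltnW.
- by have := tower_double (t - s.+1); have -> : (t - s.+1).+1 = t - s by lia.
Qed.

Lemma mark_lt t C : max_clique C -> opened C -> mark t C < 16.
Proof. by move=> mcC openC; have := label_lt (leqnn t) mcC openC; rewrite subnn. Qed.

Let near_sub C : forall j j' l' l, j <= j' -> j' <= l' -> l' <= l ->
  path_near A K C j l -> path_near A K C j' l'.
Proof. by move=> j j' l' l; apply: (@path_near_sub A K K_gt1 C). Qed.

(** Initially equal positive labels mean equal blocks, which [repeat_far] excludes within a window,
    so the condition holds vacuously. Each reduction restores it by [step_label_separated]. *)
Lemma label_separated t s C : s <= t -> max_clique C -> opened C ->
  separated (path_near A K C) (fun j => label t s (iter j next C)).
Proof.
move=> le_st mcC openC; case: s le_st => [|s] lt_st.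
  move=> j l lt_jl near_jl /=; case: ifP => // _ _.
  case: ifP => // _ /succn_inj/code_inj eq_exit; exfalso.
  apply: (repeat_far boundA K_gt1 mcC openC lt_jl _ near_jl).
  have [[jE _ _] _] := exitP boundA (iter_opened j openC).
  have [[lE _ _] _] := exitP boundA (iter_opened l openC).
  by rewrite eq_exit in jE; apply: block_trans jE (block_sym lE).
apply: (step_label_separated (near_sub (C := C))
  (path_window_max (label t s) mcC openC)) => j.
apply: window_sup_lt => [||D]; [exact: iter_clique|exact: iter_opened|].
by apply: label_lt; apply: ltnW.
Qed.

Definition window_len C := xget 0 [set i | ~ near C i /\ forall j, j < i -> near C j].

Lemma window_lenP C : max_clique C -> opened C ->
  ~ near C (window_len C) /\ forall j, j < window_len C -> near C j.
Proof.
move=> mcC openC.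
suff: [set i | ~ near C i /\ forall j, j < i -> near C j]%classic (window_len C) by [].
apply: xgetPex.
have ex : exists i, `[< ~ near C i >].
  by have [i ?] := near_ends boundA K_gt1 mcC openC; exists i; apply/asboolP.
have [i /asboolP far_i min_i] := ex_minnP ex.
exists i; split=> // j lt_ji; apply: contrapT => far_j.
by have := min_i j (asboolT far_j); lia.
Qed.

Definition jump C j := j + window_len (iter j next C).

Lemma jump_gt C j : max_clique C -> opened C -> j < jump C j.
Proof.
move=> mcC openC; have mcj := iter_clique j mcC openC.
have openj := iter_opened j openC; have [+ _] := window_lenP mcj openj.
by rewrite /jump; case: window_len => [|i _]; [case; apply: near0 | lia].
Qed.

Lemma jump_far C j : max_clique C -> opened C -> ~ path_near A K C j (jump C j).
Proof.
move=> mcC openC; rewrite /path_near /jump addKn.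
by case: (window_lenP (iter_clique j mcC openC) (iter_opened j openC)).
Qed.

Lemma jump_near C j l : max_clique C -> opened C -> j <= l < jump C j ->
  path_near A K C j l.
Proof.
move=> mcC openC lt_l; rewrite /path_near; rewrite /jump in lt_l.
have [_] := window_lenP (iter_clique j mcC openC) (iter_opened j openC).
by apply; lia.
Qed.

(** A positive maximum changes within its window, and the step label at the change is positive; so
    no reduction loses the label. *)
Lemma label_gt0 t s C : s <= t -> max_clique C -> opened C ->
  0 < label t 0 C -> 0 < window_sup (label t s) C.
Proof.
move=> + mcC openC lab0; elim: s => [|s IH] lt_st.
  exact: window_sup_gt0.
have [j lt_j neq_j] := change_in_window
  (near_sub (C := C)) (path_window_max (label t s) mcC openC)
  (label_separated (ltnW lt_st) mcC openC) (fun j => jump_gt j mcC openC)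
  (fun j => jump_far mcC openC)
  (IH (ltnW lt_st) : 0 < (fun j => window_sup _ (iter j next C)) 0).
have near_j : near C j.
  have := jump_near mcC openC lt_j.
  by rewrite /path_near /= subn0.
have [_ ub] := window_supP (label t s.+1) mcC openC.
apply: leq_trans (ub j near_j); rewrite /= step_label_gt0.
exact/eqP.
Qed.

Lemma rank_geP t C g : g <= t -> 0 < mark g C -> (t - g) * 16 + mark g C <= rank t C.
Proof.
move=> le_gt mark_gt0; rewrite -ltnS in le_gt.
have := @bigop.leq_bigmax _
  (fun g : 'I_t.+1 => if 0 < mark g C then (t - g) * 16 + mark g C else 0)
    (Ordinal le_gt).
by rewrite /= mark_gt0.
Qed.

Lemma rank_wit t C : 0 < rank t C ->
  exists g, [/\ g <= t, 0 < mark g C & rank t C = (t - g) * 16 + mark g C].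
Proof.
rewrite /rank.
have [|g ->] := @bigop.eq_bigmax _
  (fun g : 'I_t.+1 => if 0 < mark g C then (t - g) * 16 + mark g C else 0).
  by rewrite card_ord.
by case: ifP => // mark_gt0 _; exists g; rewrite -ltnS ltn_ord.
Qed.

(** Going from [t] to [t.+1] shifts all positive terms by 16 and adds a term for [g = t.+1] that is
    below 16, too small to matter. *)
Lemma rankS t C : max_clique C -> opened C -> 0 < rank t C ->
  rank t.+1 C = rank t C + 16.
Proof.
move=> mcC openC rank_gt0; have [g [le_gt mark_gt0 eq_rank]] := rank_wit rank_gt0.
have := rank_geP (leqW le_gt) mark_gt0; rewrite eq_rank subSn // => ge_rank.
have [|h [le_ht mark_h eq_h]] := @rank_wit t.+1 C; first lia.
rewrite eq_h; move: le_ht; rewrite leq_eqVlt => /predU1P[eq|/[!ltnS] le_ht].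
  by have := mark_lt h mcC openC; lia.
by have := rank_geP le_ht mark_h; rewrite eq_rank; lia.
Qed.

Lemma rankS0 t C : max_clique C -> opened C -> rank t C = 0 -> rank t.+1 C < 16.
Proof.
move=> mcC openC rank0; rewrite ltnNge; apply/negP => ge_rank.
have [|h [le_ht mark_h eq_h]] := @rank_wit t.+1 C; first lia.
have lt_mark := mark_lt h mcC openC.
move: le_ht; rewrite leq_eqVlt => /predU1P[eq|/[!ltnS] le_ht]; first lia.
by have := rank_geP le_ht mark_h; rewrite rank0; lia.
Qed.

Lemma rank_lt t C : max_clique C -> opened C -> rank t C < t.+1 * 16.
Proof.
move=> mcC openC; case: (posnP (rank t C)) => [->|/rank_wit[g [_ _ ->]]] //.
by have := mark_lt g mcC openC; lia.
Qed.

(** Marks are below 16, so equal ranks come from the same [g], and the separation of [mark g]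
    carries over. *)
Lemma rank_separated t C : max_clique C -> opened C ->
  separated (path_near A K C) (fun j => rank t (iter j next C)).
Proof.
move=> mcC openC j l lt_jl near_jl rank_gt0 eq_rank.
have [g [le_g mark_g eq_g]] := rank_wit rank_gt0.
have [|h [le_h mark_h eq_h]] := @rank_wit t (iter l next C); first by rewrite -eq_rank.
have lt_j := mark_lt g (iter_clique j mcC openC) (iter_opened j openC).
have lt_l := mark_lt h (iter_clique l mcC openC) (iter_opened l openC).
have eq_gh : g = h by lia.
rewrite -{}eq_gh in mark_h eq_h lt_l.
have [||m lt_m lt_mark] := @label_separated g g C (leqnn g) mcC openC j l lt_jl near_jl.
- exact: mark_g.
- by rewrite -/(mark _ _) -/(mark _ _); lia.
exists m => //; rewrite eq_g; apply: leq_trans (rank_geP le_g _).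
  by rewrite ltn_add2l.
exact: leq_ltn_trans lt_mark.
Qed.

Lemma rank_sup_gt0 t C : max_clique C -> opened C -> tower_class (name C) <= t ->
  0 < window_sup (rank t) C.
Proof.
move=> mcC openC; set g := tower_class _ => le_gt.
have lab0 : 0 < label g 0 C.
  by rewrite /= /g /tower_class; case: ex_minnP => h -> _.
have := label_gt0 (leqnn g) mcC openC lab0.
have [[i near_i <-] _] := window_supP (label g g) mcC openC => mark_gt0.
have [_ ub] := window_supP (rank t) mcC openC.
apply: leq_trans (ub i near_i); apply: leq_trans (rank_geP le_gt mark_gt0).
exact: leq_trans mark_gt0 (leq_addl _ _).
Qed.

Lemma rank_supS t C : max_clique C -> opened C -> tower_class (name C) <= t ->
  window_sup (rank t.+1) C = window_sup (rank t) C + 16.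
Proof.
move=> mcC openC le_t; have sup_gt0 := rank_sup_gt0 mcC openC le_t.
have [[i near_i eq_i] ub] := window_supP (rank t) mcC openC.
have [[i' near_i' eq_i'] ub'] := window_supP (rank t.+1) mcC openC.
apply/eqP; rewrite eqn_leq; apply/andP; split.
- rewrite -eq_i'; have [rank0|rank_gt0] := posnP (rank t (iter i' next C)).
    by have := rankS0 (iter_clique i' mcC openC) (iter_opened i' openC) rank0; lia.
  by rewrite rankS ?leq_add2r ?ub //; [apply: iter_clique|apply: iter_opened].
- rewrite -eq_i -rankS ?eq_i //; first exact: ub'.
    exact: iter_clique.
  exact: iter_opened.
Qed.

(** Beyond [rank_level C] each increment of [t] adds 16 to both sides. So drops that are evaluated
    each at its own level are the descents of one sequence along the path. *)
Lemma dropE t C : max_clique C -> opened C -> rank_level C <= t ->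
  drop C = (window_sup (rank t) (next C) < window_sup (rank t) C).
Proof.
move=> mcC openC; elim: t => [|t IH].
  by rewrite leqn0 /drop => /eqP ->.
rewrite leq_eqVlt => /predU1P[<-//|/[!ltnS] le_t].
move: (le_t); rewrite IH // geq_max => /andP[le_C le_nC].
rewrite !rank_supS ?ltn_add2r //; first exact: (iter_clique 1).
exact: (iter_opened 1).
Qed.

Definition class_bound T C := forall j, tower_class (name (iter j next C)) <= T.

(** One [T] serves the whole path, with ranks below [T.+1 * 16]; [big_gap] gives two successive
    drops, and the stretch between them witnesses the cut. *)
Lemma cut_exists T C : max_clique C -> opened C -> class_bound T C ->
  exists2 u, u < iter (3 * (T.+1 * 16)) (jump C) 0 & cut (iter u next C).
Proof.
move=> mcC openC bnd.
have level_le j : rank_level (iter j next C) <= T.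
  by rewrite geq_max (bnd j) (bnd j.+1).
have dropE' j : drop (iter j next C) =
    (window_sup (rank T) (iter j.+1 next C) < window_sup (rank T) (iter j next C)).
  by rewrite (@dropE T) //; [apply: iter_clique|apply: iter_opened].
have [d [u [lt_d lt_u dropd dropu [nodrop far]]]] := big_gap
  (near_sub (C := C)) (path_window_max (rank T) mcC openC)
  (@rank_separated T C mcC openC) (fun j => jump_gt j mcC openC)
  (fun j => jump_far mcC openC)
  (fun j => rank_sup_gt0 (iter_clique j mcC openC) (iter_opened j openC) (bnd j))
  (fun j => ltnW (window_sup_lt (iter_clique j mcC openC) (iter_opened j openC)
     (@rank_lt T))) 0.
exists u => //; split; first by rewrite dropE'.
exists (iter d.+1 next C), (u - d.+1); split.
- by split; [apply: iter_clique|apply: iter_opened].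
- rewrite iterB subnKC; last lia.
  by apply: (block_refl K_gt1); apply: iter_clique.
- by move=> i lt_i; rewrite iterB dropE' -leqNgt nodrop //; lia.
- exact: far.
Qed.


End Labels.

(** * Forest edges between connected classes *)

Lemma connect_mono (V : finType) (e e' : rel V) x y :
  connect e x y -> (forall u v, e u v -> e' u v) -> connect e' x y.
Proof. by move=> xy sub; apply: connect_sub xy => u v /sub/connect1. Qed.

Section ForestCount.

Variables (V : finType) (d : Order.disp_t) (W : orderType d).
Variables (F : rel V) (w : V -> V -> W) (class : V -> V).

Definition same_edge (x y u v : V) := (u == x) && (v == y) || (u == y) && (v == x).

Lemma same_edge_swap x y u v : same_edge x y u v = same_edge x y v u.
Proof. by rewrite /same_edge orbC andbC [X in _ || X]andbC. Qed.

(** A walk can be shortened to use the added edge at most once, in one of its two directions. *)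
Lemma connect_add_edge (R : rel V) a b x y : symmetric R ->
  connect (fun u v => R u v || same_edge a b u v) x y ->
  [|| connect R x y, connect R x a && connect R b y | connect R x b && connect R a y].
Proof.
move=> symR; have symc : connect_sym R by apply: sym_connect_sym.
case/connectP=> p; elim/last_ind: p y => [|p z IH] y; first by move=> _ -> /=;
  rewrite connect0.
rewrite rcons_path last_rcons => /andP[/IH IHp step] ->.
have {}IHp := IHp _ erefl; set u := last x p in IHp step.
case/orP: step => [/connect1 uz|/orP[]/andP[/eqP eq_u /eqP eq_z]].
- case/or3P: IHp => [xu|/andP[xa bu]|/andP[xb au]].
  + by rewrite (connect_trans xu uz).
  + by rewrite xa (connect_trans bu uz) orbT.
  + by rewrite xb (connect_trans au uz) !orbT.
- rewrite eq_u eq_z in IHp *; rewrite connect0 andbT.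
  case/or3P: IHp => [->|/andP[-> _]|/andP[-> _]]; rewrite ?orbT //.
- rewrite eq_u eq_z in IHp *; rewrite connect0 andbT.
  case/or3P: IHp => [->|/andP[-> _]|/andP[-> _]]; rewrite ?orbT //.
Qed.

Hypothesis symF : symmetric F.
Hypothesis symw : forall x y, w x y = w y x.
Hypothesis injw : forall x y u v, F x y -> F u v -> w x y = w u v -> same_edge x y u v.
Hypothesis kruskalF : forall x y, F x y ->
  ~~ connect (fun u v => F u v && (w x y < w u v)%O) x y.

Definition minus x y := [rel u v | F u v && ~~ same_edge x y u v].

Lemma minus_sym x y : symmetric (minus x y).
Proof. by move=> u v; rewrite /= symF same_edge_swap. Qed.

(** Induction on a set of other edges joining [x] to [y]. Its lightest edge [e] is indispensable by
    induction. If [e] is heavier than [x y], the whole set joins [x] to [y] by heavier edges. If it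
    is lighter, the remaining edges and [x y] join the ends of [e] by heavier edges. Both contradict
    [kruskalF]. *)
Lemma forest_acyclic x y : F x y -> ~~ connect (minus x y) x y.
Proof.
move=> Fxy.
suff H n (E : {set V * V}) : #|E| <= n ->
    {in E, forall e, minus x y e.1 e.2} ->
    ~~ connect (fun u v => ((u, v) \in E) || ((v, u) \in E)) x y.
  have /H : #|[set e | minus x y e.1 e.2]| <= #|[set e | minus x y e.1 e.2]| by [].
  move=> /(_ (fun e => _)); set R := (X in ~~ connect X _ _).
  have -> : connect R x y = connect (minus x y) x y.
    by apply: eq_connect => u v; rewrite /R !inE; have /= -> :=
      minus_sym x y u v; rewrite orbb.
  by apply => e; rewrite inE.
elim: n E => [|n IH] E leE subE.
  apply/connectP => -[[|z p] /=].
    by move=> _ eq_yx; have := kruskalF Fxy; rewrite -eq_yx connect0.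
  by move: leE; rewrite leqn0 cards_eq0 => /eqP ->; rewrite !inE.
have [->|[e0 Ee0]] := set_0Vmem E; first by apply: IH; rewrite ?cards0 // => e;
  rewrite inE.
have [e Ee min_e] := arg_minP (fun e => w e.1 e.2) Ee0.
have {}Ee : e \in E by [].
pose E' := E :\ e :\ (e.2, e.1).
have sub' : {subset E' <= E} by move=> f; rewrite !inE => /and3P[].
have ltE' : #|E'| <= n.
  by rewrite -ltnS; apply: leq_trans leE;
    rewrite (cardsD1 e E) Ee add1n ltnS subset_leq_card // subsetDl.
have nxy := IH E' ltE' (fun f Ef => subE f (sub' f Ef)).
have /andP[Fe ne] := subE e Ee.
apply/negP => xy; set R := (fun u v => ((u, v) \in E') || ((v, u) \in E')) in nxy.
have symR : symmetric R by move=> u v; rewrite /R orbC.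
have symc : connect_sym R by apply: sym_connect_sym.
have {}xy : connect (fun u v => R u v || same_edge e.1 e.2 u v) x y.
  apply: (connect_mono xy) => u v uv; rewrite /R /same_edge !inE -!pair_eqE /= in uv *.
  case: (eqVneq u e.1) (eqVneq v e.2) (eqVneq u e.2) (eqVneq v e.1) =>
    [?|?] [?|?] [?|?] [?|?] /=; rewrite ?orbT ?andbT ?andbF ?orbF //=.
have heavyR u v : R u v -> F u v && (w e.1 e.2 < w u v)%O.
  rewrite /R => uv; have [Fuv le_uv] : F u v /\ (w e.1 e.2 <= w u v)%O.
    case/orP: uv => /sub' Ef; have /andP[/= Ff _] := subE _ Ef; have /= le :=
      min_e _ Ef.
      by [].
    by rewrite [w u v]symw symF.
  rewrite Fuv lt_neqAle le_uv andbT; apply/eqP => /(injw Fe Fuv).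
  by case/orP => /andP[/eqP eu /eqP ev];
    rewrite eu ev !inE -!pair_eqE /= !eqxx ?andbF ?orbF in uv.
have lift u v : connect R u v ->
  connect (fun u v => F u v && (w e.1 e.2 < w u v)%O) u v.
  by move=> uv; apply: (connect_mono uv) => u' v' /heavyR.
have [lt_xy|lt_e|eq_w] := ltgtP (w x y) (w e.1 e.2).
- have := kruskalF Fxy; rewrite (connect_mono xy) //= => u v.
  case/orP => [/heavyR/andP[Fuv lt]|/orP[]/andP[/eqP-> /eqP->]].
  + by rewrite Fuv (lt_trans lt_xy).
  + by rewrite Fe; apply: lt_xy.
  + by rewrite symF Fe [w e.2 _]symw; apply: lt_xy.
- have := connect_add_edge symR xy; rewrite (negPf nxy) /=.
  pose G u v := F u v && (w e.1 e.2 < w u v)%O.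
  have Gxy : connect G x y by apply: connect1; rewrite /G Fxy; apply: lt_e.
  have Gyx : connect G y x.
    by apply: connect1; rewrite /G symF Fxy [w y x]symw; apply: lt_e.
  have /negP nk := kruskalF Fe; move=> /orP[]/andP[] c1 c2; apply: nk.
    rewrite symc in c1; rewrite symc in c2.
    exact: connect_trans (lift _ _ c1) (connect_trans Gxy (lift _ _ c2)).
  exact: connect_trans (lift _ _ c2) (connect_trans Gyx (lift _ _ c1)).
- by have := injw Fxy Fe eq_w; rewrite (negPf ne).
Qed.

Hypothesis class_connected : forall x y, class x = class y ->
  connect (fun u v => F u v && (class u == class v)) x y.

Definition crossing := [set e : V * V | F e.1 e.2 && (class e.1 != class e.2)].

(* The root of a tree component orients its edges; every class is entered by at
   most one edge directed away from the root. *)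
Definition away (e : V * V) := connect (minus e.1 e.2) e.1 (fingraph.root F e.1).

Let symc x y : connect_sym (minus x y).
Proof. exact/sym_connect_sym/minus_sym. Qed.

Lemma awayVrev e : F e.1 e.2 -> away e || away (e.2, e.1).
Proof.
move=> Fe; rewrite /away /=; have symcF : connect_sym F by apply: sym_connect_sym.
have -> : fingraph.root F e.2 = fingraph.root F e.1.
  by apply/eqP; rewrite root_connect // symcF connect1.
set r := fingraph.root F e.1.
have : connect (fun u v => minus e.1 e.2 u v || same_edge e.1 e.2 u v) e.1 r.
  apply: (connect_mono (connect_root F e.1)) => u v Fuv.
  by rewrite /= Fuv; case: same_edge.
have eq_rev : connect (minus e.2 e.1) =2 connect (minus e.1 e.2).
  by apply: eq_connect => u v; rewrite /= /same_edge orbC.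
move=> /(connect_add_edge (minus_sym _ _)); rewrite eq_rev.
by case/or3P => [->|/andP[_ ->]|/andP[_ ->]]; rewrite ?orbT.
Qed.

(** Inside the class the two heads are joined by a path that uses neither edge, as both edges cross.
    Two edges that enter the class from the side of the common root would therefore close a
    cycle. *)
Lemma away_inj e f : e \in crossing -> f \in crossing -> away e -> away f ->
  class e.2 = class f.2 -> e = f.
Proof.
case: e f => [x y] [x' y'];
  rewrite !inE /away /= => /andP[Fe ne] /andP[Fe' ne'] aw aw' eq_class.
apply/eqP; apply: contraT => neq_e.
have inner u v : same_edge x y u v || same_edge x' y' u v -> class u != class v.
  by case/orP=> /orP[]/andP[/eqP-> /eqP->] //; rewrite eq_sym.
have yy' u v : class x != class y ->
  same_edge x y =2 same_edge u v \/ same_edge x' y' =2 same_edge u v ->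
    connect (minus u v) y y'.
  move=> _ eq_uv; apply: (connect_mono (class_connected eq_class)) =>
    a b /andP[Fab eq_ab].
  rewrite /= Fab /=; apply: contraL eq_ab => uv; apply: inner.
  by case: eq_uv => ->; rewrite uv ?orbT.
have yy1 : connect (minus x y) y y' by apply: yy' => //; left.
have yy2 : connect (minus x' y') y y' by apply: yy' => //; right.
have nsame : ~~ same_edge x y x' y'.
  rewrite /same_edge negb_or; apply/andP; split.
    by apply: contra neq_e => /andP[/eqP-> /eqP->].
  by apply: contra ne => /andP[_ /eqP eqx]; rewrite eqx in eq_class; rewrite eq_class.
have symcF : connect_sym F by apply: sym_connect_sym.
have sub u v a b : connect (minus u v) a b -> connect F a b.
  by move=> ab; apply: (connect_mono ab) => c c' /andP[].
have eq_root : fingraph.root F x' = fingraph.root F x.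
  apply/eqP; rewrite root_connect //; apply: connect_trans (connect1 Fe') _.
  rewrite symcF; apply: connect_trans (connect1 Fe) _; exact: sub yy1.
rewrite eq_root in aw'; set r := fingraph.root F x in aw aw'.
have x'y : connect (minus x y) x' y.
  have x'y' : connect (minus x y) x' y' by apply: connect1; rewrite /= Fe'.
  by apply: connect_trans x'y' _; rewrite symc.
pose R := [rel u v | minus x y u v && ~~ same_edge x' y' u v].
have symR : symmetric R.
  by move=> u v; rewrite /= symF same_edge_swap [same_edge x' _ _ _]same_edge_swap.
have RsubL u v : connect R u v -> connect (minus x y) u v.
  by move=> uv; apply: (connect_mono uv) => a b /andP[].
have RsubR u v : connect R u v -> connect (minus x' y') u v.
  by move=> uv; apply: (connect_mono uv) => a b /andP[/andP[Fab _] nab]; rewrite /= Fab.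
have : connect (fun u v => R u v || same_edge x y u v) x' r.
  apply: (connect_mono aw') => u v /andP[Fuv nuv].
  by rewrite /= Fuv nuv andbT; case: same_edge.
have acy := forest_acyclic Fe; have acy' := forest_acyclic Fe'.
move=> /(connect_add_edge symR)/or3P[/RsubL
  x'r|/andP[_ /RsubL yr]|/andP[/RsubR x'y2 _]].
- apply: contraNT acy => _; apply: connect_trans aw _; rewrite symc.
  by apply: connect_trans x'r; rewrite symc.
- by apply: contraNT acy => _; apply: connect_trans aw _; rewrite symc.
- by apply: contraNT acy' => _; apply: connect_trans x'y2 yy2.
Qed.

(** [crossing] holds both orientations of an edge. The one directed away from the root is charged to
    the class of its head, the other one to the class of its tail, which is the same class. Each
    kind is charged injectively. *)
Lemma crossing_card : #|crossing| <= 2 * #|[set class e.1 | e in crossing]|.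
Proof.
set B := [set class e.1 | e in crossing].
have rev_crossing e : e \in crossing -> (e.2, e.1) \in crossing.
  by rewrite !inE /= symF eq_sym.
pose g (e : V * V) := if away e then (true, class e.2) else (false, class e.1).
have inj_g : {in crossing &, injective g}.
  move=> e f Ee Ef; rewrite /g; have := awayVrev; case: ifP => aw;
    case: ifP => aw' rev //.
    by case; apply: away_inj.
  case=> eq_class; have [/andP[Fe _] /andP[Ff _]] : F e.1 e.2 && true /\
    F f.1 f.2 && true.
    by move: Ee Ef; rewrite !inE => /andP[-> _] /andP[-> _].
  have /= re := rev e Fe; have /= rf := rev f Ff; rewrite aw in re; rewrite aw' in rf.
  have := away_inj (rev_crossing _ Ee) (rev_crossing _ Ef) re rf eq_class.
  by case: e f {re rf Ee Ef Fe Ff aw aw' eq_class rev} => [? ?] [? ?] /= [-> ->].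
rewrite -(card_in_imset inj_g) -card_bool -cardsT -cardsX.
apply: subset_leq_card; apply/fintype.subsetP => _ /imsetP[e Ee ->]; rewrite /g.
case: ifP => _; rewrite !inE /=; apply/imsetP; last by exists e.
by exists (e.2, e.1) => //; apply: rev_crossing.
Qed.

End ForestCount.

Lemma card_cover_le (P V : finType) (S : {set P}) (S_ : V -> {set P}) :
  (forall x, x \in S -> exists r, x \in S_ r) -> #|S| <= \sum_r #|S_ r|.
Proof.
move=> cov; under eq_bigr => r _ do rewrite -sum1_card big_mkcond.
rewrite exchange_big -sum1_card big_mkcond; apply: leq_sum => x _.
by case: ifP => // /cov[r rx]; rewrite (bigD1 r) //= rx.
Qed.

Lemma card_disjoint_le (P V : finType) (B : {set V}) (S : {set P}) (S_ : V -> {set P}) :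
  (forall r x, x \in S_ r -> x \in S) ->
  (forall r s x, x \in S_ r -> x \in S_ s -> r = s) ->
  \sum_(r in B) #|S_ r| <= #|S|.
Proof.
move=> sub disj; under eq_bigr => r _ do rewrite -sum1_card big_mkcond.
rewrite exchange_big -[#|S|]sum1_card [leqRHS]big_mkcond; apply: leq_sum => x _.
rewrite -big_mkcondr /=; have [/existsP[r /andP[Br rx]]|none] :=
  boolP [exists r, (r \in B) && (x \in S_ r)].
  rewrite (sub _ _ rx) (bigD1 r) ?Br //= big1 // => s /andP[/andP[_ sx]].
  by rewrite (disj _ _ _ rx sx) eqxx.
by rewrite big1 // => r Br; case/existsP: none; exists r.
Qed.

(** * Comparing an independent set with the union of optima inside the classes *)

Section ApproxCount.

Variables (P V : finType) (adj : rel P) (inc : P -> V -> bool).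
Variables (F : rel V) (class : V -> V) (K : nat).

Definition stable (S : {set P}) := {in S &, forall x y, ~~ adj x y}.

Definition interior r := [set x | [exists C, inc x C] &&
  [forall C, inc x C ==> (class C == r)]].

Local Notation crossing := (crossing F class).
Let B := [set class e.1 | e in crossing].

Hypothesis inc_clique : forall x y C, inc x C -> inc y C -> x != y -> adj x y.
Hypothesis inc_crossing : forall x C D, inc x C -> inc x D -> class C != class D ->
  exists C' D', [/\ F C' D', class C' = class C, class D' != class C, inc x C'
    & inc x D'].
Hypothesis class_wide : forall r, r \in B -> exists S,
  [/\ stable S, #|S| = K & forall x, x \in S -> exists2 C, inc x C & class C = r].
Hypothesis crossing_le : #|crossing| <= 2 * #|B|.

Variable S_ : V -> {set P}.
Hypothesis S_interior : forall r, S_ r \subset interior r.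
Hypothesis S_max : forall r (S : {set P}), stable S -> S \subset interior r ->
  #|S| <= #|S_ r|.

Lemma stable_sub (S S' : {set P}) : S \subset S' -> stable S' -> stable S.
Proof. by move=> /fintype.subsetP sub st x y /sub Sx /sub; apply: st. Qed.

(** Each clique contains at most one vertex of [S], so vertices with different edges chosen for them
    are counted apart by the tails. *)
Lemma stable_edges (S : {set P}) (E : {set V * V}) : stable S ->
  (forall x, x \in S -> exists2 e, e \in E & inc x e.1) -> #|S| <= #|E|.
Proof.
move=> st inE_; have [->|[x0 Sx0]] := set_0Vmem S; first by rewrite cards0.
pose h (e : V * V) := odflt x0 [pick x in S | inc x e.1].
apply: leq_trans (leq_imset_card h E); apply: subset_leq_card.
apply/fintype.subsetP => x Sx; have [e Ee xe] := inE_ x Sx; apply/imsetP;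
  exists e => //.
rewrite /h; case: pickP => [y /andP[Sy ye]|/(_ x)]; last by rewrite Sx xe.
by apply/eqP; apply: contraTT (st x y Sx Sy) => neq; rewrite negbK (inc_clique xe ye).
Qed.

Let X := [set x | [exists C, exists D, [&& inc x C, inc x D & class C != class D]]].

Lemma boundary_or_interior x : (exists C, inc x C) -> x \notin X ->
  exists r, x \in interior r.
Proof.
move=> [C xC] nX; exists (class C); rewrite inE; apply/andP; split;
  first by apply/existsP; exists C.
apply/forallP => D; apply/implyP => xD; apply: contraR nX => neq.
by rewrite inE; apply/existsP; exists D; apply/existsP; exists C; rewrite xD xC.
Qed.

Lemma boundary_crossing x C : inc x C -> x \in X ->
  exists2 e, e \in crossing & class e.1 = class C /\ inc x e.1.
Proof.
rewrite inE => xC /existsP[D /existsP[D' /and3P[xD xD' neq]]].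
have [E xE neqE] : exists2 E, inc x E & class C != class E.
  have [eq|neqD] := eqVneq (class C) (class D); last by exists D.
  by exists D'; rewrite ?eq.
have [C' [E' [FE eqC neqE' xC' xE']]] := inc_crossing xC xE neqE.
by exists (C', E'); rewrite ?inE /= ?FE ?eqC 1?eq_sym.
Qed.

(** Vertices of [O] inside a class are bounded by the optimum there, boundary vertices by the
    directed crossing edges. The second bound splits [K] independent vertices of each class of [B]
    in the same way; charging edges to the class of their tail counts each of them once. *)
Lemma approx_count (O : {set P}) : stable O ->
  (forall x, x \in O -> exists C, inc x C) ->
  #|O| <= #|\bigcup_r S_ r| + 2 * #|B| /\
  #|B| * K <= #|\bigcup_r S_ r| + 2 * #|B|.
Proof.
move=> stO incO.
have disjS r s x : x \in S_ r -> x \in S_ s -> r = s.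
  move=> /(fintype.subsetP (S_interior r)) + /(fintype.subsetP (S_interior s)).
  rewrite !inE => /andP[/existsP[C xC] /forallP/(_ C)] + /andP[_ /forallP/(_ C)].
  by rewrite xC /= => /eqP-> /eqP.
have subS r x : x \in S_ r -> x \in \bigcup_r S_ r by move=> rx; apply/bigcupP;
  exists r.
have sumS : \sum_r #|S_ r| <= #|\bigcup_r S_ r|.
  by have := @card_disjoint_le _ _ [set: V] _ _ subS disjS;
    rewrite (eq_bigl xpredT) // => r; rewrite inE.
split.
  rewrite -(cardsID X O) addnC; apply: leq_add.
    apply: leq_trans sumS; apply: leq_trans
      (_ : \sum_r #|O :&: interior r| <= _); last first.
      apply: leq_sum => r _; apply: S_max; last exact: subsetIr.
      by apply: stable_sub stO; apply: subsetIl.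
    apply: card_cover_le => x; rewrite inE => /andP[nX Ox].
    have [r rx] := boundary_or_interior (incO x Ox) nX.
    by exists r; rewrite inE Ox.
  apply: leq_trans crossing_le; apply: stable_edges.
    by apply: stable_sub stO; apply: subsetIl.
  move=> x; rewrite inE => /andP[/incO[C xC] Xx].
  by have [e Ee [_ xe]] := boundary_crossing xC Xx; exists e.
pose E_ r := [set e in crossing | class e.1 == r].
apply: leq_trans (_ : \sum_(r in B) (#|S_ r| + #|E_ r|) <= _).
  rewrite -sum_nat_const; apply: leq_sum => r Br.
  have [S [stS <- incS]] := class_wide Br.
  rewrite -(cardsID X S) addnC; apply: leq_add.
    apply: S_max; first by apply: stable_sub stS; apply: subsetDl.
    apply/fintype.subsetP => x; rewrite inE => /andP[nX /incS[C xC eqC]].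
    have [s sx] := @boundary_or_interior x (ex_intro _ C xC) nX.
    suff -> : r = s by [].
    by move: sx; rewrite inE => /andP[_ /forallP/(_ C)]; rewrite xC eqC => /eqP.
  apply: stable_edges; first by apply: stable_sub stS; apply: subsetIl.
  move=> x; rewrite inE => /andP[/incS[C xC eqC] Xx].
  have [e Ee [eqe xe]] := boundary_crossing xC Xx.
  by exists e => //; rewrite inE Ee eqe eqC eqxx.
rewrite big_split /=; apply: leq_add.
  exact: card_disjoint_le subS disjS.
apply: leq_trans crossing_le; apply: card_disjoint_le => [r e|r s e].
  by rewrite inE => /andP[].
by rewrite !inE => /andP[_ /eqP<-] /andP[_ /eqP].
Qed.

End ApproxCount.

(** * Chordality and the clique tree *)

Definition chordal_nat (A : rel nat) := forall p : seq nat, ucycle A p -> 4 <= size p ->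
  exists x y, [/\ x \in p, y \in p,
    A x y & [/\ x <> y, y <> path.next p x & x <> path.next p y]].

Definition kruskal A C D := meets A C D /\
  ~ reach (fun U V => meets A U V /\ (weight C D < weight U V)%O) C D.

Section Chordal.

Variable A : rel nat.
Hypothesis symA : symmetric A.
Hypothesis reflA : forall x y, A x y -> A x x.
Variable N : nat.
Hypothesis boundA : forall x y, A x y -> x < N.
Hypothesis chordalA : chordal_nat A.

(** The path closed by [q] is a cycle. As the path is induced, a chord joins [q] to an inner vertex;
    the path is split there, and induction on the length applies to the part that contains [i]. *)
Lemma fan (f : nat -> nat) q a n : (forall i, a <= i <= a + n -> f i <> q) ->
  (forall i j, a <= i -> i < j -> j <= a + n -> f i <> f j /\
    A (f i) (f j) = (j == i.+1)) ->
  A q (f a) -> A q (f (a + n)) -> forall i, a <= i <= a + n -> A q (f i).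
Proof.
have [m] := ubnP n; elim: m a n => // m IH a n lt_nm nq ind qa qb i le_i.
have [->//|/eqP ia] := eqVneq i a; have [->//|/eqP ib] := eqVneq i (a + n).
have [s size_s nth_s] : exists2 s, size s = n.+1 &
    forall x0 k, k < n.+1 -> nth x0 s k = f (a + k).
  exists [seq f i | i <- iota a n.+1] => [|x0 k lt_k].
    by rewrite size_map size_iota.
  by rewrite (nth_map 0) ?size_iota // nth_iota.
have mem_s x : x \in s -> exists2 j, a <= j <= a + n & x = f j.
  move=> sx; have := sx; rewrite -index_mem size_s => lt_i.
  by exists (a + index x s); [lia | rewrite -(nth_s 0) ?nth_index].
have f_s j : a <= j <= a + n -> f j \in s.
  move=> le_j; have -> : f j = nth 0 s (j - a) by rewrite nth_s; [congr f|]; lia.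
  by rewrite mem_nth // size_s; lia.
have uniq_s : uniq s.
  apply/(uniqP 0) => j k; rewrite !inE size_s => lt_j lt_k; rewrite !nth_s // => eq_f.
  have [lt|lt|//] := ltngtP j k.
    by have [] := ind (a + j) (a + k); [lia|lia|lia|rewrite eq_f].
  by have [] := ind (a + k) (a + j); [lia|lia|lia|rewrite eq_f].
have qs : q \notin s by apply/negP => /mem_s[j le_j] /esym; apply: nq.
pose p := q :: s.
have cyc : ucycle A p.
  rewrite /ucycle /p cons_uniq qs uniq_s !andbT /= rcons_path; apply/andP; split.
    apply/(pathP 0) => k; rewrite size_s => lt_k; rewrite nth_s //.
    case: k lt_k => [|k] lt_k /=; first by rewrite addn0.
    rewrite nth_s; last lia.
    by have [|||_ ->] := ind (a + k) (a + k.+1); rewrite ?addnS //; lia.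
  by rewrite (last_nth q) size_s /= nth_s // symA.
have [|x [y [px py Axy [neq ny nx]]]] := chordalA cyc; first by rewrite /= size_s; lia.
have next_q : path.next p q = f a.
  by rewrite next_nth mem_head /= eqxx nth_s ?addn0.
have next_f j : a <= j <= a + n -> path.next p (f j) = if j == a + n then q else f j.+1.
  move=> le_j; have sj := f_s j le_j.
  rewrite next_nth inE sj orbT /=; have /eqP/negPf-> : q <> f j by apply/nesym/nq.
  have eq_nth : f j = nth q s (j - a) by rewrite nth_s; [congr f|]; lia.
  have -> : index (f j) s = j - a by rewrite eq_nth index_uniq ?size_s //; lia.
  case: eqP => [eqj|neqj]; first by rewrite nth_default // size_s; lia.
  by rewrite nth_s; [congr f|]; lia.
have chord j : a < j < a + n -> A q (f j) -> A q (f i).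
  move=> lt_j qj; have [le_ij|lt_ji] := leqP i j.
    apply: (IH a (j - a)) => //; try lia.
    - by move=> k le_k; apply: nq; lia.
    - by move=> k l ? ? ?; apply: ind => //; lia.
    - by rewrite subnKC //; lia.
  apply: (IH j (a + n - j)) => //; try lia.
  - by move=> k le_k; apply: nq; lia.
  - by move=> k l ? ? ?; apply: ind => //; lia.
  - by rewrite subnKC //; lia.
move: px py; rewrite !inE => /predU1P[eqx|/mem_s[k]].
  case/predU1P=> [eqy|/mem_s[j]]; first by rewrite eqx eqy in neq.
  move=> le_j eqy; rewrite eqx eqy ?next_q in Axy nx ny *.
  apply: (chord j) Axy; rewrite next_f in nx; last lia.
  have ja : j <> a by move=> eqj; rewrite eqj in ny.
  by move: nx; case: eqP => // jn _; lia.
move=> le_k eqx /predU1P[eqy|/mem_s[j]].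
  rewrite eqx eqy ?next_q in Axy nx ny *; rewrite symA in Axy.
  apply: (chord k) Axy; rewrite next_f in ny; last lia.
  have ka : k <> a by move=> eqk; rewrite eqk in nx.
  by move: ny; case: eqP => // kn _; lia.
move=> le_j eqy; rewrite eqx eqy in Axy nx ny neq.
rewrite !next_f in nx ny; try lia.
have [lt|lt|eq] := ltngtP j k; last by rewrite eq in neq.
  have [||_] := ind j k _ lt; [lia|lia|rewrite symA Axy => /esym/eqP eqk].
  by move: nx; rewrite eqk; case: eqP => // ?; lia.
have [||_] := ind k j _ lt; [lia|lia|rewrite Axy => /esym/eqP eqj].
by move: ny; rewrite eqj; case: eqP => // ?; lia.
Qed.

Definition off (Q : {fset nat}) := reach (fun u v => A u v /\ v \notin Q).

Lemma off_path Q x y : x \notin Q -> off Q x y -> exists n (f : nat -> nat),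
  [/\ f 0 = x, f n = y, forall i, i <= n -> f i \notin Q &
      forall i, i < n -> A (f i) (f i.+1)].
Proof.
move=> Qx; elim=> [|u v _ [n [f [f0 fn Qf Af]]] [uv Qv]].
  by exists 0, (fun=> x); split.
exists n.+1, (fun i => if i <= n then f i else v); split=> //.
- by rewrite ltnn.
- by move=> i _; case: leqP => // le_i; apply: Qf.
- move=> i; rewrite ltnS => le_i; rewrite le_i.
  case: ltnP => [lt_i|ge_i]; first exact: Af.
  by rewrite (_ : i = n) ?fn //; lia.
Qed.

(** A shortest path off [Q] is induced, so [fan] makes every vertex of [Q] adjacent to all of it. *)
Lemma off_common Q x y : x \notin Q -> off Q x y ->
  {in Q, forall q, A q x} -> {in Q, forall q, A q y} ->
  reach (fun u v => [/\ A u v, v \notin Q & {in Q, forall q, A q v}]) x y.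
Proof.
move=> Qx xy Ax Ay.
have ex : exists n, `[< exists f : nat -> nat, [/\ f 0 = x, f n = y,
    forall i, i <= n -> f i \notin Q & forall i, i < n -> A (f i) (f i.+1)] >].
  by have [n pn] := off_path Qx xy; exists n; apply/asboolP.
have [n /asboolP[f [f0 fn Qf Af]] min_n] := ex_minnP ex.
have short m (g : nat -> nat) : g 0 = x -> g m = y ->
    (forall i, i <= m -> g i \notin Q) ->
      (forall i, i < m -> A (g i) (g i.+1)) -> n <= m.
  by move=> *; apply: min_n; apply/asboolP; exists g.
have nochord i j : i.+1 < j -> j <= n -> ~ A (f i) (f j).
  move=> lt_ij le_jn Aij.
  (* The path with the part strictly between [i] and [j] replaced by the chord. *)
  pose g k := if k <= i then f k else f (k + (j - i.+1)).
  suff : n <= n - (j - i.+1) by lia.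
  apply: (@short _ g); rewrite /g //.
  - by case: leqP => [|_]; [lia | rewrite subnK //; lia].
  - by move=> k le_k; case: leqP => _; apply: Qf; lia.
  - move=> k lt_k; case: (leqP k.+1 i) => [lt_ki|le_ik].
      by rewrite ifT; [apply: Af|]; lia.
    case: leqP => [le_ki|lt_ik]; last by apply: Af; lia.
    have -> : k = i by lia.
    by have -> : i.+1 + (j - i.+1) = j by lia.
have inj i j : i < j -> j <= n -> f i <> f j.
  move=> lt_ij le_jn eq_f; have [lt_jn|le_nj] := ltnP j n.
    by apply: (@nochord i j.+1) => //; rewrite eq_f; apply: Af.
  suff : n <= i by lia.
  apply: (@short i f) => // [|k ?|k ?]; [|apply: Qf; lia|apply: Af; lia].
  by rewrite eq_f -fn; congr f; lia.
have common i : i <= n -> {in Q, forall q, A q (f i)}.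
  move=> le_in q Qq; apply: (@fan f q 0 n) => //.
  - by move=> k le_k eq_q; have := Qf k le_k; rewrite eq_q Qq.
  - move=> k l _ lt_kl le_ln; split; first exact: inj.
    case: eqP => [->|neq]; first by apply: Af; lia.
    by apply/negP; apply: nochord => //; lia.
  - by rewrite f0; apply: Ax.
  - by rewrite fn; apply: Ay.
rewrite -fn; suff H k : k <= n -> reach (fun u v =>
    [/\ A u v, v \notin Q & {in Q, forall q, A q v}]) x (f k) by exact: H.
elim: k => [|k IH] lt_kn; first by rewrite f0; apply: reach_refl.
apply: (reach_step (IH (ltnW lt_kn))).
by split; [exact: Af|exact: Qf|exact: common].
Qed.

Lemma max_clique_extend (S : {fset nat}) : S != fset0 -> {in S &, forall x y, A x y} ->
  exists2 C, max_clique A C & S `<=` C.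
Proof.
move=> S0 clS; pose U := [fset i | i in iota 0 N].
pose P k := exists T : {fset nat},
  [/\ #|` T| = k, S `<=` T & {in T &, forall x y, A x y}].
have in_s k : P k -> k \in iota 0 (#|` U|).+1.
  move=> [T [<- _ clT]]; rewrite mem_iota /= add0n ltnS.
  apply: fsubset_leq_card; apply: fsubset_iota => x Tx.
  exact: boundA (clT x x Tx Tx).
have PS : P #|` S| by exists S.
have [k [C [sizeC subC clC]] max_k] := max_in_seq PS in_s.
exists C => //; split=> //.
  by apply: contraNneq S0 => C0; rewrite C0 fsubset0 in subC.
move=> x Ax; apply: contrapT => /negP nCx.
have Axx : A x x.
  have /fset0Pn[y Sy] := S0; exact: reflA (Ax y (fsubsetP subC y Sy)).
have : P #|` x |` C|.
  exists (x |` C); split=> //; first exact: fsubset_trans subC (fsubsetUr _ _).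
  move=> y z; rewrite !inE => /predU1P[->|Cy] /predU1P[->|Cz] //; first exact: Ax.
    by rewrite symA; apply: Ax.
  exact: clC.
by move=> /max_k; rewrite cardfsU1 nCx sizeC leEnat; lia.
Qed.

(* Chordality makes the Kruskal forest of the clique graph a clique tree: the
   cliques that contain a vertex are connected in it. *)
Lemma kruskal_cut v (P : {fset nat} -> Prop) C0 C1 : max_clique A C0 ->
  max_clique A C1 ->
  v \in C0 -> v \in C1 -> P C0 -> ~ P C1 ->
  exists C D, [/\ kruskal A C D, P C, ~ P D, v \in C & v \in D].
Proof.
move=> mc0 mc1 v0 v1 P0 nP1; pose U := fpowerset [fset i | i in iota 0 N].
have inU C : max_clique A C -> C \in U.
  by move=> /(max_clique_bound boundA) ltN; rewrite fpowersetE fsubset_iota.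
(* The edge sought is the heaviest pair of cliques through [v] that crosses from [P] to its
   complement; it remains to exclude a chain of heavier edges between its ends. *)
pose cand w := exists C D, [/\ max_clique A C /\ max_clique A D,
  v \in C /\ v \in D, P C, ~ P D & weight C D = w].
have cand0 : cand (weight C0 C1) by exists C0, C1.
have in_s w : cand w -> w \in [seq weight C D | C <- U, D <- U].
  move=> [C [D [[mcC mcD] _ _ _ <-]]]; apply/allpairsP; exists (C, D).
  by split=> //; apply: inU.
have [_ [C [D [[mcC mcD] [vC vD] PC nPD <-]]] max_w] := max_in_seq cand0 in_s.
have neCD : C <> D by move=> eq; rewrite -eq in nPD.
have CD : meets A C D by split=> //; exists v.
exists C, D; split=> //; split=> // chain.
pose Q := C `&` D; have vQ : v \in Q by rewrite !inE vC.
have light E E' : max_clique A E -> max_clique A E' -> v \in E -> v \in E' ->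
    P E -> ~ P E' -> (weight E E' <= weight C D)%O.
  by move=> *; apply: max_w; exists E, E'.
(* Cliques over [Q] that share a vertex outside [Q] have a larger intersection than [C] and [D], so
   they cannot be a crossing pair. *)
have bigger E E' x : max_clique A E -> max_clique A E' -> Q `<=` E -> Q `<=` E' ->
    x \in E -> x \in E' -> x \notin Q -> P E -> P E'.
  move=> mcE mcE' QE QE' Ex Ex' Qx PE; apply: contrapT => nPE'.
  have /weight_card := light E E' mcE mcE' (fsubsetP QE v vQ)
    (fsubsetP QE' v vQ) PE nPE'.
  suff : #|` x |` Q| <= #|` E `&` E'| by rewrite cardfsU1 Qx -/Q; lia.
  apply/fsubset_leq_card/fsubsetP => y; rewrite in_fset1U in_fsetI => /predU1P[->|Qy].
    by rewrite Ex.
  by rewrite (fsubsetP QE) ?(fsubsetP QE').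
(* The connection off [Q] can be taken through common neighbours of [Q]. Two consecutive ones lie
   with [Q] in a maximal clique, so [bigger] carries [P] along. *)
have same E E' x y : max_clique A E -> max_clique A E' -> Q `<=` E -> Q `<=` E' ->
    x \in E -> x \notin Q -> y \in E' -> y \notin Q -> off Q x y -> P E -> P E'.
  move=> mcE mcE' QE QE' Ex Qx E'y Qy xy PE.
  have [_ clE _] := mcE; have [_ clE' _] := mcE'.
  have := @off_common Q x y Qx xy
    (fun q Qq => clE q x (fsubsetP QE q Qq) Ex)
      (fun q Qq => clE' q y (fsubsetP QE' q Qq) E'y).
  move=> common; pose R z := [/\ z \notin Q, {in Q, forall q, A q z} &
    forall G, max_clique A G -> Q `<=` G -> z \in G -> P G].
  suff [_ _] : R y by apply.
  apply: (reach_stable common).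
    split=> // [q Qq|G mcG QG Gx]; first by apply: clE => //; apply: (fsubsetP QE).
    exact: (bigger E G x mcE mcG QE QG Ex Gx Qx PE).
  move=> z z' [Qz Az Pz] [Azz' Qz' Az']; split=> // G mcG QG Gz'.
  have [|a b|H mcH] := @max_clique_extend (z |` (z' |` Q)).
  - by apply/fset0Pn; exists z; rewrite !inE eqxx.
  - have clC : {in Q &, forall q q', A q q'}.
      have [_ clC _] := mcC; move=> q q'; rewrite !inE => /andP[? _] /andP[? _];
        exact: clC.
    have Az1 : A z z := reflA Azz'.
    have Az2 : A z' z' by apply: (@reflA _ z); rewrite symA.
    rewrite !in_fset1U => /or3P[/eqP->|/eqP->|Qa] /or3P[/eqP->|/eqP->|Qb] //.
    + by rewrite symA; apply: Az.
    + by rewrite symA.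
    + by rewrite symA; apply: Az'.
    + exact: Az.
    + exact: Az'.
    + exact: clC.
  move=> /fsubsetP subH.
  have QH : Q `<=` H by apply/fsubsetP => q Qq; apply: subH;
    rewrite !in_fset1U Qq !orbT.
  apply: (bigger H G z') => //; first by apply: subH; rewrite !in_fset1U eqxx orbT.
  by apply: Pz => //; apply: subH; rewrite !in_fset1U eqxx.
have notsub E E' : max_clique A E -> max_clique A E' -> E <> E' -> Q = E `&` E' ->
    exists2 x, x \in E & x \notin Q.
  move=> mcE mcE' neq eqQ; apply: contrapT => none; apply: neq.
  apply: max_clique_eq mcE mcE' _; apply/fsubsetP => x Ex.
  apply: contrapT => /negP nE'x; apply: none; exists x => //.
  by rewrite eqQ in_fsetI negb_and nE'x orbT.
(* Invariant of the heavier chain: the current clique is joined, off [Q], to a clique over [Q] that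
   satisfies [P]. At [D] it contradicts [same]. *)
pose Inv E := max_clique A E /\ exists G y x, [/\ max_clique A G /\ Q `<=` G, P G,
  y \in G /\ y \notin Q, x \in E /\ x \notin Q & off Q y x].
have QC : Q `<=` C by apply: fsubsetIl.
have QD : Q `<=` D by apply: fsubsetIr.
suff [_ [G [y [x [[mcG QG] PG [Gy Qy] [Dx Qx] yx]]]]] : Inv D.
  by apply: nPD; apply: (same G D y x).
apply: (reach_stable chain).
  split=> //; have [x Cx Qx] := notsub C D mcC mcD neCD erefl.
  by exists C, x, x; split=> //; apply: reach_refl.
move=> E E' [mcE [G [y [x [[mcG QG] PG [Gy Qy] [Ex Qx] yx]]]]] [[_ mcE' neE _] lt_w].
split=> //; have [[u [Eu E'u Qu]]|none] :=
    pselect (exists u, [/\ u \in E, u \in E' & u \notin Q]).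
  exists G, y, u; split=> //; apply: (reach_step yx).
  by have [_ clE _] := mcE; split=> //; apply: clE.
(* The edge is heavier than [C D], so its intersection is at least as large as [Q], and it is
   contained in [Q]. Both ends then contain [v], [P] passes to [E'] by the choice of [C D], and the
   invariant restarts at [E']. *)
have eqQ : E `&` E' = Q.
  apply/eqP; rewrite eqEfcard (weight_card (ltW lt_w)) andbT.
  apply/fsubsetP => u; rewrite in_fsetI => /andP[Eu E'u].
  by apply: contrapT => /negP Qu; apply: none; exists u.
have QE : Q `<=` E by rewrite -eqQ fsubsetIl.
have QE' : Q `<=` E' by rewrite -eqQ fsubsetIr.
have PE : P E by apply: (same G E y x).
have PE' : P E'.
  apply: contrapT => nPE'.
  have := light E E' mcE mcE' (fsubsetP QE v vQ) (fsubsetP QE' v vQ) PE nPE'.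
  by rewrite leNgt lt_w.
have [z E'z Qz] : exists2 x, x \in E' & x \notin Q.
  by apply: (notsub E' E) => //; [exact: nesym | rewrite fsetIC].
by exists E', z, z; split=> //; apply: reach_refl.
Qed.

End Chordal.

(** * Clusters along pointer paths *)

Lemma reach_prefix T (R : T -> T -> Prop) (P : T -> Prop) x y : reach R x y ->
  (forall z, reach R x z -> P z) ->
  reach (fun u v => [/\ R u v, P u & P v]) x y.
Proof.
move=> xy sub; elim: xy => [|u v xu IH uv]; first exact: reach_refl.
apply: (reach_step IH); split=> //; apply: sub => //; exact: reach_step uv.
Qed.

Section Clusters.

Variables (A : rel nat) (K : nat).

Local Notation next := (next A K).
Local Notation near := (near A K).
Local Notation opened := (opened A K).
Local Notation exit := (exit A K).
Local Notation max_clique := (max_clique A).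
Local Notation block := (block A K).
Local Notation cut := (cut A K).
Local Notation drop := (drop A K).
Local Notation window_sup := (window_sup A K).

Definition hit C : nat := xget 0 [set u | cut (iter u next C) /\
  forall i, i < u -> ~ cut (iter i next C)].

Definition landing C := iter (hit C) next C.

(* Open blocks are grouped by the first cut on their path. *)
Definition cluster C D := max_clique D /\ ((~ opened C /\ block C D) \/
  [/\ opened C, opened D & block (landing C) (landing D)]).

(* Vertices with cliques in two clusters are dropped: independent ones lie in
   the ends of distinct Kruskal edges between clusters. *)
Definition inner (F : {fset nat} -> Prop) x :=
  (exists2 C, max_clique C & x \in C) /\ forall C, max_clique C -> x \in C -> F C.

Definition independent_in (P : nat -> Prop) (S : {fset nat}) :=
  {in S, forall x, P x} /\ {in S &, forall x y, x <> y -> ~~ A x y}.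

(** Chosen through its specification alone, so all nodes that know the same cluster choose the same
    set. *)
Definition best_in P : {fset nat} := xget fset0 [set S | independent_in P S /\
  forall S', independent_in P S' -> #|` S'| <= #|` S|].

Definition output x := exists C, [/\ max_clique C, x \in C, inner (cluster C) x &
  x \in best_in (inner (cluster C))].


Lemma near_block C D i : block C D -> near C i = near D i.
Proof.
move=> CD; rewrite /near; congr (thin _ _ (members _)); apply/funext => E.
have eqj j : block (iter j next C) = block (iter j next D).
  by case: j => [|j]; [apply: block_eq | rewrite !iterSr (next_block CD)].
by apply/propext; split=> -[j le_j jE]; exists j => //; [rewrite -eqj|rewrite eqj].
Qed.

Lemma window_sup_block f C D : block C D -> f C = f D ->
  window_sup f C = window_sup f D.
Proof.
move=> CD eq_f; have eqj j : f (iter j next C) = f (iter j next D).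
  by case: j => [//|j]; rewrite !iterSr (next_block CD).
rewrite /window_sup; congr xget; apply/funext => v; apply/propext.
split=> -[[i near_i eq_i] ub]; split.
- by exists i; rewrite -?eqj // -(near_block _ CD).
- by move=> j; rewrite -eqj -(near_block _ CD); apply: ub.
- by exists i; rewrite ?eqj // (near_block _ CD).
- by move=> j; rewrite eqj (near_block _ CD); apply: ub.
Qed.

Lemma name_block C D : block C D -> name A K C = name A K D.
Proof. by move=> CD; rewrite /name (exit_block CD). Qed.

Lemma label_block t s C D : block C D -> label A K t s C = label A K t s D.
Proof.
move=> CD; elim: s => [|s IH] /=; first by rewrite (name_block CD).
by rewrite (window_sup_block CD IH) (next_block CD).
Qed.

Lemma rank_block t C D : block C D -> rank A K t C = rank A K t D.
Proof. by move=> CD; apply: eq_bigr => g _; rewrite /mark (label_block _ _ CD). Qed.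

Lemma drop_block C D : block C D -> drop C = drop D.
Proof.
move=> CD; rewrite /drop /rank_level (name_block CD) (next_block CD).
by rewrite (window_sup_block CD (rank_block _ CD)).
Qed.

Lemma cut_block C D : block C D -> cut C -> cut D.
Proof.
move=> CD [dropC [E [l [mcE lC nodrop far]]]]; split; first by rewrite -(drop_block CD).
by exists E, l; split=> //; apply: block_trans CD.
Qed.

Lemma hit_block C D : block C D -> hit C = hit D.
Proof.
move=> CD; have eqj j : cut (iter j next C) = cut (iter j next D).
  case: j => [|j]; last by rewrite !iterSr (next_block CD).
  by apply/propext; split; apply: cut_block; last exact: block_sym.
rewrite /hit; congr xget; apply/funext => u; apply/propext.
split=> -[cut_u first_u]; split=> [|j lt_j].
- by rewrite -eqj.
- by rewrite -eqj; apply: first_u.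
- by rewrite eqj.
- by rewrite eqj; apply: first_u.
Qed.

Variable N : nat.
Hypothesis boundA : forall x y, A x y -> x < N.
Hypothesis K_gt1 : 1 < K.

Let iter_opened i C : opened C -> opened (iter i next C).
Proof. exact: (@iter_next_opened A K N boundA K_gt1 i C). Qed.

Let iter_clique i C : max_clique C -> opened C -> max_clique (iter i next C).
Proof. exact: (@iter_next_max_clique A K N boundA K_gt1 i C). Qed.

Lemma landing_block C D : max_clique C -> opened C -> block C D ->
  block (landing C) (landing D).
Proof.
move=> mcC openC CD; rewrite /landing (hit_block CD); case: (hit D) => [//|j].
rewrite !iterSr -(next_block CD) -iterSr.
by apply: (block_refl K_gt1); apply: iter_clique.
Qed.

Lemma hitP C : (exists u, cut (iter u next C)) ->
  cut (landing C) /\ forall i, i < hit C -> ~ cut (iter i next C).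
Proof.
move=> ex.
suff: [set u | cut (iter u next C) /\
  forall i, i < u -> ~ cut (iter i next C)]%classic (hit C) by [].
apply: xgetPex.
have ex' : exists u, `[< cut (iter u next C) >].
  by have [u ?] := ex; exists u; apply/asboolP.
have [u /asboolP cut_u min_u] := ex_minnP ex'.
exists u; split=> // i lt_iu cut_i.
by have := min_u i (asboolT cut_i); lia.
Qed.

Lemma hit_uniq C u : cut (iter u next C) ->
  (forall i, i < u -> ~ cut (iter i next C)) ->
  hit C = u.
Proof.
move=> cut_u first_u; have [cut_h first_h] := hitP (ex_intro _ u cut_u).
have [lt|lt|//] := ltngtP (hit C) u; first by case: (first_u _ lt cut_h).
by case: (first_h _ lt cut_u).
Qed.

Hypothesis cut_ex : forall C, max_clique C -> opened C -> exists u, cut (iter u next C).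

Lemma landing_iter C i : max_clique C -> opened C -> i <= hit C ->
  landing (iter i next C) = landing C.
Proof.
move=> mcC openC le_i; have [cutC firstC] := hitP (cut_ex mcC openC).
have eq_hit : hit (iter i next C) = hit C - i.
  apply: hit_uniq; rewrite ?iterB ?subnKC // => j lt_j; rewrite iterB.
  by apply: firstC; lia.
by rewrite /landing eq_hit iterB subnKC.
Qed.

Lemma cluster_refl C : max_clique C -> cluster C C.
Proof.
move=> mcC; split=> //; have [openC|] := pselect (opened C); last first.
  by left; split=> //; apply: (block_refl K_gt1).
by right; split=> //; apply: (block_refl K_gt1); apply: iter_clique.
Qed.

Lemma cluster_sym C D : max_clique C -> cluster C D -> cluster D C.
Proof.
move=> mcC [mcD [[nC CD]|[openC openD CD]]]; split=> //; [left|right].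
  split; last exact: block_sym.
  by move=> openD; apply: nC; apply: opened_block openD; apply: block_sym.
by split=> //; apply: block_sym.
Qed.

Lemma cluster_trans C D E : cluster C D -> cluster D E -> cluster C E.
Proof.
move=> [mcD CD] [mcE DE]; split=> //; case: CD => [[nC CD]|[openC openD CD]].
  case: DE => [[nD DE]|[openD _ _]]; first by left; split=> //;
    apply: block_trans CD DE.
  by case: nC; apply: opened_block openD; apply: block_sym.
case: DE => [[nD _]|[_ openE DE]]; first by case: nD.
by right; split=> //; apply: block_trans CD DE.
Qed.

Lemma cluster_eq C D : max_clique C -> cluster C D -> cluster C = cluster D.
Proof.
move=> mcC CD; apply/funext => E; apply/propext; split; last exact: cluster_trans.
by apply: cluster_trans; apply: cluster_sym.
Qed.

Lemma block_cluster C D : max_clique C -> block C D -> cluster C D.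
Proof.
move=> mcC CD; split; first exact: block_max_clique CD.
have [openC|] := pselect (opened C); last by left.
by right; split=> //; [apply: opened_block openC|apply: landing_block].
Qed.

Lemma iter_cluster C i : max_clique C -> opened C -> i <= hit C ->
  cluster C (iter i next C).
Proof.
move=> mcC openC le_i; split; first exact: iter_clique.
right; split=> //; first exact: iter_opened.
by rewrite landing_iter //; apply: (block_refl K_gt1); apply: iter_clique.
Qed.

(** An edge outside the forest is bypassed by strictly heavier edges. Bypassing these in turn
    terminates, as fewer and fewer weights lie above. *)
Lemma meets_kruskal C D : meets A C D ->
  reach (fun U V => kruskal A U V /\ (weight C D <= weight U V)%O) C D.
Proof.
pose U := fpowerset [fset i | i in iota 0 N].
have inU E : max_clique E -> E \in U.
  by move=> /(max_clique_bound boundA) ltN; rewrite fpowersetE fsubset_iota.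
pose s := [seq weight E E' | E <- U, E' <- U].
have in_s E E' : meets A E E' -> weight E E' \in s.
  by move=> [/inU ? /inU ? _ _]; apply/allpairsP; exists (E, E').
have [n] := ubnP (count (fun w => weight C D < w)%O s).
elim: n C D => // n IH C D lt_n CD.
have [krCD|nkr] := pselect (kruskal A C D); first by apply: reach1; split.
have : reach (fun U V => meets A U V /\ (weight C D < weight U V)%O) C D.
  by apply: contrapT => nreach; apply: nkr.
move: (weight C D) lt_n => w0 lt_n {CD nkr}.
elim=> [|E E' _ CE [EE' lt_w]]; first exact: reach_refl.
apply: reach_trans CE _; apply: (@reach_sub _ _ _ _ _ _ (IH E E' _ EE')).
  by move=> V V' [krV le_w]; split=> //; apply: le_trans le_w; apply: ltW.
rewrite -ltnS; apply: leq_ltn_trans _ lt_n.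
have le_count : count (fun w => weight E E' < w)%O s + count (pred1 (weight E E')) s <=
    count (fun w => w0 < w)%O s.
  rewrite -count_predUI -[X in _ + X](_ : 0 = _) ?addn0.
    by apply: sub_count => w /= /orP[lt|/eqP->//]; apply: lt_trans lt.
  apply/esym/eqP; rewrite -leqn0 leqNgt -has_count; apply/hasP => -[w _ /=].
  by case/andP => lt /eqP eqw; rewrite eqw ltxx in lt.
have : 0 < count (pred1 (weight E E')) s by rewrite -has_count has_pred1 in_s.
by move: le_count; lia.
Qed.

Lemma kruskal_sym C D : kruskal A C D -> kruskal A D C.
Proof.
move=> [CD nreach]; split; first exact: meets_sym.
move=> DC; apply: nreach; apply: reach_sym; last by rewrite weightC.
by move=> U V [/meets_sym VU]; rewrite [weight V U]weightC.
Qed.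

Definition inside F := reach (fun U V => [/\ kruskal A U V, F U & F V]).

Lemma inside_sym F C D : inside F C D -> inside F D C.
Proof. by apply: reach_sym => U V [/kruskal_sym]. Qed.

(** The bypasses of [meets_kruskal] are at least as heavy as the edges they replace, so they stay
    within the level. *)
Lemma block_inside C D : block C D -> inside (block C) C D.
Proof.
move=> [[w|] CD thinC]; last first.
  have -> : D = C by apply: (@reach_stable _ _ (eq^~ C) _ _ CD) => // u v _ [].
  exact: reach_refl.
have sub U : level A (Some w) C U -> block C U by exists (Some w).
have : reach (fun U V => kruskal A U V /\ (w <= weight U V)%O) C D.
  elim: CD => [|U V _ CU [UV le_w]]; first exact: reach_refl.
  apply: reach_trans CU _; apply: reach_sub (meets_kruskal UV) => E E' [krE le_w'].
  by split=> //; apply: le_trans le_w'.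
have toLevel U : reach (fun U V => kruskal A U V /\ (w <= weight U V)%O) C U ->
    level A (Some w) C U.
  by apply: reach_sub => E E' [[EE' _] le_w'].
move=> {}CD; have := reach_prefix CD (fun U CU => sub U (toLevel U CU)).
by apply: reach_sub => U V [[krU _] ? ?].
Qed.

(** A path of heavier edges between the ends would leave the block by an edge heavier than the
    exit. *)
Lemma exit_kruskal C : opened C -> kruskal A (exit C).1 (next C).
Proof.
move=> openC; have [[CO nCP OP] maxC] := exitP boundA openC.
split=> // chain; have [U [V [CU nCV [UV lt_w]]]] := reach_exit chain CO nCP.
have := maxC (U, V) (And3 CU nCV UV); rewrite leNgt /=.
by rewrite lt_w.
Qed.

Lemma inside_sub (F F' : {fset nat} -> Prop) C D : (forall E, F E -> F' E) ->
  inside F C D -> inside F' C D.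
Proof. by move=> sub; apply: reach_sub => U V [kr /sub ? /sub]. Qed.

Lemma landing_inside C : max_clique C -> opened C ->
  inside (cluster C) C (landing C).
Proof.
move=> mcC openC; rewrite /landing.
suff H i : i <= hit C -> inside (cluster C) C (iter i next C) by apply: H.
elim: i => [|i IH] lt_i; first exact: reach_refl.
apply: reach_trans (IH (ltnW lt_i)) _; set D := iter i next C.
have mcD : max_clique D by apply: iter_clique.
have openD : opened D by apply: iter_opened.
have subD E : block D E -> cluster C E.
  move=> DE; apply: cluster_trans (block_cluster mcD DE).
  by apply: iter_cluster => //; apply: ltnW.
have [[DO _ _] _] := exitP boundA openD.
apply: reach_step (inside_sub subD (block_inside DO)) _.
by split; [apply: exit_kruskal | apply: subD | apply: (@iter_cluster _ i.+1)].
Qed.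

(** This makes clusters connected classes of the Kruskal forest, as the edge count requires. The way
    to the landing runs through blocks and exits only. *)
Lemma cluster_inside C D : max_clique C -> cluster C D -> inside (cluster C) C D.
Proof.
move=> mcC CD; have [mcD [[nC blockCD]|[openC openD landCD]]] := CD.
  exact: inside_sub (fun E => @block_cluster C E mcC) (block_inside blockCD).
have mcL : max_clique (landing C) by apply: iter_clique.
have CL : cluster C (landing C) by apply: iter_cluster.
apply: reach_trans (landing_inside mcC openC) _.
apply: reach_trans (_ : inside _ _ (landing D)) _.
  apply: inside_sub (block_inside landCD) => E LE.
  exact: cluster_trans CL (block_cluster mcL LE).
by rewrite (cluster_eq mcC CD); apply/inside_sym/landing_inside.
Qed.

(** The stretch that witnesses the cut has no drop, hence no cut, before its end. All of it lands at
    the cut, so the cluster contains a stretch that is not near. *)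
Lemma cluster_wide C : max_clique C -> opened C ->
  ~ thin A K (members (cluster C)).
Proof.
move=> mcC openC thinC; have [[_ [D [l [[mcD openD] lC nodrop far]]]] _] :=
  hitP (cut_ex mcC openC).
apply: far; apply: thin_sub thinC => x [E [j le_jl jE] Ex]; exists E => //.
have cut_l : cut (iter l next D).
  by have [cutC _] := hitP (cut_ex mcC openC); apply: cut_block cutC; apply: block_sym.
have hitD : hit D = l.
  by apply: hit_uniq => // i lt_i [dr _]; have := nodrop i lt_i; rewrite dr.
have mcl : max_clique (iter l next D) by apply: iter_clique.
have Dl : cluster D (iter l next D) by apply: iter_cluster; rewrite ?hitD.
have lE : cluster D E.
  apply: cluster_trans (block_cluster (iter_clique j mcD openD) jE).
  by apply: iter_cluster; rewrite ?hitD.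
have CL : cluster C (landing C) by apply: iter_cluster.
have DL : cluster D (landing C) by apply: cluster_trans Dl (block_cluster mcl lC).
exact: cluster_trans CL (cluster_trans (cluster_sym mcD DL) lE).
Qed.

Lemma crossing_opened C D : max_clique C -> meets A C D -> ~ cluster C D -> opened C.
Proof.
move=> mcC CD nCD; exists (C, D); split=> //=; first exact: (block_refl K_gt1).
by move=> bCD; apply: nCD; apply: block_cluster.
Qed.

End Clusters.

(** * From the network to its identifiers and back *)

Section Transport.

Variables (T : finType) (e : rel T) (id : T -> nat).

(* The graph on identifiers, with a loop at each identifier in use. *)
Definition id_graph : rel nat := fun n m =>
  [exists v, exists w, [&& id v == n, id w == m & (v == w) || e v w]].

Hypothesis simple_e : simple_graph e.
Hypothesis chordal_e : chordal e.
Hypothesis inj_id : injective id.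

Lemma id_graphE v w : id_graph (id v) (id w) = (v == w) || e v w.
Proof.
apply/existsP/idP => [[v' /existsP[w' /and3P[/eqP/inj_id-> /eqP/inj_id-> //]]]|vw].
by exists v; apply/existsP; exists w; rewrite !eqxx.
Qed.

Lemma id_graphP n m : id_graph n m -> exists v w, n = id v /\ m = id w.
Proof.
by move=> /existsP[v /existsP[w /and3P[/eqP <- /eqP <- _]]]; exists v, w.
Qed.

Lemma id_graph_sym : symmetric id_graph.
Proof.
have [sym_e _] := simple_e; suff sub n m : id_graph n m -> id_graph m n.
  by move=> n m; apply/idP/idP; apply: sub.
move=> nm; have [v [w [eqn eqm]]] := id_graphP nm; move: nm.
by rewrite eqn eqm !id_graphE eq_sym sym_e.
Qed.

Lemma id_graph_refl n m : id_graph n m -> id_graph n n.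
Proof. by move=> /id_graphP[v [_ [-> _]]]; rewrite id_graphE eqxx. Qed.

Definition id_bound := (\max_v id v).+1.

Lemma id_graph_bound n m : id_graph n m -> n < id_bound.
Proof. by move=> /id_graphP[v [_ [-> _]]]; rewrite ltnS (@bigop.leq_bigmax _ id v). Qed.

Lemma next_neq (U : eqType) (q : seq U) v : uniq q -> 1 < size q -> v \in q ->
  path.next q v != v.
Proof.
move=> uniq_q size_q qv; have [i q' eq_rot] := rot_to qv.
have := uniq_q; rewrite -(rot_uniq i) eq_rot => /= /andP[nv uniq_q'].
rewrite -(next_rot i uniq_q) eq_rot next_nth mem_head /= eqxx.
have : size (rot i q) > 1 by rewrite size_rot.
rewrite eq_rot; case: q' nv {uniq_q' eq_rot} => //= w q' nv _.
by apply: contraNneq nv => ->; rewrite mem_head.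
Qed.

Lemma map_id_ex (p : seq nat) : (forall x, x \in p -> exists v, x = id v) ->
  exists q, p = map id q.
Proof.
elim: p => [|x p IH] in_p; first by exists [::].
have [q ->] : exists q, p = map id q.
  by apply: IH => y py; apply: in_p; rewrite inE py orbT.
have [v ->] := in_p x (mem_head _ _).
by exists (v :: q).
Qed.

Lemma id_graph_chordal : chordal_nat id_graph.
Proof.
move=> p /andP[cyc_p uniq_p] size_p.
have [q eq_p] : exists q, p = map id q.
  apply: map_id_ex => x px.
  by have [v [_ [-> _]]] := id_graphP (next_cycle cyc_p px); exists v.
rewrite {p}eq_p in cyc_p uniq_p size_p *; rewrite map_inj_uniq // in uniq_p.
rewrite size_map in size_p.
have cyc_q : cycle e q.
  apply: cycle_from_next => // v qv.
  have := next_cycle cyc_p (map_f id qv); rewrite (next_map inj_id) // id_graphE.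
  by rewrite eq_sym (negPf (next_neq uniq_p _ qv)) //; apply: leq_trans size_p.
have [|v [w [qv qw vw neqw neqv]]] := @chordal_e q _ size_p.
  by rewrite /ucycle cyc_q.
exists (id v), (id w).
rewrite !(mem_map inj_id) id_graphE vw orbT !(next_map inj_id uniq_p).
split=> //; split=> /inj_id => [eq_vw|/eqP|/eqP].
- by have [_ irr_e] := simple_e; rewrite eq_vw irr_e in vw.
- by rewrite (negPf neqw).
- by rewrite (negPf neqv).
Qed.

Local Notation A := id_graph.

Variable K : nat.
Hypothesis K_gt1 : 1 < K.
Hypothesis cut_ex : forall C, max_clique A C -> opened A K C ->
  exists u, cut A K (iter u (next A K) C).

Definition output_set : {set T} := [set v | `[< output A K (id v) >]].

Let symA := id_graph_sym.
Let reflA := id_graph_refl.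
Let boundA := id_graph_bound.

Let refl_cluster C : max_clique A C -> cluster A K C C.
Proof. exact: (cluster_refl boundA K_gt1). Qed.

Lemma best_inP C : independent_in A (inner A (cluster A K C))
  (best_in A (inner A (cluster A K C))) /\
  forall S, independent_in A (inner A (cluster A K C)) S ->
    #|` S| <= #|` best_in A (inner A (cluster A K C))|.
Proof.
set P := inner A _.
suff : [set S | independent_in A P S /\
  forall S', independent_in A P S' -> #|` S'| <= #|` S|]%classic (best_in A P) by [].
apply: xgetPex.
pose size_ k := exists2 S : {fset nat}, independent_in A P S & #|` S| = k.
have size0 : size_ 0 by exists fset0; rewrite ?cardfs0.
have in_s k : size_ k -> k \in iota 0 (#|` [fset i | i in iota 0 id_bound]|).+1.
  move=> [S [SP _] <-]; rewrite mem_iota leq0n add0n ltnS andTb;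
    apply: fsubset_leq_card.
  apply: fsubset_iota => x /SP[[D mcD Dx] _]; exact: (max_clique_bound boundA mcD).
have [k [S indS sizeS] max_k] := max_in_seq size0 in_s.
by exists S; split=> // S' indS'; rewrite sizeS -leEnat; apply: max_k; exists S'.
Qed.

Lemma edge_max_clique v w : (v == w) || e v w ->
  exists2 C, max_clique A C & id v \in C /\ id w \in C.
Proof.
move=> vw; have Avw : A (id v) (id w) by rewrite id_graphE.
have Awv : A (id w) (id v) by rewrite symA.
have [||C mcC sub] := @max_clique_extend A symA reflA _ boundA [fset id v; id w].
- by apply/fset0Pn; exists (id v); rewrite !inE eqxx.
- by move=> x y; rewrite !inE => /orP[]/eqP-> /orP[]/eqP-> //;
    rewrite (reflA Avw) || rewrite (reflA Awv).
by exists C => //; split; apply: (fsubsetP sub); rewrite !inE eqxx ?orbT.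
Qed.

(** Two adjacent output vertices share a maximal clique, which belongs to the clusters of both. So
    the clusters coincide, and both vertices lie in the same independent set. *)
Lemma output_independent : independent e output_set.
Proof.
apply/forall_inP => v; rewrite inE => /asboolP[C [mcC Cv inCv best_v]].
apply/forall_inP => w; rewrite inE => /asboolP[D [mcD Dw inDw best_w]].
apply/negP => evw; have [_ irr_e] := simple_e.
have [E mcE [Ev Ew]] : exists2 E, max_clique A E & id v \in E /\ id w \in E.
  by apply: edge_max_clique; rewrite evw orbT.
have CE : cluster A K C E by apply: inCv.2.
have DE : cluster A K D E by apply: inDw.2.
rewrite (cluster_eq mcC CE) in best_v; rewrite (cluster_eq mcD DE) in best_w.
have [[_ ind] _] := best_inP E.
have neq : id v <> id w by move=> /inj_id eq_vw; rewrite eq_vw irr_e in evw.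
by have := ind _ _ best_v best_w neq; rewrite id_graphE evw orbT.
Qed.

Definition cliques := [fset C in fpowerset [fset i | i in iota 0 id_bound] |
  `[< max_clique A C >]].

Lemma cliquesP C : reflect (max_clique A C) (C \in cliques).
Proof.
rewrite /cliques; move: id_bound (@max_clique_bound A _ boundA) => n bound_n.
rewrite inE /=; apply: (iffP andP) => [[_ /asboolP//]|mcC].
split; last exact/asboolP.
by rewrite -[_ \in _]/(C \in fpowerset _) fpowersetE; apply/fsubset_iota/bound_n.
Qed.

Let V : finType := cliques.

Let mcV (C : V) : max_clique A (val C).
Proof. exact/cliquesP/valP. Qed.

(** Cliques of one cluster present the same predicate to [pick], so this is a canonical
    representative. *)
Definition clique_class (C : V) : V :=
  odflt C [pick D : V | `[< cluster A K (val C) (val D) >]].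

Lemma clique_classP C : cluster A K (val C) (val (clique_class C)).
Proof.
rewrite /clique_class; case: pickP => [D /asboolP//|/(_ C)].
by rewrite (asboolT (refl_cluster (mcV C))).
Qed.

Lemma clique_class_eq C D : cluster A K (val C) (val D) <->
  clique_class C = clique_class D.
Proof.
split=> [CD|eq_class].
  rewrite /clique_class (cluster_eq (mcV C) CD); case: pickP => [//|/(_ D)].
  by rewrite (asboolT (refl_cluster (mcV D))).
apply: cluster_trans (clique_classP C) _; rewrite eq_class.
exact: cluster_sym (mcV D) (clique_classP D).
Qed.

Let F (C D : V) := `[< kruskal A (val C) (val D) >].

Lemma connect_reach (R : rel V) (R' : {fset nat} -> {fset nat} -> Prop) C D :
  (forall U W, R U W -> R' (val U) (val W)) -> connect R C D ->
    reach R' (val C) (val D).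
Proof.
move=> sub /connectP[p + ->]; elim/last_ind: p => [|p U IH]; first by move=> _;
  apply: reach_refl.
rewrite rcons_path last_rcons => /andP[/IH CU /sub]; exact: reach_step CU.
Qed.

Lemma reach_connect (R : rel V) (R' : {fset nat} -> {fset nat} -> Prop) C D :
  (forall U W, R' U W -> max_clique A W) ->
  (forall U W : V, R' (val U) (val W) -> R U W) ->
  reach R' (val C) (val D) -> connect R C D.
Proof.
move=> mcR' sub CD; suff [W /val_inj <- //] : exists2 W :
  V, val W = val D & connect R C W.
elim: CD => [|U W _ [U' <- CU'] UW]; first by exists C.
have cW : W \in cliques by apply/cliquesP/(mcR' _ _ UW).
exists [` cW] => //; apply: connect_trans CU' (connect1 _).
exact: sub.
Qed.

(** Only representatives carry a set; for any other [r] the interior is empty. *)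
Definition class_output (r : V) : {set T} := if clique_class r == r then
  [set v | `[< inner A (cluster A K (val r)) (id v) >] &&
    (id v \in best_in A (inner A (cluster A K (val r))))] else finset.set0.

(** [m] counts the clusters at crossing forest edges. These are open, hence span [K] independent
    vertices. *)
Lemma output_approx (O : {set T}) : independent e O -> exists m,
  #|O| <= #|output_set| + 2 * m /\ m * K <= #|output_set| + 2 * m.
Proof.
move=> indO; have [_ irr_e] := simple_e.
pose inc (v : T) (C : V) := id v \in val C.
pose w (C D : V) := weight (val C) (val D).
have symF : symmetric F.
  by move=> C D; apply/asboolP/asboolP; apply: kruskal_sym.
have symw C D : w C D = w D C by apply: weightC.
have injw C D C' D' : F C D -> F C' D' -> w C D = w C' D' -> same_edge C D C' D'.
  move=> _ _ /weight_inj[]; rewrite /same_edge; case=> /val_inj-> /val_inj->.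
    by rewrite !eqxx.
  by rewrite !eqxx orbT.
have krF C D : F C D -> ~~ connect (fun U W => F U W && (w C D < w U W)%O) C D.
  move=> /asboolP[_ nreach]; apply/negP => CD; apply: nreach.
  apply: connect_reach CD => U W /andP[/asboolP[UW _] lt_w].
  by split.
have class_conn C D : clique_class C = clique_class D ->
    connect (fun U W => F U W && (clique_class U == clique_class W)) C D.
  move=> /clique_class_eq CD.
  apply: reach_connect (cluster_inside boundA K_gt1 cut_ex (mcV C) CD).
    by move=> U W [[[]]].
  move=> U W [krUW CU CW]; rewrite /F (asboolT krUW) /=; apply/eqP/clique_class_eq.
  by apply: cluster_trans (cluster_sym (mcV C) CU) CW.
have inc_clique v v' C : inc v C -> inc v' C -> v != v' -> e v v'.
  move=> vC v'C neq; have [_ clC _] := mcV C.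
  by have := clC _ _ vC v'C; rewrite id_graphE (negPf neq).
have inc_crossing v C D : inc v C -> inc v D -> clique_class C != clique_class D ->
    exists C' D', [/\ F C' D', clique_class C' = clique_class C,
      clique_class D' != clique_class C, inc v C' & inc v D'].
  move=> vC vD neq; have nCD : ~ cluster A K (val C) (val D).
    by move=> /clique_class_eq/eqP; apply/negP.
  have [C' [D' [krC'D' CC' nCD' vC' vD']]] := kruskal_cut symA reflA boundA
    id_graph_chordal (mcV C) (mcV D) vC vD (refl_cluster (mcV C)) nCD.
  have [[mcC' mcD' _ _] _] := krC'D'.
  have cC' : C' \in cliques by apply/cliquesP.
  have cD' : D' \in cliques by apply/cliquesP.
  exists [` cC'], [` cD']; split=> //; first exact/asboolP.
    by apply/esym/clique_class_eq.
  by apply/eqP => /esym/clique_class_eq.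
have wide r : r \in [set clique_class f.1 | f in crossing F clique_class] -> exists S,
    [/\ stable e S, #|S| = K &
      forall v, v \in S -> exists2 C, inc v C & clique_class C = r].
  case/imsetP=> [[C D]]; rewrite inE /= => /andP[/asboolP[CD _] neq] ->.
  have nCD : ~ cluster A K (val C) (val D).
    by move=> /clique_class_eq/eqP; apply/negP.
  have openC := crossing_opened boundA K_gt1 (mcV C) CD nCD.
  have /contrapT[s [uniq_s size_s in_s ind_s]] :=
    cluster_wide boundA K_gt1 cut_ex (mcV C) openC.
  have id_s x : x \in s -> exists v, x = id v.
    move=> /in_s[E [[_ clE _] _] Ex].
    by have [v [_ [-> _]]] := id_graphP (clE _ _ Ex Ex); exists v.
  have [q eq_s] := map_id_ex id_s.
  rewrite eq_s map_inj_uniq // in uniq_s; rewrite eq_s size_map in size_s.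
  exists [set v in q]; split.
  - move=> v v'; rewrite !inE => qv qv'.
    have [->|neq_v] := eqVneq v v'; first by rewrite irr_e.
    have := ind_s (id v) (id v'); rewrite eq_s !(mem_map inj_id) id_graphE.
    by rewrite (inj_eq inj_id) neq_v (negPf neq_v) => /(_ qv qv' isT).
  - by rewrite cardsE (card_uniqP uniq_s).
  - move=> v; rewrite inE => qv; have [|E CE Ev] := in_s (id v).
      by rewrite eq_s mem_map.
    have cE : E \in cliques by apply/cliquesP; have [] := CE.
    by exists [` cE] => //; apply/esym/clique_class_eq.
have crossing_le := crossing_card symF symw injw krF class_conn.
have inner_class r v : clique_class r = r ->
    v \in interior inc clique_class r <-> inner A (cluster A K (val r)) (id v).
  move=> fix_r; rewrite inE; split.
    move=> /andP[/existsP[C vC] /forallP all_r]; split; first by exists (val C).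
    move=> D mcD vD; have cD : D \in cliques by apply/cliquesP.
    have := all_r [` cD]; rewrite /inc vD => /eqP eq_class.
    by apply: (clique_class_eq r [` cD]).2; rewrite fix_r eq_class.
  move=> [[D mcD vD] all_r]; have cD : D \in cliques by apply/cliquesP.
  apply/andP; split; first by apply/existsP; exists [` cD].
  apply/forallP => C; apply/implyP => vC; apply/eqP.
  by rewrite -[RHS]fix_r; apply/esym/clique_class_eq/all_r.
have out_int r : class_output r \subset interior inc clique_class r.
  apply/fintype.subsetP => v; rewrite /class_output; case: eqP => [fix_r|];
    last by rewrite inE.
  by rewrite inE => /andP[/asboolP inn _]; apply/inner_class.
have out_max r (S : {set T}) : stable e S -> S \subset interior inc clique_class r ->
    #|S| <= #|class_output r|.
  move=> stS subS; rewrite /class_output; case: eqP => [fix_r|nfix]; last first.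
    rewrite cards0 leqn0 cards_eq0; apply/set0Pn => -[v /(fintype.subsetP subS)].
    rewrite inE => /andP[/existsP[C vC] /forallP/(_ C)]; rewrite vC => /eqP eqC.
    by apply: nfix; rewrite -{}eqC; apply/clique_class_eq/cluster_sym/clique_classP/mcV.
  have [[in_best ind_best] max_best] := best_inP (val r).
  have := max_best [fset id v | v in S] _.
  have -> : #|` [fset id v | v in S]| = #|S|.
    by rewrite card_imfset //= -cardE.
  move=> le_S; apply: leq_trans (le_S _) _.
    split=> [x /imfsetP[v /= Sv ->]|x y /imfsetP[v /= Sv ->]
      /imfsetP[v' /= Sv' ->] neq].
      by apply/inner_class/(fintype.subsetP subS).
    rewrite id_graphE negb_or stS // andbT; apply/eqP => eq_v.
    by rewrite eq_v in neq.
  set W := (X in _ <= #|X|).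
  have -> : best_in A (inner A (cluster A K (val r))) = [fset id v | v in W].
    apply/fsetP => x; apply/idP/imfsetP => [bx|[v /=]].
      have inn := in_best _ bx; have [[D [_ clD _] Dx] _] := inn.
      have [v [_ [eqx _]]] := id_graphP (clD _ _ Dx Dx).
      by exists v => //=; rewrite inE -eqx bx andbT; apply/asboolP.
    by rewrite inE => /andP[_ bv] ->.
  by rewrite card_imfset //= -cardE.
have stO : stable e O by move=> v v' Ov Ov'; apply: (forall_inP (forall_inP indO v Ov)).
have incO v : v \in O -> exists C, inc v C.
  move=> _; have [|C mcC [Cv _]] := @edge_max_clique v v; first by rewrite eqxx.
  have cC : C \in cliques by apply/cliquesP.
  by exists [` cC].
have [] := approx_count inc_clique inc_crossing wide crossing_le out_int out_max
  stO incO.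
have le_out : #|\bigcup_r class_output r| <= #|output_set|.
  apply: subset_leq_card; apply/fintype.subsetP => v /bigcupP[r _].
  rewrite /class_output; case: eqP => [_|]; last by rewrite inE.
  rewrite !inE => /andP[/asboolP inn best_v]; apply/asboolP.
  have [[D mcD Dv] all_r] := inn; have rD := all_r D mcD Dv.
  by exists D; rewrite -(cluster_eq (mcV r) rD).
set m := #|[set clique_class f.1 | f in crossing F clique_class]|;
  move=> leO leK; exists m.
by split; [apply: leq_trans leO _ | apply: leq_trans leK _]; rewrite leq_add2r.
Qed.

End Transport.

(** * Distances between cliques *)

Fixpoint dist (A : rel nat) r x y : Prop :=
  if r is r'.+1 then exists2 z, dist A r' x z & A z y else x = y.

Definition clique_dist (A : rel nat) r (C D : {fset nat}) :=
  forall x y, x \in C -> y \in D -> dist A r x y.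

Section Distance.

Variables (A : rel nat) (K : nat).
Hypothesis symA : symmetric A.
Hypothesis reflA : forall x y, A x y -> A x x.

Lemma dist_add r s x y z : dist A r x y -> dist A s y z -> dist A (r + s) x z.
Proof.
elim: s z => [|s IH] z xy /=; first by move=> <-; rewrite addn0.
by move=> [u yu uz]; rewrite addnS; exists u => //; apply: IH.
Qed.

Lemma dist_sym r x y : dist A r x y -> dist A r y x.
Proof.
elim: r x y => [|r IH] x y //= [z xz zy].
have y1 : dist A 1 y z by exists y; rewrite // symA.
by have := dist_add y1 (IH _ _ xz); rewrite add1n.
Qed.

Lemma dist_present r x y : A x x -> dist A r x y -> A y y.
Proof. by case: r => [|r] Axx /=;
  [move=> <-|move=> [z _ zy]; apply: (@reflA _ z); rewrite symA]. Qed.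

(** Walks have exact length; the loop at the end vertex pads them. *)
Lemma dist_le r s x y : A x x -> r <= s -> dist A r x y -> dist A s x y.
Proof.
move=> Axx /subnKC <-; elim: (s - r) => [|k IH]; first by rewrite addn0.
move=> xy; rewrite addnS; exists y; first exact: IH.
exact: dist_present xy.
Qed.

(** Breadth-first layers of [S] from [x]: if [y] is farther than [2 * K], all layers up to that
    distance are inhabited, and one vertex from each of the layers 0, 2, ..., 2K - 2 gives [K]
    independent vertices. *)
Lemma thin_dist (S : nat -> Prop) x y : A x x -> S x -> thin A K S ->
  reach (fun u v => A u v /\ S v) x y -> dist A (2 * K) x y.
Proof.
move=> Axx Sx thinS xy.
pose fix within r z {struct r} : Prop := if r is r'.+1
  then exists2 u, within r' u & A u z /\ S z else z = x.
have within_dist r z : within r z -> dist A r x z.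
  by elim: r z => [z -> //|r IH z /= [u /IH xu [uz _]]]; exists u.
have within_S r z : within r z -> S z.
  by case: r => [->//|r /= [u _ []]].
have withinS r z : within r z -> within r.+1 z.
  move=> xz; exists z => //; split; last exact: within_S xz.
  exact: dist_present Axx (within_dist _ _ xz).
have within_le r s z : r <= s -> within r z -> within s z.
  by move=> /subnKC <-; elim: (s - r) => [|k IH]; rewrite ?addn0 // addnS =>
    /IH/withinS.
apply: contrapT => far; apply: thinS.
have ex r : exists z, r <= 2 * K -> within r z /\ forall s, s < r -> ~ within s z.
  have [le_r|lt_r] := leqP r (2 * K); last by exists 0; lia.
  apply: contrapT => nex; have {}nex z : within r z -> exists2 s, s < r & within s z.
    move=> rz; apply: contrapT => ns; apply: nex; exists z => _; split=> // s lt_sr sz.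
    by apply: ns; exists s.
  case: r => [|r] in le_r nex *; first by have [|s] := nex x.
  apply: far; apply: dist_le (ltnW le_r) (within_dist _ _ _) => //.
  apply: (reach_stable xy); first exact: within_le (erefl : within 0 x).
  move=> u v ru [uv Sv]; have [|s lt_s sv] := nex v; first by exists u.
  exact: within_le sv.
have [f fP] := choice ex.
exists [seq f (2 * i) | i <- iota 0 K]; split.
- rewrite map_inj_in_uniq ?iota_uniq // => i j; rewrite !mem_iota => lt_i lt_j eq_f.
  have [|wi fi] := fP (2 * i); first lia.
  have [|wj fj] := fP (2 * j); first lia.
  have [lt|lt|//] := ltngtP i j.
    by case: (fj (2 * i)); [lia|rewrite -eq_f].
  by case: (fi (2 * j)); [lia|rewrite eq_f].
- by rewrite size_map size_iota.
- move=> z /mapP[i]; rewrite mem_iota => lt_i ->.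
  by have [|wi _] := fP (2 * i); [lia|exact: within_S wi].
- move=> z z' /mapP[i + ->] /mapP[j + ->]; rewrite !mem_iota => lt_i lt_j neq.
  have [|wi fi] := fP (2 * i); first lia.
  have [|wj fj] := fP (2 * j); first lia.
  apply/negP => Aij; have [lt|lt|eq] := ltngtP i j; last by rewrite eq eqxx in neq.
    apply: (fj (2 * i).+1); first lia.
    by exists (f (2 * i)) => //; split=> //; apply: within_S wj.
  apply: (fi (2 * j).+1); first lia.
  by exists (f (2 * j)) => //; split; [rewrite symA|apply: within_S wi].
Qed.

Local Notation next := (next A K).
Local Notation near := (near A K).
Local Notation opened := (opened A K).
Local Notation max_clique := (max_clique A).
Local Notation block := (block A K).

Variable N : nat.
Hypothesis boundA : forall x y, A x y -> x < N.
Hypothesis K_gt1 : 1 < K.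

Lemma clique_present C x : max_clique C -> x \in C -> A x x.
Proof. by move=> [_ clC _] Cx; apply: clC. Qed.

Lemma clique_dist_add r s C D E : max_clique D -> clique_dist A r C D ->
  clique_dist A s D E -> clique_dist A (r + s) C E.
Proof.
move=> [/fset0Pn[y Dy] _ _] CD DE x z Cx Ez.
exact: dist_add (CD _ _ Cx Dy) (DE _ _ Dy Ez).
Qed.

Lemma clique_dist_sym r C D : clique_dist A r C D -> clique_dist A r D C.
Proof. by move=> CD x y Dx Cy; apply/dist_sym/CD. Qed.

Lemma clique_dist_le r s C D : max_clique C -> r <= s ->
  clique_dist A r C D -> clique_dist A s C D.
Proof.
move=> mcC le_rs CD x y Cx Dy; apply: dist_le le_rs (CD _ _ Cx Dy).
exact: clique_present Cx.
Qed.

Lemma family_dist (F : {fset nat} -> Prop) C D : max_clique C -> F C ->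
  thin A K (members F) -> reach (fun U V => meets A U V /\ F V) C D ->
  clique_dist A (2 * K) C D.
Proof.
move=> mcC FC thinF CD x y Cx Dy.
apply: (thin_dist _ _ thinF); [exact: clique_present Cx|by exists C|].
elim: CD y Dy => [|U V _ IH [[_ [_ clV _] _ [u Uu Vu]] FV]] y Dy.
  by apply: reach1; split; [case: mcC => _ clC _; apply: clC|exists C].
apply: (reach_step (IH u Uu)); split; first exact: clV.
by exists V.
Qed.

Lemma level_dist w C D : max_clique C -> thin A K (members (level A w C)) ->
  level A w C D -> clique_dist A (2 * K) C D.
Proof.
move=> mcC thinC CD; apply: family_dist thinC _ => //; first exact: reach_refl.
by apply: reach_sub (reach_prefix CD (fun z => id)) => U V [[UV _] _ ?].
Qed.

Lemma block_reach C D : block C D -> reach (fun U V => meets A U V /\ block C V) C D.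
Proof.
move=> [w CD thinC].
have sub z : level A w C z -> block C z by exists w.
by apply: reach_sub (reach_prefix CD sub) => U V [[UV _] _ ?].
Qed.

Lemma block_dist C D : max_clique C -> block C D -> clique_dist A (2 * K) C D.
Proof. by move=> mcC [w CD thinC]; apply: level_dist thinC CD. Qed.

Lemma next_dist C : max_clique C -> opened C -> clique_dist A (2 * K).+1 C (next C).
Proof.
move=> mcC openC; have [[CO _ [_ [_ clP _] _ [u Ou Pu]]] _] := exitP boundA openC.
move=> x y Cx Py; exists u; first exact: (block_dist mcC CO Cx Ou).
exact: clP.
Qed.

Lemma near_dist C i D : max_clique C -> opened C -> near C i -> segment A K C i D ->
  clique_dist A (2 * K) C D.
Proof.
move=> mcC openC near_i [j le_j jD].
have mcj k : max_clique (iter k next C) by apply: (iter_next_max_clique boundA K_gt1).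
have openj k : opened (iter k next C) by apply: (iter_next_opened boundA K_gt1).
apply: family_dist near_i _ => //; first by exists 0; last exact: (block_refl K_gt1).
have blk k E : k <= i -> block (iter k next C) E ->
    reach (fun U V => meets A U V /\ segment A K C i V) (iter k next C) E.
  by move=> le_k kE; apply: reach_sub (block_reach kE) => U V [? ?]; split=> //;
    exists k.
apply: reach_trans (blk j D le_j jD).
elim: j le_j {jD} => [|j IH] lt_j; first exact: reach_refl.
have [[jO _ OP] _] := exitP boundA (openj j).
apply: reach_trans (IH (ltnW lt_j)) _; apply: (reach_step (blk _ _ (ltnW lt_j) jO)).
split=> //; exists j.+1 => //; exact: (block_refl K_gt1 (mcj j.+1)).
Qed.

Lemma clique_dist1 C : max_clique C -> clique_dist A 1 C C.
Proof. by move=> [_ clC _] x y Cx Cy; exists x => //; apply: clC. Qed.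

Lemma path_near_dist C j l : max_clique C -> opened C -> j <= l ->
  path_near A K C j l -> clique_dist A (2 * K) (iter j next C) (iter l next C).
Proof.
move=> mcC openC le_jl near_jl.
apply: near_dist near_jl _; [exact: (iter_next_max_clique boundA K_gt1)|
  exact: (iter_next_opened boundA K_gt1)|].
exists (l - j) => //; rewrite iterB subnKC //.
by apply: (block_refl K_gt1); apply: (iter_next_max_clique boundA K_gt1).
Qed.

(** A jump is a near stretch, at cost [2 * K], followed by one pointer, at cost [(2 * K).+1]. The
    final successor is the distance from a clique to itself. *)
Lemma jump_dist C q j : max_clique C -> opened C -> j <= iter q (jump A K C) 0 ->
  clique_dist A (q * (4 * K).+1).+1 C (iter j next C).
Proof.
move=> mcC openC.
have mcj k : max_clique (iter k next C) by apply: (iter_next_max_clique boundA K_gt1).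
have openj k : opened (iter k next C) by apply: (iter_next_opened boundA K_gt1).
elim: q j => [|q IH] j /=.
  by rewrite leqn0 => /eqP ->; rewrite mul0n; apply: clique_dist1.
set p := iter q _ 0 => le_j.
have [le_jp|lt_pj] := leqP j p.
  by apply: clique_dist_le (IH _ le_jp); rewrite // ltnS leq_mul2r leqnSn orbT.
apply: (@clique_dist_le ((q * (4 * K).+1).+1 + (2 * K + (2 * K).+1))) => //; first lia.
apply: clique_dist_add (IH p (leqnn p)) _ => //.
case: j lt_pj le_j => // j; rewrite ltnS => le_pj lt_j.
apply: (clique_dist_add (mcj j)); last exact: next_dist.
apply: path_near_dist => //.
by apply: (jump_near boundA K_gt1 mcC openC); rewrite le_pj.
Qed.

End Distance.

(** * Locality: graphs that agree on a ball *)

Record graph (A : rel nat) : Prop := Graph {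
  graph_sym : symmetric A;
  graph_refl : forall x y, A x y -> A x x;
  graph_bound : exists N, forall x y, A x y -> x < N
}.

(** Equal neighbourhoods at all vertices within distance [r]. Owing to the loops, a vertex in use is
    its own neighbour, so agreement passes to smaller radii. *)
Fixpoint agree (A1 A2 : rel nat) r x : Prop :=
  A1 x =1 A2 x /\ if r is r'.+1 then forall y, A1 x y -> agree A1 A2 r' y else True.

Definition same A1 A2 r (C : {fset nat}) := {in C, forall x, agree A1 A2 r x}.

Lemma agree_eq A1 A2 r x : agree A1 A2 r x -> A1 x =1 A2 x.
Proof. by case: r => [|r] []. Qed.

Lemma agree_sym A1 A2 r x : agree A1 A2 r x -> agree A2 A1 r x.
Proof.
elim: r x => [|r IH] x /= [eqx agr]; split=> //; try by move=> y; rewrite eqx.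
by move=> y; rewrite -eqx => /agr/IH.
Qed.

Lemma same_sym A1 A2 r C : same A1 A2 r C -> same A2 A1 r C.
Proof. by move=> s x /s/agree_sym. Qed.

Lemma agree_step A1 A2 r x y : agree A1 A2 r.+1 x -> A1 x y -> agree A1 A2 r y.
Proof. by move=> [_ agr] /agr. Qed.

Lemma agree_dist (A1 A2 : rel nat) r s x y : symmetric A1 ->
  agree A1 A2 (r + s) x -> dist A1 r x y -> agree A1 A2 s y.
Proof.
move=> symA; elim: r s y => [|r IH] s y; first by rewrite add0n => + <-.
rewrite addSnnS => agr [z xz zy]; exact: agree_step (IH _ _ agr xz) zy.
Qed.

Lemma agree_le (A1 A2 : rel nat) r s x : A1 x x -> s <= r -> agree A1 A2 r x ->
  agree A1 A2 s x.
Proof.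
move=> Axx /subnKC <-; elim: (r - s) => [|k IH]; rewrite ?addn0 // addnS.
by move=> agr; apply/IH/(agree_step agr).
Qed.

Lemma same_move A1 A2 r s d C D : graph A1 -> max_clique A1 C -> max_clique A1 D ->
  same A1 A2 r C -> clique_dist A1 d C D -> d + s <= r -> same A1 A2 s D.
Proof.
move=> g1 mcC mcD sC CD le_r y Dy; have [/fset0Pn[x Cx] clC _] := mcC.
apply: (agree_dist (graph_sym g1) _ (CD x y Cx Dy)).
exact: agree_le (clC x x Cx Cx) le_r (sC x Cx).
Qed.

Lemma same_le A1 A2 r s C : max_clique A1 C -> s <= r -> same A1 A2 r C ->
  same A1 A2 s C.
Proof.
by move=> [_ clC _] le_sr sC x Cx; apply: agree_le (clC x x Cx Cx) le_sr (sC x Cx).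
Qed.

Lemma same_max_clique A1 A2 C : graph A1 -> graph A2 -> same A1 A2 1 C ->
  max_clique A1 C -> max_clique A2 C.
Proof.
move=> g1 g2 sC [C0 clC maxC]; split=> // [x y Cx Cy|x Ax].
  by rewrite -(agree_eq (sC x Cx)); apply: clC.
have /fset0Pn[y Cy] := C0; apply: maxC => z Cz.
have Ayx : A1 y x by rewrite (agree_eq (sC y Cy)) (graph_sym g2); apply: Ax.
by rewrite (agree_eq (agree_step (sC y Cy) Ayx)); apply: Ax.
Qed.

Lemma same_meets A1 A2 C D : graph A1 -> graph A2 -> same A1 A2 2 C ->
  meets A1 C D -> meets A2 C D.
Proof.
move=> g1 g2 sC [mcC mcD neq [u Cu Du]]; split=> //; last by exists u.
  by apply: same_max_clique (same_le mcC _ sC) mcC.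
apply: (same_max_clique g1 g2 _ mcD) => y Dy; apply: (agree_step (sC u Cu)).
by have [_ clD _] := mcD; apply: clD.
Qed.

Section Local.

Variable K : nat.
Hypothesis K_gt1 : 1 < K.

Lemma same_thin A1 A2 (S : nat -> Prop) : (forall x, S x -> A1 x =1 A2 x) ->
  thin A1 K S -> thin A2 K S.
Proof.
move=> eqA thin1 [s [uniq_s size_s in_s ind_s]]; apply: thin1.
by exists s; split=> // x y sx sy neq; rewrite eqA; [apply: ind_s|apply: in_s].
Qed.

(** Thinness keeps the level within [2 * K] of [C], and two more steps decide which cliques meet its
    members. Both inductions stay inside the level of [A1], so thinness in [A1] suffices. *)
Lemma same_level A1 A2 w C : graph A1 -> graph A2 -> max_clique A1 C ->
  same A1 A2 (2 * K).+2 C -> thin A1 K (members (level A1 w C)) ->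
  level A1 w C = level A2 w C.
Proof.
move=> g1 g2 mcC sC thinC.
have sD D : level A1 w C D -> same A1 A2 2 D.
  move=> CD; apply: (same_move g1 mcC _ sC
    (level_dist (graph_sym g1) (graph_refl g1) mcC thinC CD)).
    exact: level_max_clique CD.
  lia.
apply/funext => D; apply/propext; split=> CD.
  elim: CD => [|U V CU IH [UV wUV]]; first exact: reach_refl.
  by apply: (reach_step IH); split=> //; apply: same_meets UV => //; apply: sD.
elim: CD => [|U V CU IH [UV wUV]]; first exact: reach_refl.
by apply: (reach_step IH); split=> //; apply: same_meets UV => //; apply/same_sym/sD.
Qed.

Lemma same_block_sub A1 A2 C D : graph A1 -> graph A2 -> max_clique A1 C ->
  same A1 A2 (2 * K).+2 C -> block A1 K C D -> block A2 K C D.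
Proof.
move=> g1 g2 mcC sC [w CD thinC]; have eq_l := same_level g1 g2 mcC sC thinC.
exists w; rewrite -eq_l //; apply: (same_thin _ thinC) => x [E CE Ex].
have mcE := level_max_clique mcC CE.
have /(_ x Ex) : same A1 A2 0 E.
  by apply: (same_move g1 mcC mcE sC
    (level_dist (graph_sym g1) (graph_refl g1) mcC thinC CE)); lia.
exact: agree_eq.
Qed.

Lemma same_block A1 A2 C : graph A1 -> graph A2 -> max_clique A1 C ->
  same A1 A2 (2 * K).+2 C -> block A1 K C = block A2 K C.
Proof.
move=> g1 g2 mcC sC; apply/funext => D; apply/propext; split.
  exact: same_block_sub.
apply: same_block_sub => //; last exact: same_sym.
by apply: (same_max_clique g1 g2 _ mcC); apply: (same_le mcC _ sC).
Qed.

Lemma same_leaves_sub A1 A2 C e : graph A1 -> graph A2 -> max_clique A1 C ->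
  same A1 A2 (2 * K).+2 C -> leaves A1 K C e -> leaves A2 K C e.
Proof.
move=> g1 g2 mcC sC; have eq_b := same_block g1 g2 mcC sC.
rewrite /leaves -eq_b => -[Ce nCe ee]; split=> //.
apply: (same_meets g1 g2 _ ee); have mce := block_max_clique mcC Ce.
apply: (same_move g1 mcC mce sC (block_dist (graph_sym g1) (graph_refl g1) mcC Ce)).
lia.
Qed.

Lemma same_leaves A1 A2 C : graph A1 -> graph A2 -> max_clique A1 C ->
  same A1 A2 (2 * K).+2 C -> leaves A1 K C = leaves A2 K C.
Proof.
move=> g1 g2 mcC sC; apply/funext => e; apply/propext; split.
  exact: same_leaves_sub.
apply: same_leaves_sub => //; last exact: same_sym.
by apply: (same_max_clique g1 g2 _ mcC); apply: (same_le mcC _ sC).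
Qed.

Lemma same_exit A1 A2 C : graph A1 -> graph A2 -> max_clique A1 C ->
  same A1 A2 (2 * K).+2 C -> exit A1 K C = exit A2 K C.
Proof. by move=> g1 g2 mcC sC; rewrite /exit /exits (same_leaves g1 g2 mcC sC). Qed.

Lemma same_opened A1 A2 C : graph A1 -> graph A2 -> max_clique A1 C ->
  same A1 A2 (2 * K).+2 C -> opened A1 K C = opened A2 K C.
Proof. by move=> g1 g2 mcC sC; rewrite /opened (same_leaves g1 g2 mcC sC). Qed.

Lemma same_next A1 A2 C : graph A1 -> graph A2 -> max_clique A1 C ->
  same A1 A2 (2 * K).+2 C -> next A1 K C = next A2 K C.
Proof. by move=> g1 g2 mcC sC; rewrite /next (same_exit g1 g2 mcC sC). Qed.

Lemma graph_iter A C i : graph A -> max_clique A C -> opened A K C ->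
  max_clique A (iter i (next A K) C) /\ opened A K (iter i (next A K) C).
Proof.
move=> [_ _ [N bA]] mcC openC; split.
  exact: (iter_next_max_clique bA K_gt1).
exact: (iter_next_opened bA K_gt1).
Qed.

Lemma graph_near_dist A C i j : graph A -> max_clique A C -> opened A K C ->
  near A K C i -> j <= i -> clique_dist A (2 * K) C (iter j (next A K) C).
Proof.
move=> g mcC openC near_i le_j; have [symA reflA [N bA]] := g.
apply: (near_dist symA reflA bA K_gt1 mcC openC near_i); exists j => //.
by apply: (block_refl K_gt1); case: (graph_iter j g mcC openC).
Qed.

(** Radius [2 * K] covers the stretch, and [(2 * K).+2] more determines each pointer, including the
    one that leaves its end. *)
Lemma same_near A1 A2 C i : graph A1 -> graph A2 -> max_clique A1 C -> opened A1 K C ->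
  same A1 A2 (4 * K).+2 C -> near A1 K C i ->
  near A2 K C i /\ forall j, j <= i.+1 -> iter j (next A1 K) C = iter j (next A2 K) C.
Proof.
move=> g1 g2 mcC openC sC near_i.
have sj j : j <= i -> same A1 A2 (2 * K).+2 (iter j (next A1 K) C).
  move=> le_j; have [mcj openj] := graph_iter j g1 mcC openC.
  by apply: (same_move g1 mcC mcj sC (graph_near_dist g1 mcC openC near_i le_j)); lia.
have eq_iter j : j <= i.+1 -> iter j (next A1 K) C = iter j (next A2 K) C.
  elim: j => // j IH lt_j; rewrite !iterS -(IH (ltnW lt_j)).
  by apply: same_next => //; [case: (graph_iter j g1 mcC openC)|apply: sj].
split=> //; have eq_seg : segment A1 K C i = segment A2 K C i.
  apply/funext => D; apply/propext; split=> -[j le_j jD]; exists j => //.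
    by rewrite -eq_iter 1?ltnW // -(same_block g1 g2) //;
      [case: (graph_iter j g1 mcC openC)|apply: sj].
  rewrite (same_block g1 g2) ?eq_iter 1?ltnW //;
    first by rewrite -eq_iter 1?ltnW //; case: (graph_iter j g1 mcC openC).
  by rewrite -eq_iter 1?ltnW //; apply: sj.
rewrite /near -eq_seg; apply: (same_thin _ near_i) => x [D CD Dx].
have [symA reflA [N bA]] := g1.
have mcD : max_clique A1 D.
  by have [j le_j jD] := CD; apply: block_max_clique jD;
    case: (graph_iter j g1 mcC openC).
have /(_ x Dx) : same A1 A2 0 D; last exact: agree_eq.
apply: (same_move g1 mcC mcD sC (near_dist symA reflA bA K_gt1 mcC openC near_i CD)).
lia.
Qed.

Definition local_fun A1 A2 r (f1 f2 : {fset nat} -> nat) := forall C,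
  max_clique A1 C -> opened A1 K C -> same A1 A2 r C -> f1 C = f2 C.

Lemma same_window_sup A1 A2 r f1 f2 : graph A1 -> graph A2 -> (2 * K).+2 <= r ->
  local_fun A1 A2 r f1 f2 ->
  local_fun A1 A2 (2 * K + r) (window_sup A1 K f1) (window_sup A2 K f2).
Proof.
move=> g1 g2 le_r eq_f C mcC openC sC.
have sC' : same A1 A2 (4 * K).+2 C by apply: same_le sC => //; lia.
have sC0 : same A1 A2 (2 * K).+2 C by apply: same_le sC => //; lia.
have mcC2 : max_clique A2 C by apply: (same_max_clique g1 g2 _ mcC);
  apply: (same_le mcC _ sC0).
have openC2 : opened A2 K C by rewrite -(same_opened g1 g2 mcC sC0).
have fj i : near A1 K C i -> f1 (iter i (next A1 K) C) = f2 (iter i (next A2 K) C).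
  move=> near_i; have [_ eq_i] := same_near g1 g2 mcC openC sC' near_i.
  rewrite -eq_i //; have [mci openi] := graph_iter i g1 mcC openC.
  apply: eq_f => //.
  by apply: (same_move g1 mcC mci sC (graph_near_dist g1 mcC openC near_i (leqnn i))).
have near12 i : near A1 K C i <-> near A2 K C i.
  split=> near_i; first by case: (same_near g1 g2 mcC openC sC' near_i).
  by case: (same_near g2 g1 mcC2 openC2 (same_sym sC') near_i).
rewrite /window_sup; congr xget; apply/funext => v; apply/propext.
split=> -[[i near_i eq_v] ub]; split.
- by exists i; [apply/near12|rewrite -fj].
- by move=> j near_j; rewrite -fj; [apply: ub|]; apply/near12.
- by move/near12 in near_i; exists i => //; rewrite fj.
- by move=> j near_j; rewrite fj //; apply: ub; apply/near12.
Qed.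

Lemma same_name A1 A2 : graph A1 -> graph A2 ->
  local_fun A1 A2 (2 * K).+2 (name A1 K) (name A2 K).
Proof. by move=> g1 g2 C mcC openC sC; rewrite /name (same_exit g1 g2 mcC sC). Qed.

Lemma graph_next A C : graph A -> max_clique A C -> opened A K C ->
  [/\ max_clique A (next A K C), opened A K (next A K C) &
      clique_dist A (2 * K).+1 C (next A K C)].
Proof.
move=> g mcC openC; have [mcP openP] := graph_iter 1 g mcC openC.
have [symA reflA [N bA]] := g; split=> //.
exact: (next_dist symA reflA bA).
Qed.

Lemma same_at_next A1 A2 r f1 f2 : graph A1 -> graph A2 -> (2 * K).+2 <= r ->
  local_fun A1 A2 r f1 f2 ->
  local_fun A1 A2 ((2 * K).+1 + r) (fun C => f1 (next A1 K C))
    (fun C => f2 (next A2 K C)).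
Proof.
move=> g1 g2 le_r eq_f C mcC openC sC.
have [mcP openP CP] := graph_next g1 mcC openC.
rewrite -(same_next g1 g2 mcC); last by apply: same_le sC => //; lia.
by apply: eq_f => //; apply: (same_move g1 mcC mcP sC CP).
Qed.

(** One reduction looks along a near stretch and across one pointer, [2 * K] and [(2 * K).+1]; the
    name alone takes [(2 * K).+2]. *)
Definition label_radius s := (2 * K).+2 + s * (4 * K).+1.

Lemma same_label A1 A2 t s : graph A1 -> graph A2 ->
  local_fun A1 A2 (label_radius s) (label A1 K t s) (label A2 K t s).
Proof.
move=> g1 g2; elim: s => [|s IH].
  rewrite /label_radius mul0n addn0 => C mcC openC sC /=.
  by rewrite (same_name g1 g2 mcC openC sC).
have eq_w : local_fun A1 A2 (2 * K + label_radius s)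
    (window_sup A1 K (label A1 K t s)) (window_sup A2 K (label A2 K t s)).
  by apply: same_window_sup => //; rewrite /label_radius; lia.
have eq_w' := same_at_next g1 g2 _ eq_w.
move=> C mcC openC sC /=; rewrite eq_w' ?eq_w //; last by apply: same_le sC;
  rewrite // /label_radius; lia.
  by apply: same_le sC; rewrite // /label_radius; lia.
by rewrite /label_radius; lia.
Qed.

Lemma same_rank A1 A2 t : graph A1 -> graph A2 ->
  local_fun A1 A2 (label_radius t) (rank A1 K t) (rank A2 K t).
Proof.
move=> g1 g2 C mcC openC sC; apply: eq_bigr => g _.
rewrite /mark (@same_label A1 A2 g g g1 g2 C) //; apply: same_le sC => //.
by rewrite /label_radius; have := ltn_ord g; nia.
Qed.

Definition drop_radius T := label_radius T.+1.

Lemma same_drop A1 A2 T C : graph A1 -> graph A2 -> max_clique A1 C -> opened A1 K C ->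
  rank_level A1 K C <= T -> same A1 A2 (drop_radius T) C -> drop A1 K C = drop A2 K C.
Proof.
move=> g1 g2 mcC openC le_T sC; rewrite /drop.
have eq_level : rank_level A1 K C = rank_level A2 K C.
  rewrite /rank_level (same_name g1 g2 mcC openC) ?(same_at_next g1 g2 (leqnn _)
    (same_name g1 g2)) //.
    by apply: same_le sC => //; rewrite /drop_radius /label_radius; nia.
  by apply: same_le sC => //; rewrite /drop_radius /label_radius; nia.
rewrite -eq_level; move: (rank_level A1 K C) le_T => t le_t {eq_level}.
have eq_w := same_window_sup g1 g2 _ (@same_rank A1 A2 t g1 g2).
have ge0 : (2 * K).+2 <= label_radius t by rewrite /label_radius; lia.
have le_t2 : label_radius t <= label_radius T by rewrite /label_radius; nia.
rewrite (eq_w ge0 C) //; last first.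
  by apply: same_le sC => //; rewrite /drop_radius /label_radius in le_t2 *; lia.
rewrite (same_at_next g1 g2 _ (eq_w ge0) mcC) //; first by rewrite /label_radius; lia.
by apply: same_le sC => //; rewrite /drop_radius /label_radius in le_t2 *; lia.
Qed.

End Local.

Section LocalOutput.

Variable K : nat.
Hypothesis K_gt1 : 1 < K.

Definition cut_radius T := (6 * K).+1 + drop_radius K T.

(** The witness of a cut may start arbitrarily far away. Its shortest final part that is not near is
    again a witness and starts one pointer before a near stretch, within [(6 * K).+1] of [C]. *)
Lemma same_cut_sub A1 A2 T C : graph A1 -> graph A2 ->
  (forall D, max_clique A1 D -> opened A1 K D -> same A1 A2 (drop_radius K T) D ->
    drop A1 K D = drop A2 K D) ->
  max_clique A1 C -> opened A1 K C -> same A1 A2 (cut_radius T) C ->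
  cut A1 K C -> cut A2 K C.
Proof.
move=> g1 g2 eq_drop mcC openC sC [dropC [D [l [[mcD openD] lC nodrop far]]]].
have ge_r : (6 * K).+3 <= drop_radius K T by rewrite /drop_radius /label_radius; lia.
have ex : exists j, `[< j <= l /\ near A1 K (iter j (next A1 K) D) (l - j) >].
  exists l; apply/asboolP; split=> //; rewrite subnn.
  have [mcl openl] := graph_iter K_gt1 l g1 mcD openD.
  by have [_ _ [N bA]] := g1; apply: (near0 bA K_gt1).
(* [j] starts the longest final stretch that is near. It is not 0, as the whole stretch is far, so a
   new witness can start at its predecessor. *)
have [j /asboolP[le_jl near_j] min_j] := ex_minnP ex.
case: j => [|i] in le_jl near_j min_j; first by rewrite subn0 in near_j.
set E := iter i (next A1 K) D; set P := next A1 K E in near_j *.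
set l' := l - i.+1 in near_j.
have eq_l : l = i + l'.+1 by rewrite /l'; lia.
have [mcE openE] : max_clique A1 E /\ opened A1 K E by apply: graph_iter.
have [mcP openP EP] := graph_next K_gt1 g1 mcE openE.
have farE : ~ near A1 K E l'.+1.
  move=> near_E; have : i.+1 <= i; last by rewrite ltnn.
  apply: min_j; apply/asboolP; split; first exact: ltnW.
  by rewrite eq_l addKn.
have iterE k : iter k (next A1 K) E = iter (i + k) (next A1 K) D by rewrite iterB.
have iterP k : iter k (next A1 K) P = iter k.+1 (next A1 K) E by rewrite iterSr.
have {}lC : block A1 K (iter l' (next A1 K) P) C by rewrite iterP iterE -eq_l.
have {}nodrop k : k < l'.+1 -> ~~ drop A1 K (iter k (next A1 K) E).
  by move=> lt_k; rewrite iterE nodrop // eq_l ltn_add2l.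
set P' := iter l' (next A1 K) P in lC.
have mcP' : max_clique A1 P' by case: (graph_iter K_gt1 l' g1 mcP openP).
have [symA reflA [N bA]] := g1.
have distPk k : k <= l' -> clique_dist A1 (2 * K) P (iter k (next A1 K) P).
  by move=> le_k; apply: (graph_near_dist K_gt1 g1 mcP openP near_j le_k).
have CP' : clique_dist A1 (2 * K) C P' by apply: clique_dist_sym => //;
  apply: block_dist.
have CP : clique_dist A1 (4 * K) C P.
  have -> : 4 * K = 2 * K + 2 * K by lia.
  by apply: clique_dist_add CP' _ => //; apply: clique_dist_sym => //; apply: distPk.
have CE : clique_dist A1 (6 * K).+1 C E.
  have -> : (6 * K).+1 = 4 * K + (2 * K).+1 by lia.
  by apply: clique_dist_add CP _ => //; apply: clique_dist_sym.
have CPk k : k <= l' -> clique_dist A1 (6 * K) C (iter k (next A1 K) P).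
  move=> le_k; have -> : 6 * K = 4 * K + 2 * K by lia.
  by apply: clique_dist_add CP _ => //; apply: distPk.
have sE : same A1 A2 (drop_radius K T) E by apply: (same_move g1 mcC mcE sC CE).
have sPk k : k <= l' -> same A1 A2 (drop_radius K T) (iter k (next A1 K) P).
  move=> le_k; have [mck _] := graph_iter K_gt1 k g1 mcP openP.
  by apply: (same_move g1 mcC mck sC (CPk k le_k)); rewrite /cut_radius; lia.
have sE4 : same A1 A2 (4 * K).+2 E by apply: same_le sE => //; lia.
have sE2 : same A1 A2 (2 * K).+2 E by apply: same_le sE => //; lia.
have mcE2 : max_clique A2 E.
  by apply: (same_max_clique g1 g2 _ mcE); apply: same_le sE => //; lia.
have openE2 : opened A2 K E by rewrite -(same_opened K_gt1 g1 g2 mcE sE2).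
have nextE : next A2 K E = P by rewrite -(same_next K_gt1 g1 g2 mcE sE2).
have sP4 : same A1 A2 (4 * K).+2 P by apply: same_le (sPk 0 _) => //; lia.
have [near2 eq_iter] := same_near K_gt1 g1 g2 mcP openP sP4 near_j.
have iter2 k : k <= l' -> iter k.+1 (next A2 K) E = iter k (next A1 K) P.
  by move=> le_k; rewrite iterSr nextE eq_iter // ltnW.
split.
  rewrite -eq_drop //; apply: same_le sC => //; rewrite /cut_radius; lia.
exists E, l'.+1; split=> // [|k lt_k|near2E].
- rewrite iter2 // -(same_block K_gt1 g1 g2) //; apply: same_le (sPk l' _) => //; lia.
- case: k lt_k => [|k] lt_k; first by rewrite -eq_drop ?(nodrop 0).
  have le_k : k <= l' by apply: ltnW.
  rewrite iter2 // -eq_drop; first by rewrite iterP nodrop.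
  + by case: (graph_iter K_gt1 k g1 mcP openP).
  + by case: (graph_iter K_gt1 k g1 mcP openP).
  + by apply: sPk.
- apply: farE.
  by case: (same_near K_gt1 g2 g1 mcE2 openE2 (same_sym sE4) near2E).
Qed.

Variables (A1 A2 : rel nat).
Hypothesis g1 : graph A1.
Hypothesis g2 : graph A2.
Variable T : nat.
Hypothesis class_le : forall C, max_clique A1 C -> opened A1 K C ->
  class_bound A1 K T C.

Let rank_level_le C : max_clique A1 C -> opened A1 K C -> rank_level A1 K C <= T.
Proof. by move=> mcC openC;
  rewrite geq_max (class_le mcC openC 0) (class_le mcC openC 1). Qed.

Let to2 r C : 2 * K + 2 <= r -> max_clique A1 C -> same A1 A2 r C ->
  max_clique A2 C /\ opened A1 K C = opened A2 K C.
Proof.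
move=> le_r mcC sC; split.
  by apply: (same_max_clique g1 g2 _ mcC); apply: same_le sC => //; lia.
by apply: same_opened => //; apply: same_le sC => //; lia.
Qed.

Let to1 r C : 2 * K + 2 <= r -> max_clique A2 C -> same A1 A2 r C ->
  max_clique A1 C /\ opened A1 K C = opened A2 K C.
Proof.
move=> le_r mcC /same_sym sC.
have mcC1 : max_clique A1 C by apply: (same_max_clique g2 g1 _ mcC);
  apply: same_le sC => //; lia.
by split=> //; apply/esym/same_opened => //; apply: same_le sC => //; lia.
Qed.

Let ge_drop : (6 * K).+3 <= drop_radius K T.
Proof. by rewrite /drop_radius /label_radius; lia. Qed.

Let ge_cut : (6 * K).+3 <= cut_radius T.
Proof. by rewrite /cut_radius; lia. Qed.

Lemma same_cut C : max_clique A1 C -> opened A1 K C -> same A1 A2 (cut_radius T) C ->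
  cut A1 K C <-> cut A2 K C.
Proof.
move=> mcC openC sC; split.
  apply: (@same_cut_sub _ _ T) => // D mcD openD sD.
  by apply: (@same_drop K K_gt1 _ _ T) => //; apply: rank_level_le.
have le_c : 2 * K + 2 <= cut_radius T by have := ge_cut; lia.
have [mcC2 eq_open] := to2 le_c mcC sC.
apply: (@same_cut_sub _ _ T) => //; [|by rewrite -eq_open|exact: same_sym].
move=> D mcD openD /same_sym sD.
have le_d : 2 * K + 2 <= drop_radius K T by have := ge_drop; lia.
have [mcD1 eq_openD] := to1 le_d mcD sD.
apply/esym/(@same_drop K K_gt1 _ _ T); rewrite ?eq_openD //.
by apply: rank_level_le; rewrite ?eq_openD.
Qed.

(** The number of windows in [cut_exists], turned into a distance by [jump_dist]. *)
Definition hit_radius := (3 * (T.+1 * 16) * (4 * K).+1).+1.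

Let cut_ex C : max_clique A1 C -> opened A1 K C -> exists u,
  cut A1 K (iter u (next A1 K) C).
Proof.
move=> mcC openC; have [_ _ [N bA]] := g1.
by have [u _ cut_u] := cut_exists bA K_gt1 mcC openC (class_le mcC openC); exists u.
Qed.

Lemma hit_dist C j : max_clique A1 C -> opened A1 K C -> j <= hit A1 K C ->
  clique_dist A1 hit_radius C (iter j (next A1 K) C).
Proof.
move=> mcC openC le_j; have [symA reflA [N bA]] := g1.
have [u lt_u cut_u] := cut_exists bA K_gt1 mcC openC (class_le mcC openC).
apply: (jump_dist symA reflA bA K_gt1) => //; apply: leq_trans le_j _.
apply: leq_trans (ltnW lt_u); rewrite leqNgt; apply/negP => lt_h.
by have [_ first_h] := hitP K_gt1 (cut_ex mcC openC); case: (first_h u lt_h).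
Qed.

Hypothesis cut_ex2 : forall C, max_clique A2 C -> opened A2 K C ->
  exists u, cut A2 K (iter u (next A2 K) C).

Definition landing_radius := hit_radius + cut_radius T.

Lemma same_hit C : max_clique A1 C -> opened A1 K C -> same A1 A2 landing_radius C ->
  hit A2 K C = hit A1 K C /\
  forall j, j <= hit A1 K C -> iter j (next A2 K) C = iter j (next A1 K) C.
Proof.
move=> mcC openC sC.
have mcj j : max_clique A1 (iter j (next A1 K) C)
  by case: (graph_iter K_gt1 j g1 mcC openC).
have openj j : opened A1 K (iter j (next A1 K) C)
  by case: (graph_iter K_gt1 j g1 mcC openC).
have sj j : j <= hit A1 K C -> same A1 A2 (cut_radius T) (iter j (next A1 K) C).
  by move=> le_j; apply: (same_move g1 mcC (mcj j) sC (hit_dist mcC openC le_j)).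
have eq_iter j : j <= hit A1 K C -> iter j (next A2 K) C = iter j (next A1 K) C.
  elim: j => // j IH lt_j; rewrite !iterS (IH (ltnW lt_j)); apply/esym/same_next => //.
  by apply: same_le (sj j (ltnW lt_j)) => //; have := ge_cut; lia.
split=> //; have [cut_h first_h] := hitP K_gt1 (cut_ex mcC openC).
apply: (hit_uniq K_gt1) => [|i lt_i].
  by rewrite eq_iter //; apply/same_cut => //; apply: sj.
rewrite eq_iter; last exact: ltnW.
by move=> cut_i; apply: (first_h i lt_i); apply/same_cut => //; apply/sj/ltnW.
Qed.

Lemma same_landing C : max_clique A1 C -> opened A1 K C ->
  same A1 A2 landing_radius C ->
  landing A2 K C = landing A1 K C.
Proof. by move=> mcC openC sC; have [eq_h eq_i] := same_hit mcC openC sC;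
  rewrite /landing eq_h eq_i. Qed.

Definition cluster_radius := 2 * hit_radius + (4 * K).+1 + landing_radius.

Lemma cluster_dist C D : max_clique A1 C -> cluster A1 K C D ->
  clique_dist A1 (2 * hit_radius + 2 * K) C D.
Proof.
move=> mcC [mcD [[nC CD]|[openC openD CD]]]; have [symA reflA [N bA]] := g1.
  by apply: clique_dist_le (block_dist symA reflA mcC CD); rewrite // leq_addl.
have mcL : max_clique A1 (landing A1 K C).
  by case: (graph_iter K_gt1 (hit A1 K C) g1 mcC openC).
have mcLD : max_clique A1 (landing A1 K D).
  by case: (graph_iter K_gt1 (hit A1 K D) g1 mcD openD).
have -> : 2 * hit_radius + 2 * K = (hit_radius + 2 * K) + hit_radius by lia.
apply: (clique_dist_add mcLD); last first.
  by apply: clique_dist_sym => //; apply: hit_dist.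
apply: (clique_dist_add mcL); first exact: hit_dist.
exact: block_dist CD.
Qed.

(** The delicate direction starts from a clique of the cluster in [A2], where no bound on names,
    hence no distance to the landing, is at hand. *)
Lemma same_cluster C : max_clique A1 C -> same A1 A2 cluster_radius C ->
  cluster A1 K C = cluster A2 K C.
Proof.
move=> mcC sC; have [symA reflA [N bA]] := g1.
have le_l : 2 * K + 2 <= landing_radius.
  by rewrite /landing_radius; have := ge_cut; lia.
have le_c : 2 * K + 2 <= cluster_radius by rewrite /cluster_radius; lia.
have [mcC2 eq_openC] := to2 le_c mcC sC.
have eq_block : block A1 K C = block A2 K C.
  by apply: same_block => //; apply: same_le sC => //; lia.
have sCl : same A1 A2 landing_radius C by apply: same_le sC => //;
  rewrite /cluster_radius; lia.
apply/funext => D; apply/propext; split=> CD.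
  have [mcD cases] := CD.
  have sD : same A1 A2 landing_radius D.
    by apply: (same_move g1 mcC mcD sC (cluster_dist mcC CD));
      rewrite /cluster_radius; lia.
  have [mcD2 eq_openD] := to2 le_l mcD sD.
  split=> //; case: cases => [[nC bCD]|[openC openD bCD]]; [left|right].
    by rewrite -eq_openC -eq_block.
  rewrite -eq_openC -eq_openD !same_landing //; split=> //.
  rewrite -(same_block K_gt1 g1 g2) //.
    by case: (graph_iter K_gt1 (hit A1 K C) g1 mcC openC).
  have mcL : max_clique A1 (landing A1 K C).
    by case: (graph_iter K_gt1 (hit A1 K C) g1 mcC openC).
  apply: (same_move g1 mcC mcL sC (hit_dist mcC openC (leqnn _))).
  by rewrite /cluster_radius; lia.
have [mcD2 [[nC bCD]|[openC2 openD2 bCD]]] := CD.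
  rewrite -eq_openC -eq_block in nC bCD; split; last by left.
  exact: block_max_clique bCD.
have openC : opened A1 K C by rewrite eq_openC.
have mcL : max_clique A1 (landing A1 K C).
  by case: (graph_iter K_gt1 (hit A1 K C) g1 mcC openC).
have CL := hit_dist mcC openC (leqnn _); rewrite -/(landing A1 K C) in CL.
have sL : same A1 A2 (cluster_radius - hit_radius) (landing A1 K C).
  by apply: (same_move g1 mcC mcL sC CL); rewrite /cluster_radius; lia.
rewrite (same_landing mcC openC sCl) -(same_block K_gt1 g1 g2) // in bCD; last first.
  by apply: same_le sL => //; rewrite /cluster_radius; lia.
set E := landing A2 K D in bCD; set h := hit A2 K D.
have mcE : max_clique A1 E by apply: block_max_clique bCD.
have sE : same A1 A2 (hit_radius + (2 * K).+1 + landing_radius) E.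
  apply: (same_move g1 mcL mcE sL (block_dist symA reflA mcL bCD)).
  by rewrite /cluster_radius; lia.
(* The path of [D] in [A2] is followed backwards from its landing [E]. Each predecessor is one
   pointer away from a clique near enough for comparison; so it lands at [E] in [A1] too, and
   [hit_dist] there brings it within [hit_radius] of [E]. *)
have back i : i <= h -> max_clique A1 (iter (h - i) (next A2 K) D) /\
    clique_dist A1 hit_radius E (iter (h - i) (next A2 K) D).
  elim: i => [_|i IH lt_i].
    by rewrite subn0; split=> //; apply: clique_dist_le (clique_dist1 mcE).
  have [mcY EY] := IH (ltnW lt_i).
  have [mcX openX] := graph_iter K_gt1 (h - i.+1) g2 mcD2 openD2.
  have eqY : iter (h - i) (next A2 K) D = next A2 K (iter (h - i.+1) (next A2 K) D).
    by rewrite -iterS; congr iter; lia.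
  have landX : landing A2 K (iter (h - i.+1) (next A2 K) D) = E.
    have [_ _ [N2 bA2]] := g2.
    exact: (landing_iter K_gt1 cut_ex2 mcD2 openD2 (leq_subr _ _)).
  rewrite eqY in mcY EY; set X :=
    iter (h - i.+1) (next A2 K) D in mcX openX mcY EY landX *.
  have [mcY2 openY2 XY] := graph_next K_gt1 g2 mcX openX.
  have sY : same A1 A2 ((2 * K).+1 + landing_radius) (next A2 K X).
    by apply: (same_move g1 mcE mcY sE EY); lia.
  have sX : same A1 A2 landing_radius X.
    apply/same_sym/(same_move g2 mcY2 mcX (same_sym sY) (clique_dist_sym _ XY)) => //.
    by have [] := g2.
  have [mcX1 eq_openX] := to1 le_l mcX sX.
  have openX1 : opened A1 K X by rewrite eq_openX.
  have landX1 : landing A1 K X = E by rewrite -same_landing.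
  by split=> //; apply: clique_dist_sym => //; rewrite -landX1; apply: hit_dist.
have [] := back h (leqnn h); rewrite subnn /= => mcD ED.
have sD : same A1 A2 landing_radius D.
  by apply: (same_move g1 mcE mcD sE ED); lia.
have [_ eq_openD] := to1 le_l mcD2 sD.
have openD : opened A1 K D by rewrite eq_openD.
by split=> //; right; split=> //; rewrite -(same_landing mcD openD sD).
Qed.

Definition output_radius := cluster_radius + (2 * hit_radius + 2 * K) + 4.

Lemma same_inner C : max_clique A1 C ->
  same A1 A2 (cluster_radius + (2 * hit_radius + 2 * K) + 2) C ->
  inner A1 (cluster A1 K C) = inner A2 (cluster A2 K C) /\
  forall x, inner A1 (cluster A1 K C) x -> A1 x =1 A2 x.
Proof.
move=> mcC sC; have eq_cl : cluster A1 K C = cluster A2 K C.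
  by apply: same_cluster => //; apply: same_le sC => //; lia.
have sD D : cluster A1 K C D -> same A1 A2 2 D.
  move=> CD; have [mcD _] := CD.
  by apply: (same_move g1 mcC mcD sC (cluster_dist mcC CD));
    rewrite /cluster_radius; lia.
have mc12 D x : cluster A1 K C D -> x \in D -> forall E, x \in E ->
    max_clique A1 E <-> max_clique A2 E.
  move=> CD Dx E Ex; have := sD D CD x Dx => agr_x; split=> mcE.
    apply: (same_max_clique g1 g2 _ mcE) => y Ey; apply: agree_step agr_x _.
    by have [_ clE _] := mcE; apply: clE.
  apply: (same_max_clique g2 g1 _ mcE) => y Ey; apply/agree_sym/(agree_step agr_x).
  by rewrite (agree_eq agr_x); have [_ clE _] := mcE; apply: clE.
split; last first.
  move=> x [[D mcD Dx] all_x]; exact: agree_eq (sD D (all_x D mcD Dx) x Dx).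
rewrite -eq_cl; apply/funext => x; apply/propext; split=> -[[D mcD Dx] all_x].
  have CD := all_x D mcD Dx; split; first by exists D => //;
    apply/(mc12 D x CD Dx D Dx).
  by move=> E mcE Ex; apply: (all_x E _ Ex); apply/(mc12 D x CD Dx E Ex).
have CD := all_x D mcD Dx; split; first by exists D => //; apply/(mc12 D x CD Dx D Dx).
by move=> E mcE Ex; apply: (all_x E _ Ex); apply/(mc12 D x CD Dx E Ex).
Qed.

Lemma same_output x : agree A1 A2 output_radius x -> output A1 K x <-> output A2 K x.
Proof.
move=> agr_x.
have sC C : x \in C -> (max_clique A1 C \/ max_clique A2 C) ->
    same A1 A2 (cluster_radius + (2 * hit_radius + 2 * K) + 3) C.
  move=> Cx mcC y Cy; apply: (agree_step (x := x)); first by rewrite -addnS.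
  case: mcC => -[_ clC _]; first exact: clC.
  by rewrite (agree_eq agr_x); apply: clC.
have mc12 C : x \in C -> max_clique A1 C <-> max_clique A2 C.
  move=> Cx; split=> mcC.
    apply: (same_max_clique g1 g2 _ mcC); apply: (same_le mcC _ (sC C Cx _));
      [lia|by left].
  apply: (same_max_clique g2 g1 _ mcC);
    apply: (same_le mcC _ (same_sym (sC C Cx _))); [lia|by right].
have key C : x \in C -> max_clique A1 C ->
    inner A1 (cluster A1 K C) = inner A2 (cluster A2 K C) /\
    best_in A1 (inner A1 (cluster A1 K C)) = best_in A2 (inner A2 (cluster A2 K C)).
  move=> Cx mcC; have [|eq_inner eqA] := @same_inner C mcC.
    by apply: (same_le mcC _ (sC C Cx _)); [lia|left].
  split=> //; rewrite -eq_inner; set P := inner A1 _ in eqA *.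
  have ind12 S : independent_in A1 P S = independent_in A2 P S.
    apply/propext; split=> -[SP indS]; split=> // y z Sy Sz neq.
      by rewrite -(eqA _ (SP y Sy)); apply: indS.
    by rewrite (eqA _ (SP y Sy)); apply: indS.
  rewrite /best_in; congr xget; apply/funext => S; apply/propext.
  split=> -[indS maxS]; split=> [|S' indS'].
  - by rewrite -ind12.
  - by apply: maxS; rewrite ind12.
  - by rewrite ind12.
  - by apply: maxS; rewrite -ind12.
split=> -[C [mcC Cx inC bestC]].
  have [eq_inner eq_best] := key C Cx mcC.
  by exists C; rewrite -eq_best -eq_inner; split=> //; apply/mc12.
have mcC1 : max_clique A1 C by apply/mc12.
have [eq_inner eq_best] := key C Cx mcC1.
by exists C; rewrite eq_best eq_inner.
Qed.

End LocalOutput.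

(** * The full-information algorithm *)

Inductive view := Leaf of nat & seq nat | Round of view & seq (nat * view).

Definition gather (dec : view -> option bool) : local_algorithm :=
  LocalAlgorithm Leaf (fun q _ => q) Round dec.

Fixpoint view_after (T : finType) (e : rel T) (id : T -> nat) t v : view :=
  if t is t'.+1 then Round (view_after e id t' v)
    [seq (id w, view_after e id t' w) | w <- neighbours e id v]
  else Leaf (id v) [seq id w | w <- neighbours e id v].

Lemma state_after_gather dec (T : finType) (e : rel T) id t v :
  state_after (gather dec) e id t v = view_after e id t v.
Proof.
elim: t v => [//|t IH] v /=; congr Round; first exact: IH.
by apply: eq_map => w; rewrite IH.
Qed.

Fixpoint view_depth q := if q is Round q' _ then (view_depth q').+1 else 0.

Lemma view_depth_after (T : finType) (e : rel T) id t v :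
  view_depth (view_after e id t v) = t.
Proof. by elim: t => //= t ->. Qed.

Lemma mem_neighbours (T : finType) (e : rel T) id v w :
  (w \in neighbours e id v) = e v w.
Proof. by rewrite mem_sort mem_enum. Qed.

Lemma eq_map_mem (T T' : eqType) U (f : T -> U) (g : T' -> U) s s' x :
  map f s = map g s' -> x \in s -> exists2 y, y \in s' & f x = g y.
Proof.
elim: s s' => [|z s IH] [|z' s'] //= [eq_z /IH{}IH].
rewrite inE => /predU1P[->|/IH[y sy eq_xy]]; first by exists z'; rewrite ?mem_head.
by exists y; rewrite // inE sy orbT.
Qed.

(** The leaves list the identifiers of neighbours, and each round brings in the previous views of
    the neighbours; so [t] rounds reveal all neighbourhoods within distance [t]. *)
Lemma view_agree (T T' : finType) (e : rel T) (e' : rel T') id id' t v v' :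
  injective id -> injective id' -> view_after e id t v = view_after e' id' t v' ->
  id v = id' v' /\ agree (id_graph e id) (id_graph e' id') t (id v).
Proof.
move=> inj inj'.
have adj (U : finType) (f : rel U) (j : U -> nat) u m : injective j ->
    id_graph f j (j u) m = (m == j u) || (m \in [seq j w | w <- neighbours f j u]).
  move=> inj_j; apply/idP/idP => [um|/orP[/eqP->|/mapP[w]]].
  - have [_ [w [_ eqm]]] := id_graphP um; rewrite eqm id_graphE // in um *.
    rewrite (inj_eq inj_j) eq_sym; case/orP: um => [->//|uw].
    by rewrite map_f ?orbT // mem_neighbours.
  - by rewrite id_graphE ?eqxx.
  - by rewrite mem_neighbours => uw ->; rewrite id_graphE // uw orbT.
elim: t v v' => [|t IH] v v' /=.
  by case=> eq_id eq_nbr; split=> //; split=> // m;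
    rewrite adj // {2}eq_id adj // eq_id eq_nbr.
case=> /IH[eq_id agr] eq_in; split=> //; split=> [|y]; first exact: agree_eq agr.
rewrite adj // => /orP[/eqP->//|/mapP[w vw ->]].
by have [w' _ [_ /IH[]]] := eq_map_mem eq_in vw.
Qed.

Section Simulation.

Variables (c : nat) (out : forall (T : finType) (e : rel T) (id : T -> nat), T -> bool).

Definition valid (T : finType) (e : rel T) (id : T -> nat) :=
  [/\ simple_graph e, chordal e & id_assignment c id].

Definition forced q b := forall (T : finType) (e : rel T) (id : T -> nat) t v,
  valid e id -> view_after e id t v = q -> out e id v = b.

(* This needs no bound on the size of the network: [forced] ranges over all
   networks in which the view can occur. *)
Definition answer q : option bool :=
  if pselect (exists b, forced q b) is left ex then Some (projT1 (cid ex)) else None.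

Lemma answer_correct (T : finType) (e : rel T) (id : T -> nat) t v b : valid e id ->
  answer (view_after e id t v) = Some b -> b = out e id v.
Proof.
rewrite /answer => val; case: pselect => // ex [<-].
by case: (cid ex) => b' /= /(_ T e id t v val erefl).
Qed.

(** An answer given before round [r] is right as well, since it was forced; so the write-once
    register does no harm. *)
Lemma gather_computes (T : finType) (e : rel T) (id : T -> nat) r : valid e id ->
  (forall v, exists b, forced (view_after e id r v) b) ->
  computes_in (gather answer) e id r [set v | out e id v].
Proof.
move=> val ex v; rewrite inE.
have sound t : output_after (gather answer) e id t v = None \/
    output_after (gather answer) e id t v = Some (out e id v).
  have dec t' : decide (state_after (gather answer) e id t' v) = None \/
      decide (state_after (gather answer) e id t' v) = Some (out e id v).
    rewrite state_after_gather /=; case eq_ans : (answer _) => [b|]; last by left.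
    by right; rewrite (answer_correct val eq_ans).
  elim: t => [|t IH] /=; first exact: (dec 0).
  by case: IH => ->; [apply: (dec t.+1)|right].
have now : decide (state_after (gather answer) e id r v) = Some (out e id v).
  rewrite state_after_gather /=; case eq_ans : (answer _) => [b|].
    by rewrite (answer_correct val eq_ans).
  by move: eq_ans; rewrite /answer; case: pselect => // -[]; apply: ex.
have [none|//] := sound r.
case: r {ex} now none => [|r] now /=; first by move=> none; rewrite -now.
by case: (output_after _ _ _ r v) => // _; rewrite -now.
Qed.

End Simulation.

(** * The number of rounds *)

Lemma tower_class_le n g : n < 2 ^ tower g -> tower_class n <= g.
Proof. by rewrite /tower_class => lt_n; case: ex_minnP => h _; apply. Qed.

Lemma tower_class_mono m n : m <= n -> tower_class m <= tower_class n.
Proof.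
move=> le_mn; apply: tower_class_le; apply: leq_ltn_trans le_mn _.
by rewrite /tower_class; case: ex_minnP.
Qed.

Lemma class_bound_ge A K N C : 1 < K -> graph A -> (forall x y, A x y -> x < N) ->
  max_clique A C -> opened A K C -> class_bound A K (tower_class (2 ^ N)) C.
Proof.
move=> K_gt1 g bA mcC openC j; apply: tower_class_mono; apply: code_lt.
have [mcj openj] := graph_iter K_gt1 j g mcC openC.
have [[jO _ _] _] := exitP bA openj.
by apply: (max_clique_bound bA); apply: block_max_clique jO.
Qed.

Lemma graph_cut_ex A K C : 1 < K -> graph A -> max_clique A C -> opened A K C ->
  exists u, cut A K (iter u (next A K) C).
Proof.
move=> K_gt1 g mcC openC; have [_ _ [N bA]] := g.
have [u _ cut_u] := cut_exists bA K_gt1 mcC openC (class_bound_ge K_gt1 g bA mcC openC).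
by exists u.
Qed.

Lemma id_graph_graph (T : finType) (e : rel T) id : simple_graph e -> injective id ->
  graph (id_graph e id).
Proof.
move=> simple_e inj_id; split.
- exact: id_graph_sym.
- exact: id_graph_refl.
- by exists (id_bound id) => x y; apply: id_graph_bound.
Qed.

Lemma agree_isolated (A1 A2 : rel nat) r x : (forall y, A1 x y -> y = x) ->
  agree A1 A2 0 x -> agree A1 A2 r x.
Proof.
move=> iso agr; elim: r => [//|r IH]; split; first exact: agree_eq agr.
by move=> y /iso ->.
Qed.

(** For at most one node the iterated logarithm is 0 and the bound allows no round; the initial
    state then suffices. Otherwise identifiers are below [(n ^ c).+1], which bounds the names. *)
Definition rounds c K n :=
  if n <= 1 then 0 else output_radius K (tower_class (2 ^ (n ^ c).+1)).

Definition joins K (T : finType) (e : rel T) (id : T -> nat) (v : T) :=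
  `[< output (id_graph e id) K (id v) >].

(** The competing network may have any size: [same_output] asks for a bound on the names in the
    first graph only, and the depth of the view fixes the round. *)
Lemma joins_forced c K (T : finType) (e : rel T) id v : 1 < K -> valid c e id ->
  exists b, forced c (joins K) (view_after e id (rounds c K #|T|) v) b.
Proof.
move=> K_gt1 [simple_e chordal_e [inj_id range_id]].
exists (joins K e id v) => T' e' id' t' v' [simple_e' _ [inj_id' _]] eq_view.
have eq_t : t' = rounds c K #|T|.
  by rewrite -(view_depth_after e' id' t' v') eq_view view_depth_after.
rewrite eq_t in eq_view; have [eq_id agr] := view_agree inj_id inj_id' (esym eq_view).
have g1 := id_graph_graph simple_e inj_id; have g2 := id_graph_graph simple_e' inj_id'.
have bA n m : id_graph e id n m -> n < (#|T| ^ c).+1.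
  by move=> /id_graphP[w [_ [-> _]]]; rewrite ltnS; case/andP: (range_id w).
have agr' : agree (id_graph e id) (id_graph e' id')
    (output_radius K (tower_class (2 ^ (#|T| ^ c).+1))) (id v).
  move: agr; rewrite /rounds; case: leqP => // le1; apply: agree_isolated.
  move=> y /id_graphP[w [w' [_ ->]]]; congr id.
  exact: (fintype_le1P le1).
rewrite /joins -eq_id; apply/esym/asbool_equiv_eq.
apply: (same_output K_gt1 g1 g2 _ _ agr') => C.
- exact: class_bound_ge.
- exact: graph_cut_ex.
Qed.

Fixpoint power_tower k := if k is k'.+1 then 2 ^ power_tower k' else 1.

(** The head start of [2 * c + 5] levels makes up for the decrements in [tower] and for the exponent
    [c]. The additive [c + 5] carries the induction, as [2 ^ (c * p + c + 4)] splits into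
    [16 * (2 ^ c * 2 ^ (c * p))]. *)
Lemma power_tower_le c k : c * power_tower k + c + 5 <= tower (k + (2 * c + 5)).
Proof.
elim: k => [|k IH]; first by rewrite add0n muln1; have := tower_gt (2 * c + 5); lia.
rewrite addSn [tower _]/= [power_tower _]/=.
move: (tower _) (power_tower k) IH => t p IH.
have : 2 ^ (c * p + c + 4) <= 2 ^ t.-1 by rewrite leq_exp2l //; lia.
have : 2 ^ (c * p + c + 4) = 16 * (2 ^ c * 2 ^ (c * p)).
  by rewrite !expnD; nia.
case: c {IH} => [|c]; first by rewrite !mul0n expn0; lia.
have : 2 ^ p <= 2 ^ (c.+1 * p) by rewrite leq_exp2l // mulSn leq_addr.
have := ltn_expl c.+1 (leqnn 2); have := expn_gt0 2 p; nia.
Qed.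

Lemma power_tower_class c k n : n <= power_tower k.+1 ->
  tower_class (2 ^ (n ^ c).+1) <= k.+1 + (2 * c + 5).
Proof.
move=> le_n; apply: tower_class_le; rewrite ltn_exp2l //.
have le_nc : n ^ c <= 2 ^ (c * power_tower k).
  by case: c => // c; rewrite mulnC expnM leq_exp2r.
rewrite addSn [tower _]/=; have := power_tower_le c k.
move: (tower _) (power_tower k) le_nc => t p le_nc le_t.
have : 2 ^ (c * p + c + 4) <= 2 ^ t.-1 by rewrite leq_exp2l //; lia.
rewrite !expnD; have := expn_gt0 2 c; have := expn_gt0 2 (c * p); nia.
Qed.

Lemma rounds_le c : exists2 D, 0 < D & forall K n, 1 < K -> 1 < n ->
  rounds c K n <= D * (K * (tower_class (2 ^ (n ^ c).+1)).+1).
Proof.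
(* A generous constant: five times [hit_radius] dominates, about [240 * (4 * K + 1) * T.+1], which
   is at most [1080 * K * T.+1]. *)
exists 2000 => // K n K_gt1 n_gt1; rewrite /rounds [n <= 1]leqNgt n_gt1 /=.
move: (tower_class _) => T.
rewrite /output_radius /cluster_radius /landing_radius /cut_radius /drop_radius.
by rewrite /label_radius /hit_radius; nia.
Qed.

Section Rounds.

Variables (R : realType).
Local Open Scope ring_scope.

Lemma iter_log2_le k (x : R) : iter k (@log2 R) x <= 1 -> x <= (power_tower k)%:R.
Proof.
elim: k x => [//|k IH] x; rewrite iterSr => /IH le_log.
have [x_le0|x_gt0] := leP x 0; first exact: le_trans x_le0 (ler0n _ _).
have ln2_gt0 : 0 < ln 2 :> R by rewrite ln_gt0 ?ltr1n.
move: le_log; rewrite /log2 ler_pdivrMr // mulr_natl -lnXn ?ltr0n //.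
by rewrite ler_ln ?posrE ?exprn_gt0 ?ltr0n // /= natrX.
Qed.

Lemma log_star_class c n : (1 < n)%N ->
  ((tower_class (2 ^ (n ^ c).+1)).+1 <= (2 * c + 7) * log_star R n)%N.
Proof.
move=> n_gt1; rewrite /log_star; case: ex_minnP => [[|k]] le_log _.
  by move: le_log; rewrite /= lern1 leqNgt n_gt1.
have le_n : (n <= power_tower k.+1)%N.
  by rewrite -(ler_nat R); apply: iter_log2_le.
have := power_tower_class c le_n; nia.
Qed.

Lemma rounds_log_star c : exists2 D, (0 < D)%N & forall K n, (1 < K)%N -> (1 < n)%N ->
  (rounds c K n <= D * (K * log_star R n))%N.
Proof.
have [D D_gt0 le_D] := rounds_le c; exists (D * (2 * c + 7))%N.
  by rewrite muln_gt0 D_gt0 addn_gt0 orbT.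
move=> K n K_gt1 n_gt1; apply: leq_trans (le_D K n K_gt1 n_gt1) _.
by rewrite -mulnA leq_mul // [leqRHS]mulnCA leq_mul // log_star_class.
Qed.

End Rounds.

Local Open Scope ring_scope.

Theorem theorem25 (R : realType) (c : nat) :
  exists C : R, 0 < C /\
  forall eps : R, 0 < eps < 1 / 2 ->
  exists A : local_algorithm,
  forall (T : finType) (e : rel T) (id : T -> nat),
    simple_graph e -> chordal e -> id_assignment c id ->
  exists (r : nat) (I : {set T}),
    [/\ computes_in A e id r I,
        independent e I,
        (alpha e)%:R <= (1 + eps) * #|I|%:R &
        r%:R <= C * (1 / eps * ln (1 / eps) * (log_star R #|T|)%:R)].
Proof.
have ln2_gt0 : 0 < ln 2 :> R by rewrite ln_gt0 ?ltr1n.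
have [D D_gt0 le_D] := rounds_log_star R c.
(* The 5 comes from [K <= 5 / eps], the division from [ln 2 <= ln (1 / eps)]. *)
exists (5 * D%:R / ln 2); split; first by rewrite divr_gt0 // mulr_gt0 // ltr0n.
move=> eps /andP[eps_gt0 eps_lt].
(* [K - 2 = k.+1] exceeds [2 / eps], while [K] is at most [2 / eps + 3], hence at most [5 / eps]. *)
pose k := Num.truncn (2 / eps); pose K := k.+3.
have K_gt1 : (1 < K)%N by [].
have eps2_ge0 : 0 <= 2 / eps by rewrite divr_ge0 // ltW.
have lt_k : 2 / eps < k.+1%:R by rewrite truncnS_gt.
have le_k : k%:R <= 2 / eps by rewrite truncn_le.
exists (gather (answer c (joins K))) => T e id simple_e chordal_e id_c.
have val : valid c e id by split.
have [inj_id range_id] := id_c.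
have cut_ex C : max_clique (id_graph e id) C -> opened (id_graph e id) K C ->
    exists u, cut (id_graph e id) K (iter u (next (id_graph e id) K) C).
  by apply: graph_cut_ex => //; apply: id_graph_graph.
have eq_out : [set v | joins K e id v] = output_set e id K.
  by apply/setP => v; rewrite !inE.
exists (rounds c K #|T|), (output_set e id K); split.
- by rewrite -eq_out; apply: gather_computes => // v; apply: joins_forced.
- exact: (output_independent simple_e inj_id).
- have [|O indO eq_alpha] :=
    @bigop.eq_bigmax_cond _ (fun S => independent e S) (fun S => #|S|).
    by apply/card_gt0P; exists finset.set0; apply/forall_inP => x; rewrite inE.
  rewrite (eq_alpha : alpha e = _).
  have [m []] := output_approx simple_e chordal_e inj_id K_gt1 cut_ex indO.
  move: #|_| #|_| => i o le_o le_m.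
  (* Subtracting [2 * m] from both sides leaves [m * (K - 2)]; with [2 < eps * k.+1] the loss
     [2 * m] is at most [eps * i]. *)
  have {}le_m : (m * k.+1 <= i)%N by rewrite /K in le_m; nia.
  have : (o%:R : R) <= i%:R + 2 * m%:R.
    by move: le_o; rewrite -(ler_nat R) natrD natrM.
  move/le_trans; apply.
  rewrite [(1 + eps) * _]mulrDl mul1r lerD2l.
  have : (m%:R * k.+1%:R : R) <= i%:R by rewrite -natrM ler_nat.
  have : 2 < eps * k.+1%:R by rewrite mulrC -ltr_pdivrMr.
  have : 0 <= m%:R :> R by [].
  nra.
- have [le1|gt1] := leqP #|T| 1.
    rewrite /rounds le1; apply: mulr_ge0; first by rewrite divr_ge0 // ltW.
    rewrite mulr_ge0 // mulr_ge0 //; first by rewrite divr_ge0 // ltW.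
    by rewrite ln_ge0 // ler_pdivlMr // mul1r; lra.
  have le_r := le_D K _ K_gt1 gt1.
  have le_K : K%:R <= 5 / eps :> R.
    have : 3 <= 3 / eps :> R by rewrite ler_pdivlMr //; lra.
    have -> : 5 / eps = 3 / eps + 2 / eps :> R by rewrite -mulrDl; congr (_ / _); lra.
    have -> : K%:R = 3 + k%:R :> R by rewrite -natrD.
    lra.
  (* The rounds are already bounded by a multiple of [1 / eps] times the iterated logarithm; the
     factor [ln (1 / eps) / ln 2], at least 1 because [eps < 1 / 2], is multiplied in. *)
  have le_ln : ln 2 <= ln (1 / eps).
    by rewrite ler_ln ?posrE ?divr_gt0 // ler_pdivlMr //; lra.
  have := le_r; rewrite -(ler_nat R) => /le_trans; apply.
  have -> : 5 * D%:R / ln 2 * (1 / eps * ln (1 / eps) * (log_star R #|T|)%:R) =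
      D%:R * (5 / eps * (log_star R #|T|)%:R) * (ln (1 / eps) / ln 2) :> R.
    by field; rewrite (gt_eqF ln2_gt0) (gt_eqF eps_gt0).
  rewrite -[leLHS]mulr1; apply: ler_pM => //;
    last by rewrite ler_pdivlMr // [1 * ln 2]mul1r.
  by rewrite 2!natrM ler_wpM2l // ler_wpM2r.
Qed.
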